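(* Let $A$ be a unital algebra with differential graded algebra $(\Omega,\mathrm d)$, let $(\nabla,\sigma)$ be a bimodule connection on $\Omega^1$ that is torsion free, flat, $\wedge$-compatible, extendable and Leibniz compatible, and let $(\nabla_E,\sigma_E)$ be a bimodule connection on an $A$-bimodule $E$ that is flat, extendable and Leibniz compatible. For $k\ge0$ let $$\mathcal J^k_E=E\oplus\Omega^1_S\otimes_AE\oplus\cdots\oplus\Omega^k_S\otimes_AE,\qquad j^k_E:E\to\mathcal J^k_E,\quad j^k_E(s)=s+\nabla^1_Es+\cdots+\nabla^k_Es .$$ Then $\mathcal J^k_E$ is an $A$-bimodule, and $j^k_E$ is a (well-defined) bimodule map from $E$, with respect to the left and right actions $\bullet_k$ given for $a\in A$, $\omega_j\in\Omega^j_S$, $s\in E$, $j=0,\dots,k$, by $$a\bullet_k(\omega_j\otimes s)=j^{k-j}(a)\odot_E(\omega_j\otimes s)=\sum_{i=j}^k\nabla^{i-j}a\odot_E(\omega_j\otimes s),$$ $$(\omega_j\otimes s)\bullet_ka=(\omega_j\otimes s)\odot_Ej^{k-j}(a)=\sum_{i=j}^k(\omega_j\otimes s)\odot_E\nabla^{i-j}a .$$ Moreover, for $k\ge1$, quotienting out $\Omega^k_S\otimes_AE$ gives a bimodule map surjection $\pi_k:\mathcal J^k_E\to\mathcal J^{k-1}_E$ (for $\bullet_k$, $\bullet_{k-1}$) such that $\pi_k\circ j^k_E=j^{k-1}_E$.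
   Context: Everything is over a field. $A$ is a unital algebra and $(\Omega=\oplus_n\Omega^n,\mathrm d)$ is a differential graded algebra with $\Omega^0=A$, product $\wedge$, $\mathrm d$ of degree $1$ with $\mathrm d^2=0$ and the graded Leibniz rule, and $\Omega$ generated by $A,\mathrm dA$. $\Omega^{1\otimes_An}$ is the $n$-fold tensor power over $A$ (degree zero: $A$). Lower indices indicate position: $\wedge_i,\sigma_i,\sigma_{E,i}$ are $\wedge,\sigma,\sigma_E$ applied in tensor factors $i,i+1$. A bimodule connection on an $A$-bimodule $E$ is a linear map $\nabla_E:E\to\Omega^1\otimes_AE$ and a bimodule map $\sigma_E:E\otimes_A\Omega^1\to\Omega^1\otimes_AE$ with $\nabla_E(as)=\mathrm da\otimes s+a\nabla_Es$ and $\nabla_E(sa)=(\nabla_Es)a+\sigma_E(s\otimes\mathrm da)$. For $E=\Omega^1$ write $(\nabla,\sigma)$. Set $\nabla_0=\mathrm d$, $\nabla_1=\nabla$, $\nabla_n=\nabla\otimes\mathrm{id}^{n-1}+\sigma_1(\mathrm{id}\otimes\nabla_{n-1})$ on $\Omega^{1\otimes_An}$; and $\nabla_{(0,E)}=\nabla_E$, $\nabla_{(n,E)}=\nabla\otimes\mathrm{id}^{n-1}\otimes\mathrm{id}_E+\sigma_1(\mathrm{id}\otimes\nabla_{(n-1,E)}):\Omega^{1\otimes_An}\otimes_AE\to\Omega^{1\otimes_A(n+1)}\otimes_AE$. Conditions on $\nabla$: torsion free: $\wedge\nabla=\mathrm d$; flat: $(\mathrm d\otimes\mathrm{id}-\mathrm{id}\wedge\nabla)\nabla=0$;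 $\wedge$-compatible: $\nabla_{\Omega^2}(\eta\wedge\omega):=(\nabla\eta)\wedge\omega+\wedge_2\sigma_1(\eta\otimes\nabla\omega)$ is a well-defined bimodule connection on $\Omega^2$; extendable: $\omega\otimes\eta\wedge\zeta\mapsto\wedge_1\sigma_2\sigma_1(\omega\otimes\eta\otimes\zeta)$ is a well-defined bimodule map $\Omega^1\otimes_A\Omega^2\to\Omega^2\otimes_A\Omega^1$; Leibniz compatible: $\nabla_2\sigma_1=\sigma_2\nabla_2$ on $\Omega^1\otimes_A\Omega^1$. Conditions on $\nabla_E$: flat: $(\mathrm d\otimes\mathrm{id}-\mathrm{id}\wedge\nabla_E)\nabla_E=0:E\to\Omega^2\otimes_AE$; extendable: $s\otimes\eta\wedge\zeta\mapsto\wedge_1\sigma_{E,2}\sigma_{E,1}(s\otimes\eta\otimes\zeta)$ is a well-defined bimodule map $E\otimes_A\Omega^2\to\Omega^2\otimes_AE$; Leibniz compatible: $\nabla_{(1,E)}\sigma_E=\sigma_{E,2}\big(\nabla_E\otimes\mathrm{id}+\sigma_{E,1}(\mathrm{id}_E\otimes\nabla)\big)$ as maps $E\otimes_A\Omega^1\to\Omega^1\otimes_A\Omega^1\otimes_AE$ (this implies the coloured braid relations $\sigma_1\sigma_{E,2}\sigma_{E,1}=\sigma_{E,2}\sigma_{E,1}\sigma_2$ on $E\otimes_A\Omega^1\otimes_A\Omega^1$). Quantum symmetric forms: $\Omega^0_S=A$, $\Omega^1_S=\Omega^1$, $\Omega^k_S=\bigcap_{i<k}\ker\wedge_i\subseteq\Omega^{1\otimes_Ak}$.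 Iterated derivatives: $\nabla^0=\mathrm{id}_A$, $\nabla^na=\nabla_{n-1}\cdots\nabla_1\mathrm da$; $\nabla^0_E=\mathrm{id}_E$, $\nabla^n_Es=\nabla_{(n-1,E)}\cdots\nabla_{(0,E)}s$. Also $j^k(a)=\sum_{i=0}^k\nabla^ia$. Braided binomials: $\left[{n\atop0},\sigma\right]=\left[{n\atop n},\sigma\right]=\mathrm{id}^n$, $\left[{n\atop k},\sigma\right]=\left(\mathrm{id}\otimes\left[{n-1\atop k-1},\sigma\right]\right)\sigma_1\cdots\sigma_{n-k}+\mathrm{id}\otimes\left[{n-1\atop k},\sigma\right]$ for $0<k<n$. Product on $\Omega_S=\oplus_k\Omega^k_S$: $\odot=\left[{i+j\atop j},\sigma\right]:\Omega^i_S\otimes_A\Omega^j_S\to\Omega^{i+j}_S$. Let $\sigma_{E,\Omega_S}:E\otimes_A\Omega_S\to\Omega_S\otimes_AE$ be given in degree $n$ by $\sigma^n_E=\sigma_{E,n}\cdots\sigma_{E,1}$. The $\Omega_S$-actions on $\Omega_S\otimes_AE$ are $\eta\odot_E(\omega\otimes s)=\eta\odot\omega\otimes s$ and $(\omega\otimes s)\odot_E\eta=(\odot\otimes\mathrm{id}_E)\big(\omega\otimes\sigma_{E,\Omega_S}(s\otimes\eta)\big)$.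
   Formalization: The summands Ω^k_S⊗_A E are read as the joint kernel of the ∧_i⊗id_E in the k-fold tensor power of Ω^1 tensored with E; the literal summands are covered when the canonical maps identify them with these kernels (e.g. E left flat), as otherwise j^k_E is not well defined. *)

(* Defs.v *)
From HB Require Import structures.
From mathcomp Require Import all_boot all_algebra.
From mathcomp Require Import boolp.

Set Implicit Arguments.
Unset Strict Implicit.
Unset Printing Implicit Defensive.

Import GRing.Theory.
Local Open Scope ring_scope.
Local Open Scope quotient_scope.

Section Bimodules.
Context {K : fieldType} {A : algType K}.

Record bimod_axioms (V : lmodType K) (l : A -> V -> V) (r : V -> A -> V) : Prop :=
  BimodAxioms {
  ax_lDl : forall a b x, l (a + b) x = l a x + l b x;
  ax_lDr : forall a x y, l a (x + y) = l a x + l a y;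
  ax_lZl : forall (c : K) a x, l (c *: a) x = c *: l a x;
  ax_lZr : forall (c : K) a x, l a (c *: x) = c *: l a x;
  ax_l1 : forall x, l 1 x = x;
  ax_lM : forall a b x, l (a * b) x = l a (l b x);
  ax_rDl : forall x y a, r (x + y) a = r x a + r y a;
  ax_rDr : forall x a b, r x (a + b) = r x a + r x b;
  ax_rZl : forall (c : K) x a, r (c *: x) a = c *: r x a;
  ax_rZr : forall (c : K) x a, r x (c *: a) = c *: r x a;
  ax_r1 : forall x, r x 1 = x;
  ax_rM : forall x a b, r x (a * b) = r (r x a) b;
  ax_lr : forall a x b, r (l a x) b = l a (r x b) }.

Record bimod := Bimod {
  bimod_car :> lmodType K;
  lact : A -> bimod_car -> bimod_car;
  ract : bimod_car -> A -> bimod_car;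
  bimodP : bimod_axioms lact ract }.

Definition bimod_map_for (V W : lmodType K) (lV : A -> V -> V) (rV : V -> A -> V)
    (lW : A -> W -> W) (rW : W -> A -> W) (f : V -> W) : Prop :=
  [/\ linear f, forall a x, f (lV a x) = lW a (f x)
    & forall x a, f (rV x a) = rW (f x) a].

Definition bimod_map (M N : bimod) (f : M -> N) : Prop :=
  bimod_map_for (@lact M) (@ract M) (@lact N) (@ract N) f.

End Bimodules.
Arguments bimod {K} A.
Arguments bimod_map {K A M N} f.

Infix "<*" := lact (at level 40, left associativity) : ring_scope.
Infix "*>" := ract (at level 40, left associativity) : ring_scope.

Section BimodTheory.
Context {K : fieldType} {A : algType K} {M : bimod A}.
Implicit Types (a b : A) (x y : M).

Lemma lactDl a b x : (a + b) <* x = a <* x + b <* x.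
Proof. exact: (ax_lDl (bimodP M)). Qed.
Lemma lactDr a x y : a <* (x + y) = a <* x + a <* y.
Proof. exact: (ax_lDr (bimodP M)). Qed.
Lemma lactZl (c : K) a x : (c *: a) <* x = c *: (a <* x).
Proof. exact: (ax_lZl (bimodP M)). Qed.
Lemma lactZr (c : K) a x : a <* (c *: x) = c *: (a <* x).
Proof. exact: (ax_lZr (bimodP M)). Qed.
Lemma lact1 x : 1 <* x = x.
Proof. exact: (ax_l1 (bimodP M)). Qed.
Lemma lactM a b x : (a * b) <* x = a <* (b <* x).
Proof. exact: (ax_lM (bimodP M)). Qed.
Lemma ractDl x y a : (x + y) *> a = x *> a + y *> a.
Proof. exact: (ax_rDl (bimodP M)). Qed.
Lemma ractDr x a b : x *> (a + b) = x *> a + x *> b.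
Proof. exact: (ax_rDr (bimodP M)). Qed.
Lemma ractZl (c : K) x a : (c *: x) *> a = c *: (x *> a).
Proof. exact: (ax_rZl (bimodP M)). Qed.
Lemma ractZr (c : K) x a : x *> (c *: a) = c *: (x *> a).
Proof. exact: (ax_rZr (bimodP M)). Qed.
Lemma ract1 x : x *> 1 = x.
Proof. exact: (ax_r1 (bimodP M)). Qed.
Lemma ractM x a b : x *> (a * b) = x *> a *> b.
Proof. exact: (ax_rM (bimodP M)). Qed.
Lemma lractA a x b : a <* x *> b = a <* (x *> b).
Proof. exact: (ax_lr (bimodP M)). Qed.
Lemma lact0 a : a <* (0 : M) = 0.
Proof. by rewrite -(scale0r (0 : M)) lactZr !scale0r. Qed.
Lemma ract0 a : (0 : M) *> a = 0.
Proof. by rewrite -(scale0r (0 : M)) ractZl !scale0r. Qed.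
Lemma lact0r x : (0 : A) <* x = 0.
Proof. by rewrite -(scale0r (0 : A)) lactZl !scale0r. Qed.
Lemma ract0r x : x *> (0 : A) = 0.
Proof. by rewrite -(scale0r (0 : A)) ractZr !scale0r. Qed.

End BimodTheory.

Section Maps.
Context {K : fieldType} {A : algType K} {M N : bimod A} {f : M -> N}.
Hypothesis f_map : bimod_map f.
Lemma bmapP (c : K) x y : f (c *: x + y) = c *: f x + f y.
Proof. by have [h _ _] := f_map; apply: h. Qed.
Lemma bmapD x y : f (x + y) = f x + f y.
Proof. by have := bmapP 1 x y; rewrite !scale1r. Qed.
Lemma bmap0 : f 0 = 0.
Proof. by apply: (@addrI _ (f 0)); rewrite -bmapD !addr0. Qed.
Lemma bmapZ (c : K) x : f (c *: x) = c *: f x.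
Proof. by rewrite -[c *: x]addr0 bmapP bmap0 addr0. Qed.
Lemma bmapl a x : f (a <* x) = a <* f x.
Proof. by have [_ h _] := f_map; apply: h. Qed.
Lemma bmapr x a : f (x *> a) = f x *> a.
Proof. by have [_ _ h] := f_map; apply: h. Qed.
End Maps.

(* The tensor product over A: formal finite sums of pairs (m, n), stored as
   lists, modulo the congruence generated by the usual relations.  Compatibility
   with the scalars of K needs no generator of its own: they act through A. *)
Section Tensor.
Context {K : fieldType} {A : algType K}.
Variables M N : bimod A.

Inductive teq : seq (M * N) -> seq (M * N) -> Prop :=
| teq_refl s : teq s s
| teq_sym s t : teq s t -> teq t s
| teq_trans s t u : teq s t -> teq t u -> teq s u
| teq_cat s s' t t' : teq s s' -> teq t t' -> teq (s ++ t) (s' ++ t')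
| teq_comm s t : teq (s ++ t) (t ++ s)
| teq_zero n : teq [:: (0, n)] [::]
| teq_addl m m' n : teq [:: (m + m', n)] [:: (m, n); (m', n)]
| teq_addr m n n' : teq [:: (m, n + n')] [:: (m, n); (m, n')]
| teq_bal m a n : teq [:: (m *> a, n)] [:: (m, a <* n)].

Definition teqb (s t : seq (M * N)) : bool := `[< teq s t >].

Fact teqb_refl : reflexive teqb.
Proof. by move=> s; apply/asboolP/teq_refl. Qed.
Fact teqb_sym : symmetric teqb.
Proof.
by move=> s t; apply/asboolP/asboolP => h; apply: teq_sym.
Qed.
Fact teqb_trans : transitive teqb.
Proof.
by move=> s t u /asboolP h /asboolP h'; apply/asboolP; apply: teq_trans h h'.
Qed.
Definition teq_equiv := EquivRel teqb teqb_refl teqb_sym teqb_trans.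

Definition tensT : Type := {eq_quot teq_equiv}.
HB.instance Definition _ := Choice.on tensT.
HB.instance Definition _ := EqQuotient.on tensT.

Lemma tpiP (s t : seq (M * N)) : teq s t <-> \pi_tensT s = \pi_tensT t.
Proof.
split=> [h|/eqmodP /asboolP //].
by apply/eqmodP/asboolP.
Qed.

Lemma teq_repr (s : seq (M * N)) : teq (repr (\pi_tensT s)) s.
Proof. by apply/tpiP; rewrite reprK. Qed.

Lemma tpiW (P : tensT -> Prop) : (forall s, P (\pi_tensT s)) -> forall t, P t.
Proof. by move=> h t; rewrite -[t]reprK. Qed.

Definition tmaps (g : M * N -> M * N) (t : tensT) : tensT := \pi_tensT (map g (repr t)).

Definition tadd (s t : tensT) : tensT := \pi_tensT (repr s ++ repr t).
Definition topp := tmaps (fun p => (- p.1, p.2)).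
Definition tscale (c : K) := tmaps (fun p => (c *: p.1, p.2)).
Definition tlact (a : A) := tmaps (fun p => (a <* p.1, p.2)).
Definition tract (t : tensT) (a : A) := tmaps (fun p => (p.1, p.2 *> a)) t.

Lemma taddE s t : tadd (\pi_tensT s) (\pi_tensT t) = \pi_tensT (s ++ t).
Proof. by apply/tpiP/teq_cat; apply: teq_repr. Qed.

Lemma tmapsE g (hg : forall s t, teq s t -> teq (map g s) (map g t)) s :
  tmaps g (\pi_tensT s) = \pi_tensT (map g s).
Proof. by apply/tpiP/hg/teq_repr. Qed.

Lemma teq_mapl (g : M -> M) : {morph g : x y / x + y} ->
  (forall m a, g (m *> a) = g m *> a) ->
  forall s t, teq s t ->
    teq (map (fun p => (g p.1, p.2)) s) (map (fun p => (g p.1, p.2)) t).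
Proof.
move=> gD gr s t; elim=> {s t} /=.
- by move=> s; apply: teq_refl.
- by move=> s t _; apply: teq_sym.
- by move=> s t u _ h _; apply: teq_trans.
- by move=> s s' t t' _ h _ h'; rewrite !map_cat; apply: teq_cat.
- by move=> s t; rewrite !map_cat; apply: teq_comm.
- move=> n; have -> : g 0 = 0 by apply: (@addrI _ (g 0)); rewrite -gD !addr0.
  exact: teq_zero.
- by move=> m m' n; rewrite gD; apply: teq_addl.
- by move=> m n n'; apply: teq_addr.
- by move=> m a n; rewrite gr; apply: teq_bal.
Qed.

Lemma teq_mapr (g : N -> N) : {morph g : x y / x + y} ->
  (forall a n, g (a <* n) = a <* g n) ->
  forall s t, teq s t ->
    teq (map (fun p => (p.1, g p.2)) s) (map (fun p => (p.1, g p.2)) t).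
Proof.
move=> gD gl s t; elim=> {s t} /=.
- by move=> s; apply: teq_refl.
- by move=> s t _; apply: teq_sym.
- by move=> s t u _ h _; apply: teq_trans.
- by move=> s s' t t' _ h _ h'; rewrite !map_cat; apply: teq_cat.
- by move=> s t; rewrite !map_cat; apply: teq_comm.
- by move=> n; apply: teq_zero.
- by move=> m m' n; apply: teq_addl.
- by move=> m n n'; rewrite gD; apply: teq_addr.
- by move=> m a n; rewrite gl; apply: teq_bal.
Qed.

Lemma toppE s : topp (\pi_tensT s) = \pi_tensT (map (fun p => (- p.1, p.2)) s).
Proof.
apply: tmapsE; apply: teq_mapl => [x y|m a]; first exact: opprD.
by rewrite -!scaleN1r ractZl.
Qed.
Lemma tscaleE c s : tscale c (\pi_tensT s) = \pi_tensT (map (fun p => (c *: p.1, p.2)) s).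
Proof.
apply: tmapsE; apply: teq_mapl => [x y|m a]; first exact: scalerDr.
by rewrite ractZl.
Qed.
Lemma tlactE a s : tlact a (\pi_tensT s) = \pi_tensT (map (fun p => (a <* p.1, p.2)) s).
Proof.
apply: tmapsE; apply: teq_mapl => [x y|m b]; first exact: lactDr.
by rewrite lractA.
Qed.
Lemma tractE a s : tract (\pi_tensT s) a = \pi_tensT (map (fun p => (p.1, p.2 *> a)) s).
Proof.
apply: tmapsE; apply: (@teq_mapr (fun n => n *> a)) => [x y|b n]; first exact: ractDl.
by rewrite lractA.
Qed.

Lemma taddA : associative tadd.
Proof. move=> x y z; elim/tpiW: x => s; elim/tpiW: y => t; elim/tpiW: z => u; by rewrite !taddE catA. Qed.
Lemma taddC : commutative tadd.
Proof. move=> x y; elim/tpiW: x => s; elim/tpiW: y => t; by rewrite !taddE; apply/tpiP/teq_comm. Qed.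
Lemma tadd0 : left_id (\pi_tensT [::]) tadd.
Proof. move=> x; elim/tpiW: x => s; by rewrite !taddE. Qed.
Lemma taddN : left_inverse (\pi_tensT [::]) topp tadd.
Proof.
move=> x; elim/tpiW: x => s; rewrite toppE taddE; apply/tpiP.
elim: s => [|[m n] s IH] /=; first exact: teq_refl.
rewrite -cat1s.
have h1 : teq ((map (fun p => (- p.1, p.2)) s) ++ (m, n) :: s)
              ((m, n) :: (map (fun p => (- p.1, p.2)) s ++ s)).
  rewrite -[(m, n) :: s]cat1s -[in X in teq _ X]cat1s !catA.
  by apply: teq_cat; [apply: teq_comm | apply: teq_refl].
apply: teq_trans (teq_cat (teq_refl _) h1) _.
rewrite /= -[_ :: _ :: _]/([:: (- m, n); (m, n)] ++ _).
rewrite -[[::]]/([::] ++ [::]); apply: teq_cat => //.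
apply: teq_trans (teq_sym (teq_addl _ _ _)) _.
by rewrite addNr; apply: teq_zero.
Qed.

HB.instance Definition _ := GRing.isZmodule.Build tensT taddA taddC tadd0 taddN.

Lemma tpiD s t : \pi_tensT (s ++ t) = \pi_tensT s + \pi_tensT t.
Proof. by rewrite -taddE. Qed.

Definition tmul (m : M) (n : N) : tensT := \pi_tensT [:: (m, n)].

Lemma tmulDl m m' n : tmul (m + m') n = tmul m n + tmul m' n.
Proof. by rewrite -tpiD; apply/tpiP/teq_addl. Qed.
Lemma tmulDr m n n' : tmul m (n + n') = tmul m n + tmul m n'.
Proof. by rewrite -tpiD; apply/tpiP/teq_addr. Qed.
Lemma tmulA m a n : tmul (m *> a) n = tmul m (a <* n).
Proof. by apply/tpiP/teq_bal. Qed.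
Lemma tmul0l n : tmul 0 n = 0.
Proof. by apply/tpiP/teq_zero. Qed.
Lemma tmul0r m : tmul m 0 = 0.
Proof. by rewrite -(lact0r (0 : N)) -tmulA ract0r tmul0l. Qed.

Lemma tpiE s : \pi_tensT s = \sum_(p <- s) tmul p.1 p.2.
Proof.
elim: s => [|[m n] s IH]; first by rewrite big_nil.
by rewrite big_cons -IH -cat1s tpiD.
Qed.

Lemma tens_ind (P : tensT -> Prop) : P 0 ->
  (forall m n, P (tmul m n)) -> (forall s t, P s -> P t -> P (s + t)) ->
  forall t, P t.
Proof.
move=> P0 Pm PD; elim/tpiW=> s; rewrite tpiE.
by elim: s => [|p s IH]; rewrite ?big_nil // big_cons; apply: PD.
Qed.

Lemma tlactD a : {morph tlact a : s t / s + t}.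
Proof. move=> x y; elim/tpiW: x => s; elim/tpiW: y => t; by rewrite -tpiD !tlactE map_cat tpiD. Qed.
Lemma tractD a : {morph tract^~ a : s t / s + t}.
Proof. move=> x y; elim/tpiW: x => s; elim/tpiW: y => t; by rewrite -tpiD !tractE map_cat tpiD. Qed.
Lemma tscaleD c : {morph tscale c : s t / s + t}.
Proof. move=> x y; elim/tpiW: x => s; elim/tpiW: y => t; by rewrite -tpiD !tscaleE map_cat tpiD. Qed.
Lemma tlact_mul a m n : tlact a (tmul m n) = tmul (a <* m) n.
Proof. exact: tlactE. Qed.
Lemma tract_mul a m n : tract (tmul m n) a = tmul m (n *> a).
Proof. exact: tractE. Qed.
Lemma tscale_mul c m n : tscale c (tmul m n) = tmul (c *: m) n.
Proof. exact: tscaleE. Qed.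
Lemma tlact0 a : tlact a 0 = 0.
Proof. exact: tlactE. Qed.
Lemma tract0 a : tract 0 a = 0.
Proof. exact: tractE. Qed.
Lemma tscale0 c : tscale c 0 = 0.
Proof. exact: tscaleE. Qed.

Fact tscaleA c d t : tscale c (tscale d t) = tscale (c * d) t.
Proof.
elim/tens_ind: t => [|m n|s t hs ht]; first by rewrite !tscale0.
  by rewrite !tscale_mul scalerA.
by rewrite !tscaleD hs ht.
Qed.
Fact tscale1 : left_id 1 tscale.
Proof.
move=> x; elim/tens_ind: x => [|m n|s t hs ht]; first by rewrite !tscale0.
  by rewrite !tscale_mul scale1r.
by rewrite !tscaleD hs ht.
Qed.
Fact tscaleDl t : {morph tscale^~ t : c d / c + d}.
Proof.
move=> c d; elim/tens_ind: t => [|m n|s t hs ht]; first by rewrite !tscale0 addr0.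
  by rewrite !tscale_mul scalerDl tmulDl.
by rewrite !tscaleD hs ht addrACA.
Qed.
HB.instance Definition _ :=
  GRing.Zmodule_isLmodule.Build K tensT tscaleA tscale1 tscaleD tscaleDl.

Lemma tmulZl (c : K) m n : tmul (c *: m) n = c *: tmul m n.
Proof. exact: esym (tscale_mul _ _ _). Qed.
Lemma tmulZr (c : K) m n : tmul m (c *: n) = c *: tmul m n.
Proof.
by rewrite -tmulZl -{1}[n]lact1 -lactZl -tmulA ractZr ract1.
Qed.

Fact tens_axioms : bimod_axioms tlact tract.
Proof.
split.
- move=> a b; move=> x; elim/tens_ind: x => [|m n|s t hs ht]; first by rewrite !tlact0 addr0.
    by rewrite !tlact_mul lactDl tmulDl.
  by rewrite !tlactD hs ht addrACA.
- by move=> a x y; rewrite tlactD.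
- move=> c a; move=> x; elim/tens_ind: x => [|m n|s t hs ht]; first by rewrite !tlact0 scaler0.
    by rewrite !tlact_mul lactZl tmulZl.
  by rewrite !tlactD hs ht scalerDr.
- move=> c a; move=> x; elim/tens_ind: x => [|m n|s t hs ht].
  + by rewrite scaler0 !tlact0 scaler0.
  + by rewrite -tmulZl !tlact_mul lactZr tmulZl.
  + by rewrite scalerDr !tlactD hs ht scalerDr.
- move=> x; elim/tens_ind: x => [|m n|s t hs ht]; first by rewrite !tlact0.
    by rewrite !tlact_mul lact1.
  by rewrite !tlactD hs ht.
- move=> a b; move=> x; elim/tens_ind: x => [|m n|s t hs ht]; first by rewrite !tlact0.
    by rewrite !tlact_mul lactM.
  by rewrite !tlactD hs ht.
- by move=> x y a; rewrite tractD.
- move=> x a b; elim/tens_ind: x => [|m n|s t hs ht]; first by rewrite !tract0 addr0.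
    by rewrite !tract_mul ractDr tmulDr.
  by rewrite !tractD hs ht addrACA.
- move=> c x a; elim/tens_ind: x => [|m n|s t hs ht].
  + by rewrite scaler0 !tract0 scaler0.
  + by rewrite -tmulZl !tract_mul tmulZl.
  + by rewrite scalerDr !tractD hs ht scalerDr.
- move=> c x a; elim/tens_ind: x => [|m n|s t hs ht]; first by rewrite !tract0 scaler0.
    by rewrite !tract_mul ractZr tmulZr.
  by rewrite !tractD hs ht scalerDr.
- move=> x; elim/tens_ind: x => [|m n|s t hs ht]; first by rewrite !tract0.
    by rewrite !tract_mul ract1.
  by rewrite !tractD hs ht.
- move=> x a b; elim/tens_ind: x => [|m n|s t hs ht]; first by rewrite !tract0.
    by rewrite !tract_mul ractM.
  by rewrite !tractD hs ht.
- move=> a x b; elim/tens_ind: x => [|m n|s t hs ht]; first by rewrite tlact0 tract0 tlact0.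
    by rewrite !(tlact_mul, tract_mul).
  by rewrite !(tlactD, tractD) hs ht.
Qed.

Definition tens : bimod A := Bimod tens_axioms.

Definition tensor (m : M) (n : N) : tens := tmul m n.
End Tensor.

Declare Scope bimod_scope.
Delimit Scope bimod_scope with B.
Bind Scope bimod_scope with bimod.
Infix "⊗" := tens (at level 41, right associativity) : bimod_scope.
Infix "⊠" := tensor (at level 38, right associativity) : ring_scope.

Section Lift.
Context {K : fieldType} {A : algType K}.
Implicit Types M N P V : bimod A.

Record balanced M N (P : zmodType) (f : M -> N -> P) : Prop := Balanced {
  balDl : forall m m' n, f (m + m') n = f m n + f m' n;
  balDr : forall m n n', f m (n + n') = f m n + f m n';
  balA : forall m a n, f (m *> a) n = f m (a <* n) }.

(* For balanced f this is the induced map on the tensor product (tliftE); the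
   value does not depend on the representative.  Otherwise it is junk. *)
Definition tlift M N (P : zmodType) (f : M -> N -> P) (t : (M ⊗ N)%B) : P :=
  \sum_(p <- repr (t : tensT M N)) f p.1 p.2.

Lemma tensor_ind M N (Q : (M ⊗ N)%B -> Prop) : Q 0 ->
  (forall m n, Q (m ⊠ n)) -> (forall s t, Q s -> Q t -> Q (s + t)) ->
  forall t, Q t.
Proof. exact: tens_ind. Qed.
Lemma tensorDl M N (m m' : M) (n : N) : (m + m') ⊠ n = m ⊠ n + m' ⊠ n.
Proof. exact: tmulDl. Qed.
Lemma tensorDr M N (m : M) (n n' : N) : m ⊠ (n + n') = m ⊠ n + m ⊠ n'.
Proof. exact: tmulDr. Qed.
Lemma tensorA M N (m : M) a (n : N) : (m *> a) ⊠ n = m ⊠ (a <* n).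
Proof. exact: tmulA. Qed.
Lemma tensorZl M N (c : K) (m : M) (n : N) : (c *: m) ⊠ n = c *: (m ⊠ n).
Proof. exact: tmulZl. Qed.
Lemma tensorZr M N (c : K) (m : M) (n : N) : m ⊠ (c *: n) = c *: (m ⊠ n).
Proof. exact: tmulZr. Qed.
Lemma tensor0l M N (n : N) : (0 : M) ⊠ n = 0.
Proof. exact: tmul0l. Qed.
Lemma tensor0r M N (m : M) : m ⊠ (0 : N) = 0.
Proof. exact: tmul0r. Qed.
Lemma tensorNl M N (m : M) (n : N) : (- m) ⊠ n = - (m ⊠ n).
Proof. by rewrite -scaleN1r tensorZl scaleN1r. Qed.
Lemma tensorNr M N (m : M) (n : N) : m ⊠ (- n) = - (m ⊠ n).
Proof. by rewrite -scaleN1r tensorZr scaleN1r. Qed.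
Lemma tensor_lact M N a (m : M) (n : N) : a <* (m ⊠ n) = (a <* m) ⊠ n.
Proof. exact: tlact_mul. Qed.
Lemma tensor_ract M N a (m : M) (n : N) : (m ⊠ n) *> a = m ⊠ (n *> a).
Proof. exact: tract_mul. Qed.

Section TliftTheory.
Context {M N : bimod A} {P : zmodType} {f : M -> N -> P}.
Hypothesis fB : balanced f.

Let f0l n : f 0 n = 0.
Proof. by apply: (@addrI _ (f 0 n)); rewrite -(balDl fB) !addr0. Qed.

Let teq_sum s t : teq s t -> \sum_(p <- s) f p.1 p.2 = \sum_(p <- t) f p.1 p.2.
Proof.
elim=> {s t} //=.
- by move=> s t u _ -> _ ->.
- by move=> s s' t t' _ h _ h'; rewrite !big_cat /= h h'.
- by move=> s t; rewrite !big_cat /= addrC.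
- by move=> n; rewrite big_seq1 big_nil.
- by move=> m m' n; rewrite big_seq1 big_cons big_seq1 (balDl fB).
- by move=> m n n'; rewrite big_seq1 big_cons big_seq1 (balDr fB).
- by move=> m a n; rewrite !big_seq1 (balA fB).
Qed.

Lemma tlift_pi s : tlift f (\pi_(tensT M N) s) = \sum_(p <- s) f p.1 p.2.
Proof. exact/teq_sum/teq_repr. Qed.

Lemma tliftE m n : tlift f (m ⊠ n) = f m n.
Proof. by rewrite tlift_pi big_seq1. Qed.
Lemma tliftD s t : tlift f (s + t) = tlift f s + tlift f t.
Proof.
have E (u : (M ⊗ N)%B) : u = \pi_(tensT M N) (repr (u : tensT M N)) by rewrite reprK.
by rewrite (E s) (E t) -[in LHS]tpiD !tlift_pi big_cat.
Qed.
Lemma tlift0 : tlift f 0 = 0.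
Proof. by apply: (@addrI _ (tlift f 0)); rewrite -tliftD !addr0. Qed.
End TliftTheory.

Lemma tlift_addf M N (P : zmodType) (f g h : M -> N -> P) t :
  (forall m n, h m n = f m n + g m n) -> tlift h t = tlift f t + tlift g t.
Proof. by move=> e; rewrite /tlift -big_split /=; apply: eq_bigr => p _. Qed.
Lemma eq_tlift M N (P : zmodType) (f g : M -> N -> P) :
  (forall m n, f m n = g m n) -> tlift f =1 tlift g.
Proof. by move=> e t; apply: eq_bigr => p _. Qed.
Lemma tlift_lact M N (P : zmodType) (f : M -> N -> P) a t : balanced f ->
  tlift f (a <* t) = tlift (fun m n => f (a <* m) n) t.
Proof.
move=> fB.
have gB : balanced (fun m n => f (a <* m) n).
  by split=> *; rewrite ?lactDr ?(balDl fB) ?(balDr fB) -?lractA ?(balA fB).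
elim/tensor_ind: t => [|m n|s t hs ht].
- by rewrite lact0 !tlift0.
- by rewrite tensor_lact !tliftE.
- by rewrite lactDr !tliftD // hs ht.
Qed.

Record bibalanced M N P (f : M -> N -> P) : Prop := Bibalanced {
  bib_bal : balanced f;
  bibl : forall a m n, f (a <* m) n = a <* f m n;
  bibr : forall m n a, f m (n *> a) = f m n *> a }.

Lemma bimod_map_ext M N (f g : M -> N) : f =1 g -> bimod_map g -> bimod_map f.
Proof. by move=> /funext ->. Qed.

Lemma bimod_map_id M : bimod_map (fun x : M => x).
Proof. by []. Qed.
Lemma bimod_map_comp M N P (g : N -> P) (f : M -> N) :
  bimod_map g -> bimod_map f -> bimod_map (fun x => g (f x)).
Proof.
move=> gM fM; split=> [c x y|a x|x a] /=.
- by rewrite (bmapP fM) (bmapP gM).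
- by rewrite (bmapl fM) (bmapl gM).
- by rewrite (bmapr fM) (bmapr gM). Qed.
Lemma bimod_map0 M N : bimod_map (fun _ : M => 0 : N).
Proof. by split=> [c x y|a x|x a] /=; rewrite ?scaler0 ?addr0 ?lact0 ?ract0. Qed.

Lemma bimod_mapD M N (f g : M -> N) :
  bimod_map f -> bimod_map g -> bimod_map (fun x => f x + g x).
Proof.
move=> fM gM; split=> [c x y|a x|x a] /=.
- by rewrite (bmapP fM) (bmapP gM) scalerDr addrACA.
- by rewrite (bmapl fM) (bmapl gM) lactDr.
- by rewrite (bmapr fM) (bmapr gM) ractDl.
Qed.

Lemma scale_lact M (c : K) (x : M) : c *: x = (c *: 1) <* x.
Proof. by rewrite lactZl lact1. Qed.

Lemma tlift_map M N P (f : M -> N -> P) : bibalanced f -> bimod_map (tlift f).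
Proof.
move=> [fB fl fr].
have tl a t : tlift f (a <* t) = a <* tlift f t.
  elim/tensor_ind: t => [|m n|s t hs ht].
  - by rewrite lact0 (tlift0 fB) lact0.
  - by rewrite tensor_lact !(tliftE fB) fl.
  - by rewrite lactDr !(tliftD fB) hs ht lactDr.
split=> //.
- by move=> c x y; rewrite (tliftD fB) scale_lact tl -scale_lact.
move=> t a; elim/tensor_ind: t => [|m n|s t hs ht].
- by rewrite ract0 (tlift0 fB) ract0.
- by rewrite tensor_ract !(tliftE fB) fr.
- by rewrite ractDl !(tliftD fB) hs ht ractDl.
Qed.

Definition tmap M M' N N' (f : M -> M') (g : N -> N') : (M ⊗ N)%B -> (M' ⊗ N')%B :=
  tlift (fun m n => f m ⊠ g n).
Definition idt M N N' (g : N -> N') : (M ⊗ N)%B -> (M ⊗ N')%B :=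
  tmap (fun m : M => m) g.

Lemma tmap_bib M M' N N' (f : M -> M') (g : N -> N') :
  bimod_map f -> bimod_map g -> bibalanced (fun m n => f m ⊠ g n).
Proof.
move=> fM gM; split=> [|*|*].
- split=> *; rewrite ?(bmapD fM) ?(bmapD gM) ?tensorDl ?tensorDr //.
  by rewrite (bmapr fM) (bmapl gM) tensorA.
- by rewrite (bmapl fM) tensor_lact.
- by rewrite (bmapr gM) tensor_ract.
Qed.
Lemma tmapE M M' N N' (f : M -> M') (g : N -> N') m n :
  bimod_map f -> bimod_map g -> tmap f g (m ⊠ n) = f m ⊠ g n.
Proof. by move=> fM gM; rewrite /tmap (tliftE (bib_bal (tmap_bib fM gM))). Qed.
Lemma tmap_map M M' N N' (f : M -> M') (g : N -> N') :
  bimod_map f -> bimod_map g -> bimod_map (tmap f g).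
Proof. by move=> fM gM; apply/tlift_map/tmap_bib. Qed.
Lemma idtE M N N' (g : N -> N') (m : M) n :
  bimod_map g -> idt g (m ⊠ n) = m ⊠ g n.
Proof. by move=> gM; rewrite /idt tmapE. Qed.
Lemma idt_map M N N' (g : N -> N') : bimod_map g -> bimod_map (@idt M N N' g).
Proof. by move=> gM; apply: tmap_map. Qed.

Definition tassoc {M N P} : ((M ⊗ N) ⊗ P)%B -> (M ⊗ N ⊗ P)%B :=
  tlift (fun t p => tlift (fun m n => m ⊠ n ⊠ p) t).

Lemma tassoc_bib1 M N P (p : P) :
  balanced (fun (m : M) (n : N) => m ⊠ n ⊠ p).
Proof.
by split=> *; rewrite ?tensorDl ?tensorDr // tensorA tensor_lact.
Qed.
Lemma tassoc_bib M N P : bibalanced (fun (t : (M ⊗ N)%B) (p : P) =>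
  tlift (fun m n => m ⊠ n ⊠ p) t).
Proof.
split=> [|a t p|t p a].
- split=> [s t p|t p p'|t a p].
  + by rewrite (tliftD (tassoc_bib1 _ _ _)).
  + by apply: tlift_addf => m n; rewrite !tensorDr.
  + elim/tensor_ind: t => [|m n|s t hs ht].
    * by rewrite ract0 !(tlift0 (tassoc_bib1 _ _ _)).
    * by rewrite tensor_ract !(tliftE (tassoc_bib1 _ _ _)) tensorA.
    * by rewrite ractDl !(tliftD (tassoc_bib1 _ _ _)) hs ht.
- elim/tensor_ind: t => [|m n|s t hs ht].
  + by rewrite lact0 (tlift0 (tassoc_bib1 _ _ _)) lact0.
  + by rewrite tensor_lact !(tliftE (tassoc_bib1 _ _ _)) tensor_lact.
  + by rewrite lactDr !(tliftD (tassoc_bib1 _ _ _)) hs ht lactDr.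
- elim/tensor_ind: t => [|m n|s t hs ht].
  + by rewrite !(tlift0 (tassoc_bib1 _ _ _)) ract0.
  + by rewrite !(tliftE (tassoc_bib1 _ _ _)) !tensor_ract.
  + by rewrite !(tliftD (tassoc_bib1 _ _ _)) hs ht ractDl.
Qed.
Lemma tassocE M N P (m : M) (n : N) (p : P) : tassoc ((m ⊠ n) ⊠ p) = m ⊠ n ⊠ p.
Proof.
by rewrite /tassoc (tliftE (bib_bal (tassoc_bib _ _ _)))
  (tliftE (tassoc_bib1 _ _ _)).
Qed.
Lemma tassoc_map M N P : bimod_map (@tassoc M N P).
Proof. exact/tlift_map/tassoc_bib. Qed.

(* h in the first two factors, i.e. (h ⊗ id) after rebracketing *)
Definition on12 M V (Q : bimod A) (h : (M ⊗ V)%B -> Q) P :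
    (M ⊗ V ⊗ P)%B -> (Q ⊗ P)%B :=
  tlift (fun m y => tlift (fun v p => h (m ⊠ v) ⊠ p) y).

Section On12.
Variables (M V Q P : bimod A) (h : (M ⊗ V)%B -> Q).
Hypothesis hM : bimod_map h.
Lemma on12_bal1 m : balanced (fun (v : V) (p : P) => h (m ⊠ v) ⊠ p).
Proof.
split=> *; rewrite ?tensorDr ?(bmapD hM) ?tensorDl //.
by rewrite -tensor_ract (bmapr hM) tensorA.
Qed.
Lemma on12_bib : bibalanced (fun (m : M) (y : (V ⊗ P)%B) =>
  tlift (fun v p => h (m ⊠ v) ⊠ p) y).
Proof.
split=> [|a m y|m y a].
- split=> [m m' y|m y y'|m a y].
  + by apply: tlift_addf => v p; rewrite tensorDl (bmapD hM) tensorDl.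
  + by rewrite (tliftD (on12_bal1 _)).
  + rewrite (tlift_lact _ _ (on12_bal1 _)).
    by apply: eq_tlift => v p; rewrite tensorA.
- elim/tensor_ind: y => [|v p|s t hs ht].
  + by rewrite !(tlift0 (on12_bal1 _)) lact0.
  + by rewrite !(tliftE (on12_bal1 _)) -tensor_lact (bmapl hM) tensor_lact.
  + by rewrite !(tliftD (on12_bal1 _)) hs ht lactDr.
- elim/tensor_ind: y => [|v p|s t hs ht].
  + by rewrite ract0 !(tlift0 (on12_bal1 _)) ract0.
  + by rewrite tensor_ract !(tliftE (on12_bal1 _)) tensor_ract.
  + by rewrite ractDl !(tliftD (on12_bal1 _)) hs ht ractDl.
Qed.
Lemma on12E m v (p : P) : on12 h (m ⊠ v ⊠ p) = h (m ⊠ v) ⊠ p.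
Proof. by rewrite /on12 (tliftE (bib_bal on12_bib)) (tliftE (on12_bal1 _)). Qed.
Lemma on12_map : bimod_map (@on12 M V Q h P).
Proof. exact/tlift_map/on12_bib. Qed.
End On12.

Definition braid12 M V (s : (M ⊗ V)%B -> (V ⊗ M)%B) P
    (x : (M ⊗ V ⊗ P)%B) : (V ⊗ M ⊗ P)%B := tassoc (on12 s x).

Lemma braid12_map M V (s : (M ⊗ V)%B -> (V ⊗ M)%B) P :
  bimod_map s -> bimod_map (@braid12 M V s P).
Proof.
by move=> sM; apply: bimod_map_comp; [apply: tassoc_map | apply: on12_map].
Qed.

End Lift.
Arguments on12 {K A M V Q} h {P} _.
Arguments braid12 {K A M V} s {P} x.

Section Dga.
Context {K : fieldType}.

(* degree 0 is A itself; V n is the component of degree n.+1 *)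
Definition form_of (A : algType K) (V : nat -> lmodType K) (n : nat) : lmodType K :=
  if n is m.+1 then V m else A.

Definition gcast (A : algType K) (V : nat -> lmodType K) m n (e : m = n) :
    form_of A V m -> form_of A V n :=
  fun x => ecast i (form_of A V i) e x.
Arguments gcast {A V m n} e x.

Record dga (A : algType K) := Dga {
  dga_pos : nat -> lmodType K;
  wedge : forall i j, form_of A dga_pos i -> form_of A dga_pos j ->
    form_of A dga_pos (i + j);
  dga_d : forall n, form_of A dga_pos n -> form_of A dga_pos n.+1;
  wedge_linl : forall i j y, linear (fun x => @wedge i j x y);
  wedge_linr : forall i j x, linear (fun y => @wedge i j x y);
  wedge_deg0 : forall a b : A, @wedge 0 0 a b = a * b :> A;
  wedge_1l : forall n (x : form_of A dga_pos n), @wedge 0 n (1 : A) x = x;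
  wedge_1r : forall n (x : form_of A dga_pos n),
    gcast (addn0 n) (@wedge n 0 x (1 : A)) = x;
  wedgeA : forall i j k (x : form_of A dga_pos i) (y : form_of A dga_pos j)
      (z : form_of A dga_pos k),
    gcast (addnA i j k) (wedge x (wedge y z)) = wedge (wedge x y) z;
  dga_d_lin : forall n, linear (@dga_d n);
  dga_dd : forall n (x : form_of A dga_pos n), dga_d (dga_d x) = 0;
  dga_leibniz : forall i j (x : form_of A dga_pos i) (y : form_of A dga_pos j),
    dga_d (wedge x y) = wedge (dga_d x) y
      + (-1) ^+ i *: gcast (addnS i j) (wedge x (dga_d y));
  dga_generated : forall Q : forall n, form_of A dga_pos n -> Prop,
    (forall a : A, Q 0 a) -> (forall a : A, Q 1 (@dga_d 0 a)) ->
    (forall n x y, Q n x -> Q n y -> Q n (x + y)) ->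
    (forall i j x y, Q i x -> Q j y -> Q (i + j) (wedge x y)) ->
    forall n x, Q n x }.

End Dga.
Arguments gcast {K A V m n} e x.

Section DgaBimod.
Context {K : fieldType} {A : algType K} (O : dga A).
Local Notation form := (form_of A (dga_pos O)).
Local Notation w i j := (@wedge K A O i j).

Lemma gcast_id n (e : n = n) (x : form n) : gcast e x = x.
Proof. by rewrite /gcast eq_axiomK. Qed.
Lemma gcast_comp m n p (e : m = n) (e' : n = p) (x : form m) :
  gcast e' (gcast e x) = gcast (etrans e e') x.
Proof. by case: p / e'; case: n / e. Qed.
Lemma gcast_irr m n (e e' : m = n) (x : form m) : gcast e x = gcast e' x.
Proof. by rewrite (eq_irrelevance e e'). Qed.
Lemma gcast_lin m n (e : m = n) : linear (gcast e : form m -> form n).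
Proof. by case: n / e. Qed.
Lemma wedge_castl i i' j (e : i = i') (x : form i) (y : form j) :
  w i' j (gcast e x) y = gcast (congr1 (addn^~ j) e) (w i j x y).
Proof. by case: i' / e. Qed.
Lemma wedge_castr i j j' (e : j = j') (x : form i) (y : form j) :
  w i j' x (gcast e y) = gcast (congr1 (addn i) e) (w i j x y).
Proof. by case: j' / e. Qed.

Fact form_axioms n : bimod_axioms (w 0 n)
  (fun x a => gcast (addn0 n) (w n 0 x a)).
Proof.
have lD := @wedge_linl K A O; have rD := @wedge_linr K A O.
have cD := @gcast_lin; split.
- by move=> a b x; have := lD 0 n x 1 a b; rewrite !scale1r.
- by move=> a x y; have := rD 0 n a 1 x y; rewrite !scale1r.
- move=> c a x; have l0 : w 0 n 0 x = 0.
    by have := lD 0 n x (-1) 0 0; rewrite scaler0 addr0 scaleN1r addNr.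
  by have := lD 0 n x c a 0; rewrite !addr0 l0 addr0.
- move=> c a x; have r0 : w 0 n a 0 = 0.
    by have := rD 0 n a (-1) 0 0; rewrite scaler0 addr0 scaleN1r addNr.
  by have := rD 0 n a c x 0; rewrite !addr0 r0 addr0.
- by move=> x; apply: wedge_1l.
- move=> a b x; rewrite -[a * b](wedge_deg0 O).
  by have /= <- := @wedgeA K A O 0 0 n a b x; rewrite gcast_id.
- move=> x y a; have := lD n 0 a 1 x y; rewrite !scale1r => ->.
  by have := cD _ _ (addn0 n) 1 (w n 0 x a) (w n 0 y a); rewrite !scale1r.
- move=> x a b; have := rD n 0 x 1 a b; rewrite !scale1r => ->.
  by have := cD _ _ (addn0 n) 1 (w n 0 x a) (w n 0 x b); rewrite !scale1r.
- move=> c x a; have c0 : gcast (addn0 n) (w n 0 0 a) = 0.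
    have -> : w n 0 0 a = 0.
      by have := lD n 0 a (-1) 0 0; rewrite scaler0 addr0 scaleN1r addNr.
    by have := cD _ _ (addn0 n) (-1) 0 0; rewrite scaler0 addr0 scaleN1r addNr.
  by have := lD n 0 a c x 0; rewrite !addr0 => ->; rewrite cD c0 addr0.
- move=> c x a; have c0 : gcast (addn0 n) (w n 0 x 0) = 0.
    have -> : w n 0 x 0 = 0.
      by have := rD n 0 x (-1) 0 0; rewrite scaler0 addr0 scaleN1r addNr.
    by have := cD _ _ (addn0 n) (-1) 0 0; rewrite scaler0 addr0 scaleN1r addNr.
  by have := rD n 0 x c a 0; rewrite !addr0 => ->; rewrite cD c0 addr0.
- by move=> x; apply: wedge_1r.
- move=> x a b; rewrite -[a * b](wedge_deg0 O) wedge_castl gcast_comp.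
  have /= <- := @wedgeA K A O n 0 0 x a b; rewrite gcast_comp.
  exact: gcast_irr.
- move=> a x b; rewrite wedge_castr.
  have /= <- := @wedgeA K A O 0 n 0 a x b; rewrite gcast_comp.
  exact: gcast_irr.
Qed.

Definition Om (n : nat) : bimod A := Bimod (form_axioms n).

Definition da (a : A) : Om 1 := @dga_d K A O 0 a.
Definition d1 (w : Om 1) : Om 2 := @dga_d K A O 1 w.
Definition wedge1 (x y : Om 1) : Om 2 := w 1 1 x y.

Lemma wedge1_bib : bibalanced wedge1.
Proof.
split=> [|a x y|x y a].
- split=> [x x' y|x y y'|x a y].
  + by have := @wedge_linl K A O 1 1 y 1 x x'; rewrite !scale1r.
  + by have := @wedge_linr K A O 1 1 x 1 y y'; rewrite !scale1r.
  + rewrite /wedge1 /ract /lact /= wedge_castl.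
    have /= <- := @wedgeA K A O 1 0 1 x a y; rewrite gcast_comp.
    exact: (gcast_irr _ (erefl 2%N)).
- have := @wedgeA K A O 0 1 1 a x y; rewrite (gcast_irr _ (erefl 2%N)).
  exact: esym.
- rewrite /wedge1 /ract /= wedge_castr.
  have /= <- := @wedgeA K A O 1 1 0 x y a; rewrite gcast_comp.
  exact: (@gcast_irr 2 2).
Qed.

Definition wedge2 : (Om 1 ⊗ Om 1)%B -> Om 2 := tlift wedge1.

Lemma wedge2_map : bimod_map wedge2.
Proof. exact/tlift_map/wedge1_bib. Qed.
Lemma wedge2E x y : wedge2 (x ⊠ y) = wedge1 x y.
Proof. by rewrite /wedge2 (tliftE (bib_bal wedge1_bib)). Qed.

Lemma daD a b : da (a + b) = da a + da b.
Proof. by have := @dga_d_lin K A O 0 1 a b; rewrite !scale1r. Qed.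
Lemma d1D x y : d1 (x + y) = d1 x + d1 y.
Proof. by have := @dga_d_lin K A O 1 1 x y; rewrite !scale1r. Qed.
Lemma d1_ract x a : d1 (x *> a) = d1 x *> a - wedge1 x (da a).
Proof.
have E m n (e : m = n) (y : form m) :
    @dga_d K A O n (gcast e y) = gcast (congr1 S e) (@dga_d K A O m y).
  by case: n / e.
rewrite /d1 /ract /= E; have /= -> := @dga_leibniz K A O 1 0 x a.
have := gcast_lin (congr1 S (addn0 1)) 1 (w 2 0 (dga_d x) a)
  ((-1) ^+ 1 *: gcast (addnS 1 0) (w 1 1 x (da a))).
rewrite !scale1r /= => ->; congr (_ + _); first exact: (@gcast_irr 2 2).
by rewrite !(gcast_irr _ (erefl 2%N)) expr1 scaleN1r.
Qed.

End DgaBimod.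
Arguments wedge2 {K A} O t.

Section Connections.
Context {K : fieldType} {A : algType K} (O : dga A).
Local Notation Om := (Om O).
Local Notation Om1 := (Om 1).
Implicit Types (E F : bimod A).

Record bimod_conn E := BimodConn {
  nabla : E -> (Om1 ⊗ E)%B;
  sigma : (E ⊗ Om1)%B -> (Om1 ⊗ E)%B;
  nabla_lin : linear nabla;
  sigma_map : bimod_map sigma;
  nabla_lact : forall a s, nabla (a <* s) = da O a ⊠ s + a <* nabla s;
  nabla_ract : forall s a, nabla (s *> a) = nabla s *> a + sigma (s ⊠ da O a) }.

Lemma nablaD E (C : bimod_conn E) x y : nabla C (x + y) = nabla C x + nabla C y.
Proof. by have := nabla_lin C 1 x y; rewrite !scale1r. Qed.

(* nabla_F ⊗ id + sigma_F (id ⊗ g) on F ⊗ E, for g a left connection on E *)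
Definition tnabla F (C : bimod_conn F) E (g : E -> (Om1 ⊗ E)%B) :
    (F ⊗ E)%B -> (Om1 ⊗ F ⊗ E)%B :=
  tlift (fun f s => tassoc (nabla C f ⊠ s) + braid12 (sigma C) (f ⊠ g s)).

Record left_conn E (g : E -> (Om1 ⊗ E)%B) : Prop := LeftConn {
  left_connD : forall x y, g (x + y) = g x + g y;
  left_connl : forall a s, g (a <* s) = da O a ⊠ s + a <* g s }.

Lemma nabla_left E (C : bimod_conn E) : left_conn (nabla C).
Proof. by split; [apply: nablaD | apply: nabla_lact]. Qed.

Section Tnabla.
Variables (F : bimod A) (C : bimod_conn F) (E : bimod A) (g : E -> (Om1 ⊗ E)%B).
Hypothesis gL : left_conn g.
Let aM := @tassoc_map K A Om1 F E.
Let bM := braid12_map E (sigma_map C).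

Lemma tnabla_bal : balanced
  (fun f s => tassoc (nabla C f ⊠ s) + braid12 (sigma C) (f ⊠ g s)).
Proof.
split=> [f f' s|f s s'|f a s].
- by rewrite nablaD !tensorDl (bmapD aM) (bmapD bM) addrACA.
- by rewrite (left_connD gL) !tensorDr (bmapD aM) (bmapD bM) addrACA.
- rewrite nabla_ract (left_connl gL) tensorDl tensorDr (bmapD aM) (bmapD bM).
  rewrite !tensorA -!addrA; congr (_ + (_ + _)).
  by rewrite /braid12 (on12E (sigma_map C)).
Qed.
Lemma tnablaE f s : tnabla C g (f ⊠ s) =
  tassoc (nabla C f ⊠ s) + braid12 (sigma C) (f ⊠ g s).
Proof. by rewrite /tnabla (tliftE tnabla_bal). Qed.
Lemma tnabla_left (D : forall x y, tnabla C g (x + y) = tnabla C g x + tnabla C g y) a t :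
  tnabla C g (a <* t) = da O a ⊠ t + a <* tnabla C g t.
Proof.
elim/(@tensor_ind K A F E): t => [|f s|s t hs ht].
- have z : tnabla C g 0 = 0 by apply: (@addrI _ (tnabla C g 0)); rewrite -D !addr0.
  by rewrite lact0 z tensor0r lact0 addr0.
- rewrite tensor_lact !tnablaE nabla_lact tensorDl (bmapD aM) tassocE -addrA.
  congr (_ + _); rewrite lactDr -(bmapl aM) -(bmapl bM) !tensor_lact //.
- by rewrite lactDr !D hs ht lactDr tensorDr addrACA.
Qed.
End Tnabla.

Lemma tnabla_leftP F (C : bimod_conn F) E (g : E -> (Om1 ⊗ E)%B) :
  left_conn g -> left_conn (tnabla C g).
Proof.
move=> gL; have D x y : tnabla C g (x + y) = tnabla C g x + tnabla C g y.
  by rewrite /tnabla (tliftD (tnabla_bal C gL)).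
by split=> // a t; apply: tnabla_left.
Qed.

(* (Omega^1)^{⊗ n} ⊗ X, bracketed to the right *)
Fixpoint tower (X : bimod A) (n : nat) : bimod A :=
  if n is m.+1 then (Om1 ⊗ tower X m)%B else X.

(* (Omega^1)^{⊗ n}; equal to A for n = 0 and to Omega^1 for n = 1 *)
Definition tpow (n : nat) : bimod A := if n is m.+1 then tower Om1 m else Om 0.

Definition wedge12 (X : bimod A) : (Om1 ⊗ Om1 ⊗ X)%B -> (Om 2 ⊗ X)%B :=
  on12 (wedge2 O).
Lemma wedge12_map X : bimod_map (@wedge12 X).
Proof. exact/on12_map/wedge2_map. Qed.

(* d ⊗ id - id ∧ g : Omega^1 ⊗ E -> Omega^2 ⊗ E *)
Definition dnabla E (g : E -> (Om1 ⊗ E)%B) : (Om1 ⊗ E)%B -> (Om 2 ⊗ E)%B :=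
  tlift (fun w s => d1 w ⊠ s - wedge12 (w ⊠ g s)).

Lemma dnablaE E (g : E -> (Om1 ⊗ E)%B) w s : left_conn g ->
  dnabla g (w ⊠ s) = d1 w ⊠ s - wedge12 (w ⊠ g s).
Proof.
move=> gL; rewrite /dnabla tliftE //; have wM := wedge12_map E.
split=> [f f' t|f t t'|f a t].
- by rewrite d1D !tensorDl (bmapD wM) opprD addrACA.
- by rewrite (left_connD gL) !tensorDr (bmapD wM) opprD addrACA.
- rewrite d1_ract (left_connl gL) tensorDl tensorDr (bmapD wM) opprD tensorNl.
  by rewrite !tensorA -!addrA /wedge12 (on12E (wedge2_map O)) wedge2E.
Qed.

Definition torsion_free (C : bimod_conn Om1) : Prop :=
  forall w, wedge2 O (nabla C w) = d1 w.

Definition flat_conn E (C : bimod_conn E) : Prop :=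
  forall s, dnabla (nabla C) (nabla C s) = 0.

Definition wedge_compatible (C : bimod_conn Om1) : Prop :=
  exists C2 : bimod_conn (Om 2), forall x w : Om1,
    nabla C2 (wedge1 x w) =
      idt (wedge2 O) (tassoc (nabla C x ⊠ w))
      + idt (wedge2 O) (braid12 (sigma C) (x ⊠ nabla C w)).

(* with E = Omega^1 the next two are the conditions on (nabla, sigma) itself *)
Definition extendable E (C : bimod_conn E) : Prop :=
  exists2 T : (E ⊗ Om 2)%B -> (Om 2 ⊗ E)%B, bimod_map T &
    forall s (x z : Om1), T (s ⊠ wedge1 x z) =
      wedge12 (idt (sigma C) (braid12 (sigma C) (s ⊠ x ⊠ z))).

Definition leibniz_compatible (C : bimod_conn Om1) E (CE : bimod_conn E) : Prop :=
  forall t : (E ⊗ Om1)%B,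
    tnabla C (nabla CE) (sigma CE t) = idt (sigma CE) (tnabla CE (nabla C) t).

Section Tower.
Variables (C : bimod_conn Om1) (E : bimod A) (CE : bimod_conn E).

(* nabla_(n,E); for E = Omega^1 this is nabla_{n+1} on (Omega^1)^{⊗ n+1} *)
Fixpoint nablaT (n : nat) : tower E n -> tower E n.+1 :=
  if n is m.+1 then tnabla C (@nablaT m) else nabla CE.

Lemma nablaT_left n : left_conn (@nablaT n).
Proof. by elim: n => [|n IH] /=; [apply: nabla_left | apply: tnabla_leftP]. Qed.

Fixpoint nabla_iter (n : nat) (s : E) : tower E n :=
  if n is m.+1 then nablaT (nabla_iter m s) else s.

(* sigma_E^{m+1} = sigma_{E,m+1} ... sigma_{E,1} *)
Fixpoint sigmaT (m : nat) : (E ⊗ tower Om1 m)%B -> tower E m.+1 :=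
  if m is m'.+1 then fun t => idt (@sigmaT m') (braid12 (sigma CE) t)
  else sigma CE.

Definition sigma_pow (n : nat) : (E ⊗ tpow n)%B -> tower E n :=
  match n return (E ⊗ tpow n)%B -> tower E n with
  | 0 => tlift (fun s (a : Om 0) => s *> (a : A))
  | m.+1 => @sigmaT m
  end.
End Tower.

(* nabla^n a = nabla_{n-1} ... nabla_1 da *)
Definition nabla_pow (C : bimod_conn Om1) (n : nat) (a : A) : tpow n :=
  if n is m.+1 then nabla_iter C C m (da O a) else a.

Section Binomials.
Variables (C : bimod_conn Om1) (X : bimod A).

(* sigma in the tensor factors i+1, i+2 of (Omega^1)^{⊗ n} ⊗ X *)
Fixpoint sigma_at (i n : nat) : tower X n -> tower X n :=
  match n return tower X n -> tower X n with
  | 0 => id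
  | m.+1 => match i with
    | 0 => match m return (Om1 ⊗ tower X m)%B -> (Om1 ⊗ tower X m)%B with
           | 0 => id
           | m'.+1 => braid12 (sigma C)
           end
    | i'.+1 => idt (@sigma_at i' m)
    end
  end.

(* sigma_1 sigma_2 ... sigma_r *)
Definition sigma_chain (r n : nat) (x : tower X n) : tower X n :=
  foldr (fun i y => sigma_at i y) x (iota 0 r).

(* the braided binomial [n choose k, sigma] ⊗ id_X *)
Fixpoint bbinom (n k : nat) : tower X n -> tower X n :=
  match n return tower X n -> tower X n with
  | 0 => id
  | m.+1 => fun x =>
      if (k == 0) || (k == m.+1) then x
      else idt (@bbinom m k.-1) (sigma_chain (m.+1 - k) x) + idt (@bbinom m k) x
  end.
End Binomials.

(* concatenation (Omega^1)^{⊗ m} ⊗ ((Omega^1)^{⊗ j} ⊗ E) -> (Omega^1)^{⊗ m+j} ⊗ E *)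
Fixpoint tcatT E (m j : nat) : (tower Om1 m ⊗ tower E j)%B -> tower E (m.+1 + j) :=
  match m return (tower Om1 m ⊗ tower E j)%B -> tower E (m.+1 + j) with
  | 0 => id
  | m'.+1 => fun t => idt (@tcatT E m' j) (tassoc t)
  end.
Definition tcat E (m j : nat) : (tpow m ⊗ tower E j)%B -> tower E (m + j) :=
  match m return (tpow m ⊗ tower E j)%B -> tower E (m + j) with
  | 0 => tlift (fun (a : Om 0) x => (a : A) <* x)
  | m'.+1 => @tcatT E m' j
  end.

(* id^j ⊗ sigma_E^m on ((Omega^1)^{⊗ j} ⊗ E) ⊗ (Omega^1)^{⊗ m} *)
Fixpoint sigma_cat E (CE : bimod_conn E) (j m : nat) :
    (tower E j ⊗ tpow m)%B -> tower E (j + m) :=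
  match j return (tower E j ⊗ tpow m)%B -> tower E (j + m) with
  | 0 => sigma_pow CE (n := m)
  | j'.+1 => fun t => idt (@sigma_cat E CE j' m) (tassoc t)
  end.

Lemma sigmaT_map E (CE : bimod_conn E) m : bimod_map (@sigmaT E CE m).
Proof.
elim: m => [|m IH] /=; first exact: sigma_map.
exact: (bimod_map_comp (idt_map Om1 IH) (braid12_map _ (sigma_map CE))).
Qed.
Lemma ract_bib E : bibalanced (fun s (a : Om 0) => s *> (a : A) : E).
Proof.
split=> [|a s b|s b a]; last 1 first.
- by rewrite -ractM -(wedge_deg0 O) [_ *> a in LHS]gcast_id.
- split=> [s s' a|s a a'|s a b]; first exact: ractDl.
    exact: ractDr.
  by rewrite -ractM -(wedge_deg0 O).
- by rewrite lractA.
Qed.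
Lemma lact_bib E : bibalanced (fun (a : Om 0) (s : E) => (a : A) <* s).
Proof.
split=> [|a b s|b s a]; last 1 first.
- by rewrite lractA.
- split=> [b b' s|b s s'|b a s]; first exact: lactDl.
    exact: lactDr.
  by rewrite -lactM -(wedge_deg0 O) [_ *> a in LHS]gcast_id.
- by rewrite -lactM -(wedge_deg0 O).
Qed.
Lemma sigma_pow_map E (CE : bimod_conn E) n : bimod_map (@sigma_pow E CE n).
Proof.
by case: n => [|n]; [apply/tlift_map/ract_bib | apply: sigmaT_map].
Qed.
Lemma sigma_at_map C X i n : bimod_map (@sigma_at C X i n).
Proof.
elim: n i => [|n IH] [|i] //=; last exact: idt_map.
by case: n {IH} => [//|n]; apply: braid12_map (sigma_map C).
Qed.
Lemma sigma_chain_map C X r n : bimod_map (@sigma_chain C X r n).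
Proof.
rewrite /sigma_chain; elim: (iota 0 r) => [//|i s IH] /=.
exact: (bimod_map_comp (sigma_at_map C X i n) IH).
Qed.
Lemma bbinom_map C X n k : bimod_map (@bbinom C X n k).
Proof.
elim: n k => [|n IH] k //=; case: (_ || _) => //.
apply: bimod_mapD; last exact: idt_map.
exact: (bimod_map_comp (idt_map Om1 (IH _)) (sigma_chain_map C X _ n.+1)).
Qed.
Lemma tcat_map E m j : bimod_map (@tcat E m j).
Proof.
case: m => [|m] /=; first exact/tlift_map/lact_bib.
elim: m => [//|m IH] /=.
exact: (bimod_map_comp (idt_map Om1 IH) (tassoc_map _ _ _)).
Qed.
Lemma sigma_cat_map E (CE : bimod_conn E) j m : bimod_map (@sigma_cat E CE j m).
Proof.
elim: j => [|j IH] /=; first exact: sigma_pow_map.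
exact: (bimod_map_comp (idt_map Om1 IH) (tassoc_map _ _ _)).
Qed.

(* eta ⊙_E x and x ⊙_E eta, for eta of degree m and x of degree j *)
Definition odotl C E (m j : nat) (eta : tpow m) (x : tower E j) : tower E (m + j) :=
  @bbinom C E (m + j) j (tcat (eta ⊠ x)).
Definition odotr C E (CE : bimod_conn E) (j m : nat) (x : tower E j) (eta : tpow m) :
    tower E (j + m) :=
  @bbinom C E (j + m) m (sigma_cat CE (x ⊠ eta)).

End Connections.

Section SubBimodule.
Context {K : fieldType} {A : algType K} (M : bimod A).

Record subbimod := SubBimod {
  sub_pred : {pred M};
  sub_lin : forall (c : K) x y, x \in sub_pred -> y \in sub_pred ->
    c *: x + y \in sub_pred;
  sub0 : 0 \in sub_pred;
  sub_lact : forall a x, x \in sub_pred -> a <* x \in sub_pred;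
  sub_ract : forall x a, x \in sub_pred -> x *> a \in sub_pred }.

Variable S : subbimod.

Record subcar := SubCar { subval : M; subvalP : subval \in sub_pred S }.

Fact sub_pred_closed : submod_closed (sub_pred S).
Proof. by split=> [|c x y]; [apply: sub0 | apply: sub_lin]. Qed.
HB.instance Definition _ :=
  GRing.isSubmodClosed.Build K M (sub_pred S) sub_pred_closed.
HB.instance Definition _ := [isSub of subcar for subval].
HB.instance Definition _ := [Choice of subcar by <:].
HB.instance Definition _ := [SubChoice_isSubLmodule of subcar by <:].

Definition sub_l (a : A) (x : subcar) : subcar := SubCar (sub_lact a (subvalP x)).
Definition sub_r (x : subcar) (a : A) : subcar := SubCar (sub_ract a (subvalP x)).

Fact sub_axioms : bimod_axioms sub_l sub_r.
Proof.
have vD (x y : subcar) : subval (x + y) = subval x + subval y := raddfD val x y.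
have vZ c (x : subcar) : subval (c *: x) = c *: subval x := linearZ_LR val c x.
split=> *; apply: val_inj; rewrite /= ?(vD, vZ) /=.
all: rewrite ?lactDl ?lactDr ?lactZl ?lactZr ?lact1 ?lactM.
all: by rewrite ?ractDl ?ractDr ?ractZl ?ractZr ?ract1 ?ractM ?lractA.
Qed.

Definition subB : bimod A := Bimod sub_axioms.
Definition subB_val (x : subB) : M := subval x.
Lemma subB_val_map : bimod_map subB_val.
Proof. by split=> // c x y; apply: (linearP (val : subcar -> M)). Qed.
End SubBimodule.

Section Symmetric.
Context {K : fieldType} {A : algType K} (O : dga A).
Local Notation Om := (Om O).
Local Notation Om1 := (Om 1).
Local Notation tower := (tower O).
Local Notation tpow := (tpow O).

(* the wedge product in the tensor factors i+1, i+2 of (Omega^1)^{⊗ n} ⊗ X;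
   only meaningful for i+1 < n *)
Fixpoint wedge_cod (X : bimod A) (i n : nat) : bimod A :=
  match i, n with
  | 0, m.+2 => (Om 2 ⊗ tower X m)%B
  | i'.+1, m.+1 => (Om1 ⊗ wedge_cod X i' m)%B
  | _, _ => X
  end.
Fixpoint wedge_at (X : bimod A) (i n : nat) : tower X n -> wedge_cod X i n :=
  match i, n return tower X n -> wedge_cod X i n with
  | 0, m.+2 => @wedge12 K A O (tower X m)
  | i'.+1, m.+1 => idt (@wedge_at X i' m)
  | 0, 0 | 0, 1 | _.+1, 0 => fun _ => 0
  end.

(* the same on (Omega^1)^{⊗ m+1}; only meaningful for i < m *)
Fixpoint wedge_pcod (i m : nat) : bimod A :=
  match i, m with
  | 0, 1 => Om 2
  | 0, m'.+2 => (Om 2 ⊗ tower Om1 m')%B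
  | i'.+1, m'.+1 => (Om1 ⊗ wedge_pcod i' m')%B
  | _, _ => Om1
  end.
Fixpoint wedge_pat (i m : nat) : tower Om1 m -> wedge_pcod i m :=
  match i, m return tower Om1 m -> wedge_pcod i m with
  | 0, 1 => wedge2 O
  | 0, m'.+2 => @wedge12 K A O (tower Om1 m')
  | i'.+1, m'.+1 => idt (@wedge_pat i' m')
  | 0, 0 | _.+1, 0 => fun _ => 0
  end.

Lemma wedge_at_map X i n : bimod_map (@wedge_at X i n).
Proof.
elim: i n => [|i IH] [|n]; try exact: bimod_map0.
  by case: n => [|n]; [apply: bimod_map0 | apply: wedge12_map].
exact: idt_map.
Qed.
Lemma wedge_pat_map i m : bimod_map (@wedge_pat i m).
Proof.
elim: i m => [|i IH] [|m]; try exact: bimod_map0.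
  by case: m => [|m]; [apply: wedge2_map | apply: wedge12_map].
exact: idt_map.
Qed.

Definition joint_ker (M : bimod A) (D : pred nat) (N : nat -> bimod A)
    (f : forall i, M -> N i) (fM : forall i, bimod_map (f i)) : subbimod M.
Proof.
apply: (@SubBimod _ _ _ [pred x | `[< forall i, D i -> f i x = 0 >]]).
- move=> c x y /asboolP hx /asboolP hy; apply/asboolP => i Di.
  by rewrite (bmapP (fM i)) hx // hy // scaler0 addr0.
- by apply/asboolP => i _; rewrite (bmap0 (fM i)).
- move=> a x /asboolP hx; apply/asboolP => i Di.
  by rewrite (bmapl (fM i)) hx // lact0.
- move=> x a /asboolP hx; apply/asboolP => i Di.
  by rewrite (bmapr (fM i)) hx // ract0.
Defined.

Definition OmS (n : nat) : bimod A :=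
  if n is m.+1 then
    subB (joint_ker [pred i | i < m]%N (fun i => wedge_pat_map i m))
  else Om 0.

(* Omega_S^n ⊗ E has to be read inside (Omega^1)^{⊗ n} ⊗ E, where sigma_E^n and
   nabla_E^n take their values.  The canonical map between the two is injective
   with image the joint kernel symE of the wedge_i ⊗ id_E when E is flat as a
   left A-module, but it need not be injective in general.  Two models are
   given: the joint kernel itself (ker_model) and the tensor product with its
   canonical map (tens_model). *)
Section Coefficients.
Variable E : bimod A.

Definition symE (n : nat) : subbimod (tower E n) :=
  joint_ker [pred i | i.+1 < n]%N (fun i => wedge_at_map E i n).

Record sym_model := SymModel {
  sym_car :> nat -> lmodType K;
  sym_iota : forall n, sym_car n -> tower E n }.

Definition ker_model : sym_model :=
  @SymModel (fun n => subB (symE n)) (fun n => @subB_val _ _ _ (symE n)).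

(* concatenation (Omega^1)^{⊗ m+1} ⊗ E -> (Omega^1)^{⊗ m+1} ⊗ E *)
Fixpoint tapp (m : nat) : (tower Om1 m ⊗ E)%B -> tower E m.+1 :=
  match m return (tower Om1 m ⊗ E)%B -> tower E m.+1 with
  | 0 => id
  | m'.+1 => fun t => idt (@tapp m') (tassoc t)
  end.

Definition tens_car (n : nat) : bimod A :=
  if n is m.+1 then (OmS m.+1 ⊗ E)%B else E.
Definition tens_iota (n : nat) : tens_car n -> tower E n :=
  match n return tens_car n -> tower E n with
  | 0 => id
  | m.+1 => fun t => @tapp m (tmap (@subB_val _ _ _ _) (fun s => s) t)
  end.

Lemma tapp_map m : bimod_map (@tapp m).
Proof.
elim: m => [//|m IH] /=.
exact: (bimod_map_comp (idt_map Om1 IH) (tassoc_map _ _ _)).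
Qed.
Lemma tens_iota_map n : bimod_map (@tens_iota n).
Proof.
case: n => [//|n]; apply: (bimod_map_comp (tapp_map n)).
by apply: tmap_map => //; apply: subB_val_map.
Qed.

Definition tens_model : sym_model := @SymModel tens_car tens_iota.

Definition sym_identified (X : sym_model) : Prop :=
  forall n, injective (@sym_iota X n) /\
    forall y : tower E n, y \in sub_pred (symE n) <-> exists x, @sym_iota X n x = y.

End Coefficients.
End Symmetric.

(* J^k = X 0 ⊕ ... ⊕ X k *)
Section Jet.
Context {K : fieldType} (X : nat -> lmodType K) (k : nat).

Definition jet : Type := forall i : 'I_k.+1, X i.
HB.instance Definition _ := Choice.copy jet (forall i : 'I_k.+1, X i).

Definition jadd (x y : jet) : jet := fun i => x i + y i.
Definition jopp (x : jet) : jet := fun i => - x i.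
Definition jzero : jet := fun=> 0.
Definition jscale (c : K) (x : jet) : jet := fun i => c *: x i.
Fact jaddA : associative jadd.
Proof. by move=> x y z; apply: functional_extensionality_dep => i; apply: addrA. Qed.
Fact jaddC : commutative jadd.
Proof. by move=> x y; apply: functional_extensionality_dep => i; apply: addrC. Qed.
Fact jadd0 : left_id jzero jadd.
Proof. by move=> x; apply: functional_extensionality_dep => i; apply: add0r. Qed.
Fact jaddN : left_inverse jzero jopp jadd.
Proof. by move=> x; apply: functional_extensionality_dep => i; apply: addNr. Qed.
HB.instance Definition _ := GRing.isZmodule.Build jet jaddA jaddC jadd0 jaddN.
Fact jscaleA c d x : jscale c (jscale d x) = jscale (c * d) x.
Proof. by apply: functional_extensionality_dep => i; apply: scalerA. Qed.
Fact jscale1 : left_id 1 jscale.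
Proof. by move=> x; apply: functional_extensionality_dep => i; apply: scale1r. Qed.
Fact jscaleDr : right_distributive jscale +%R.
Proof. by move=> c x y; apply: functional_extensionality_dep => i; apply: scalerDr. Qed.
Fact jscaleDl x : {morph jscale^~ x : c d / c + d}.
Proof. by move=> c d; apply: functional_extensionality_dep => i; apply: scalerDl. Qed.
HB.instance Definition _ :=
  GRing.Zmodule_isLmodule.Build K jet jscaleA jscale1 jscaleDr jscaleDl.

(* x lies in the summand X j *)
Definition homog (j : 'I_k.+1) (x : jet) : Prop := forall i, i != j -> x i = 0.
End Jet.

Definition jet_pi (K : fieldType) (X : nat -> lmodType K) k (x : jet X k.+1) : jet X k :=
  fun i => x (widen_ord (leqnSn k.+1) i).

Section JetStatement.
Context {K : fieldType} {A : algType K} {O : dga A} (C : bimod_conn O (Om O 1)).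
Context {E : bimod A} (CE : bimod_conn O E) (X : sym_model O E).

(* a •_k x = sum_{i = j}^k nabla^{i-j} a ⊙_E x for x in the summand j: the
   components of degree i < j vanish, that of degree m + j is nabla^m a ⊙_E x *)
Definition left_jet_action k (l : A -> jet X k -> jet X k) : Prop :=
  forall a (j : 'I_k.+1) x, homog j x ->
    (forall i : 'I_k.+1, (i < j)%N -> l a x i = 0) /\
    (forall m (h : (m + j < k.+1)%N),
      sym_iota (l a x (Ordinal h)) = odotl C (nabla_pow C m a) (sym_iota (x j))).

Definition right_jet_action k (r : jet X k -> A -> jet X k) : Prop :=
  forall a (j : 'I_k.+1) x, homog j x ->
    (forall i : 'I_k.+1, (i < j)%N -> r x a i = 0) /\
    (forall m (h : (j + m < k.+1)%N),
      sym_iota (r x a (Ordinal h)) = odotr C CE (sym_iota (x j)) (nabla_pow C m a)).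

Definition jet_map k (f : E -> jet X k) : Prop :=
  forall s (i : 'I_k.+1), sym_iota (f s i) = nabla_iter C CE i s.

Definition jet_bimodules : Prop :=
  exists (l : forall k, A -> jet X k -> jet X k)
         (r : forall k, jet X k -> A -> jet X k)
         (j : forall k, E -> jet X k),
  (forall k, [/\ left_jet_action (l k), right_jet_action (r k), jet_map (j k),
      bimod_axioms (l k) (r k)
    & bimod_map_for (@lact K A E) (@ract K A E) (l k) (r k) (j k)]) /\
  (forall k, let pi := @jet_pi K X k in
    [/\ bimod_map_for (l k.+1) (r k.+1) (l k) (r k) pi,
      forall y, exists x, pi x = y,
      forall x, pi x = 0 <-> homog ord_max x
    & forall s, pi (j k.+1 s) = j k s]).

End JetStatement.

(* Main.v *)
From mathcomp Require Import all_boot all_algebra.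
From mathcomp Require Import boolp zify.
Require Import Defs.

Set Implicit Arguments.
Unset Strict Implicit.
Unset Printing Implicit Defensive.

Import GRing.Theory.
Local Open Scope ring_scope.

(** The product ⊙ is a braided shuffle product: composed with concatenation, the
    binomial [n choose k, sigma] sums the braid lifts of the (n-k, k)-shuffles.
    Everything rests on two facts about such sums, proved here for arbitrary
    additive operators s_0, s_1, ... on an abelian group.

    - qbin_assoc: if the s_p satisfy the braid relations, the two ways of
      shuffling three blocks agree. This is associativity of ⊙.
    - qbin_sym: if wedge_p o s_p = - wedge_p, and if the kernels of the wedges are
      carried along by pairs of braidings, the shuffle sum sends a tensor that is
      symmetric in each of its two blocks to a symmetric tensor. This is why ⊙
      and the jet actions stay inside the symmetric forms.

    The hypotheses on the connections provide exactly these relations. Since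
    Omega^1 is spanned as a right module by exact forms, a right linear identity
    need only be checked on da, and there it can be read off by comparing two
    Leibniz rules. Leibniz compatibility then gives the coloured braid relation
    (coloured_braid), torsion freeness gives wedge o sigma = - wedge
    (wedge2_braid), and the wedge passes through sigma from one side by
    extendability (extend_wedge12) and from the other by wedge-compatibility
    (wedge12_braid2).

    For the derivatives, the tensor product connection commutes with sigma_i
    (nablaT_sigma), so that nabla (u ⊙ v) splits into a shuffle sum of
    (nabla u, v) and one of (u, nabla v), the latter with the new form carried to
    the front. These two parts are the two terms of the recursion of the binomial
    one degree higher. Hence nabla^n (a s) = sum over i+j=n of
    nabla^i a ⊙ nabla^j s, and likewise for s a (nabla_iter_shuffles). Flatness
    and wedge-compatibility make nabla^n s symmetric (nabla_iter_sym).

    A jet is then a truncated sequence of symmetric tensors, and the two actions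
    are convolutions with the sequence (nabla^n a)_n. The Leibniz formulas say
    that a |-> (nabla^n a)_n is multiplicative for convolution and that j^k is a
    bimodule map; associativity of convolution gives the remaining axioms. Only
    components of degree at most n enter degree n, whence the truncation maps
    pi_k.

    The powers of Omega^1 are treated on the same footing as the modules
    (Omega^1)^n ⊗ E by writing them as (Omega^1)^n ⊗ A and giving A the connection
    d (conn0): left and right actions, and the product of two forms, become
    instances of one notion (gaction). *)

(** * Shuffle sums of braidings *)

Section Shuffles.
Implicit Types V W : zmodType.

Definition additive_op V W (f : V -> W) := {morph f : x y / x + y}.

Lemma additive_op0 V W (f : V -> W) : additive_op f -> f 0 = 0.
Proof. by move=> fD; apply: (@addrI _ (f 0)); rewrite -fD !addr0. Qed.

Lemma additive_op_sum V W (f : V -> W) (I : Type) (r : seq I) (P : pred I) F :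
  additive_op f -> f (\sum_(i <- r | P i) F i) = \sum_(i <- r | P i) f (F i).
Proof. by move=> fD; apply: (big_morph f fD (additive_op0 fD)). Qed.

(** The braid s_0 s_1 ... s_(r-1): it carries the strand in position r to the front. *)
Definition cyc V (s : nat -> V -> V) (r : nat) (x : V) : V := foldr s x (iota 0 r).

(** The recursion of the braided binomial, for any sequence of operators on one
    fixed group: passing to the factors behind the first one is the shift s o S. *)
Fixpoint qbin V (s : nat -> V -> V) (n k : nat) (x : V) : V :=
  if n is m.+1 then
    if (k == 0%N) || (k == m.+1) then x
    else qbin (s \o S) m k.-1 (cyc s (m.+1 - k) x) + qbin (s \o S) m k x
  else x.

Lemma cycD V (s : nat -> V -> V) i j x :
  cyc s (i + j) x = cyc s i (cyc (s \o addn i) j x).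
Proof. by rewrite /cyc iotaD foldr_cat add0n -[in iota i j](addn0 i) iotaDl foldr_map. Qed.

Lemma cycS V (s : nat -> V -> V) r x : cyc s r.+1 x = s 0 (cyc (s \o S) r x).
Proof. by rewrite (cycD s 1). Qed.

Lemma cycSr V (s : nat -> V -> V) r x : cyc s r.+1 x = cyc s r (s r x).
Proof. by rewrite -addn1 cycD /cyc /= addn0. Qed.

Lemma qbin0 V (s : nat -> V -> V) n x : qbin s n 0 x = x.
Proof. by case: n. Qed.

Lemma qbinn V (s : nat -> V -> V) n x : qbin s n n x = x.
Proof. by case: n => //= n; rewrite eqxx. Qed.

(** The first strand of the result comes from the right block, after crossing the
    i + 1 strands of the left one, or it is the first strand of the left block. *)
Lemma qbinS V (s : nat -> V -> V) m i j x : (i + j.+1)%N = m ->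
  qbin s m.+1 j.+1 x =
  qbin (s \o S) m j (cyc s i.+1 x) + qbin (s \o S) m j.+1 x.
Proof.
move=> <-; rewrite [LHS]/= eqSS ifF; last by apply/eqP; lia.
by have -> : ((i + j.+1).+1 - j.+1 = i.+1)%N by lia.
Qed.

Lemma cyc_nat V W (s : nat -> V -> V) (t : nat -> W -> W) (f : V -> W) r x :
  (forall p y, (p < r)%N -> f (s p y) = t p (f y)) ->
  f (cyc s r x) = cyc t r (f x).
Proof.
elim: r x => // r IH x h; rewrite !cycSr IH; last by move=> p y pr; apply: h; lia.
by rewrite h.
Qed.

(** An operator that intertwines the braidings intertwines the shuffle sums. All
    commutations with concatenation, with the derivatives and with the braid of a
    single strand across a block are instances. *)
Lemma qbin_nat V W (s : nat -> V -> V) (t : nat -> W -> W) (f : V -> W) n k x :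
  additive_op f -> (forall p y, (p.+1 < n)%N -> f (s p y) = t p (f y)) ->
  f (qbin s n k x) = qbin t n k (f x).
Proof.
move=> fD; elim: n k s t x => //= n IH k s t x h.
case: ifP => // /negbT /norP [k0 _].
have hS p y : (p.+1 < n)%N -> f ((s \o S) p y) = (t \o S) p (f y).
  by move=> pn; apply: (h p.+1).
rewrite fD !(IH _ _ (t \o S)) //; congr (qbin _ _ _ _ + _).
by apply: cyc_nat => p y pn; apply: h; lia.
Qed.

Lemma cyc_additive V (s : nat -> V -> V) r :
  (forall p, additive_op (s p)) -> additive_op (cyc s r).
Proof. by move=> sD; elim: r => // r IH x y; rewrite !cycSr sD IH. Qed.

Lemma qbin_additive V (s : nat -> V -> V) n k :
  (forall p, additive_op (s p)) -> additive_op (qbin s n k).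
Proof.
elim: n k s => //= n IH k s sD x y; case: ifP => // _.
have sD' p : additive_op ((s \o S) p) by apply: sD.
by rewrite cyc_additive // !IH // addrACA.
Qed.

Definition far_commute V n (s : nat -> V -> V) := forall p q x,
  (p.+1 < q)%N -> (q.+1 < n)%N -> s p (s q x) = s q (s p x).

Definition braided V n (s : nat -> V -> V) := forall p x, (p.+2 < n)%N ->
  s p (s p.+1 (s p x)) = s p.+1 (s p (s p.+1 x)).

Lemma far_commute_shift V n (s : nat -> V -> V) :
  far_commute n.+1 s -> far_commute n (s \o S).
Proof. by move=> h p q x pq qn; apply: h. Qed.

Lemma braided_shift V n (s : nat -> V -> V) : braided n.+1 s -> braided n (s \o S).
Proof. by move=> h p x pn; apply: h. Qed.

Lemma cyc_far V n (s : nat -> V -> V) r q x : far_commute n s ->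
  (r < q)%N -> (q.+1 < n)%N -> cyc s r (s q x) = s q (cyc s r x).
Proof.
move=> sC rq qn; symmetry; apply: (cyc_nat (f := s q)) => p y pr.
by rewrite [RHS]sC //; lia.
Qed.

(** Carrying strand r to the front moves every crossing that it passes one step
    to the right. *)
Lemma cyc_braid V n (s : nat -> V -> V) r p x : far_commute n s -> braided n s ->
  (p.+1 < r < n)%N -> cyc s r (s p x) = s p.+1 (cyc s r x).
Proof.
move=> sC sB; elim: r x => // r IH x /andP [pr rn].
rewrite !cycSr; move: pr; rewrite ltnS leq_eqVlt => /predU1P [pr|pr].
  rewrite -pr !cycSr sB; last by lia.
  by rewrite (cyc_far _ sC) //; lia.
by rewrite -sC ?IH //; lia.
Qed.

(** By induction on the number of strands, according to the block from which the
    first strand of the result comes. From the last block: the strand crosses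
    i + j others, and the inner shuffle sum slides past it by [cyc_braid]. From
    the middle block: both sides bring it forward through i strands. From the
    first block: it stays in place. *)
Lemma qbin_assoc V (s : nat -> V -> V) i j k x :
  (forall p, additive_op (s p)) ->
  far_commute (i + j + k) s -> braided (i + j + k) s ->
  qbin s (i + j + k) k (qbin s (i + j) j x) =
  qbin s (i + j + k) (j + k) (qbin (s \o addn i) (j + k) k x).
Proof.
have [n e] : exists n, (i + j + k)%N = n by exists (i + j + k)%N.
elim: n i j k s x e => [|n IH] i j k s x e sD sC sB.
  by have [-> -> ->] : [/\ i = 0, j = 0 & k = 0]%N by split; lia.
case: i j k e sC sB => [|i] [|j] [|k] e sC sB; rewrite ?(addn0, add0n) ?(qbin0, qbinn) //.
have sD' p : additive_op ((s \o S) p) by apply: sD.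
have IH' i' j' k' m l y : (i' + j' + k' = n)%N -> (i' + j' = m)%N -> (j' + k' = l)%N ->
    qbin (s \o S) n k' (qbin (s \o S) m j' y) =
    qbin (s \o S) n l (qbin (s \o addn i'.+1) l k' y).
  move=> e' <- <-; rewrite -e'; apply: IH; rewrite ?e' //.
    by apply: far_commute_shift; rewrite -e.
  by apply: braided_shift; rewrite -e.
rewrite e in sC sB *.
have cycB a y : cyc s (i + j.+1).+1 (qbin s (i + j.+1).+1 a y) =
    qbin (s \o S) (i + j.+1).+1 a (cyc s (i + j.+1).+1 y).
  apply: qbin_nat => [|p z pn]; first exact: cyc_additive.
  by rewrite /= (cyc_braid _ sC sB) //; lia.
have cycF a y : cyc s i.+1 (qbin (s \o addn i.+2) (j + k.+1) a y) =
    qbin (s \o addn i.+2) (j + k.+1) a (cyc s i.+1 y).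
  apply: qbin_nat => [|p z pn]; first exact: cyc_additive.
  by rewrite /= (cyc_far _ sC) //; lia.
rewrite [in RHS]addSn.
have shE a : (s \o addn a) \o S = s \o addn a.+1.
  by apply/funext => p; rewrite /= addnS.
have qL := @qbinS V s n (i + j.+1) k; have qR := @qbinS V s n i (j + k.+1).
rewrite addSn qL ?qR; try by lia.
rewrite cycB (IH' i.+1 j.+1 k _ (j + k.+1)%N); try by lia.
rewrite (@qbinS V s _ i j) // (qbin_additive (s := s \o S)) //.
rewrite (IH' i.+1 j k.+1 _ (j + k.+1)%N); try by lia.
rewrite (IH' i j.+1 k.+1 _ (j + k.+1).+1); try by lia.
rewrite (@qbinS V (s \o addn i.+1) _ j k) // shE.
rewrite cyc_additive // !cycF -cycD addSn.
by rewrite !(qbin_additive (s := s \o S)) // !addrA.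
Qed.

(** The part of the calculus of wedges that symmetry of shuffle sums uses, where
    Z p stands for the kernel of the wedge in positions p, p+1. Only kernels are
    recorded, so that the wedges may have different targets. *)
Record sym_kernels V n (s : nat -> V -> V) (Z : nat -> V -> Prop) : Prop := {
  ker0 : forall p, Z p 0;
  kerD : forall p x y, Z p x -> Z p y -> Z p (x + y);
  ker_anti : forall p x, (p.+1 < n)%N -> Z p (s p x + x);
  ker_up : forall p x, (p.+2 < n)%N -> Z p x -> Z p.+1 (s p (s p.+1 x));
  ker_down : forall p x, (p.+2 < n)%N -> Z p.+1 x -> Z p (s p.+1 (s p x));
  ker_far : forall p q x, (p.+1 < n)%N -> (q.+1 < n)%N ->
    (p.+1 < q)%N || (q.+1 < p)%N -> Z q x -> Z q (s p x) }.

Lemma sym_kernels_shift V n (s : nat -> V -> V) (Z : nat -> V -> Prop) :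
  sym_kernels n.+1 s Z -> sym_kernels n (s \o S) (Z \o S).
Proof.
move=> h; split => /=.
- by move=> p; apply: (ker0 h).
- by move=> p; apply: (kerD h).
- by move=> p x pn; apply: (ker_anti h).
- by move=> p x pn; apply: (ker_up h).
- by move=> p x pn; apply: (ker_down h).
- by move=> p q x pn qn pq; apply: (ker_far h).
Qed.

Lemma cyc_ker V n (s : nat -> V -> V) Z r q x : sym_kernels n s Z -> (r < n)%N ->
  (q.+1 < n)%N -> (r < q)%N -> Z q x -> Z q (cyc s r x).
Proof.
move=> h rn qn; elim: r rn x => // r IH rn x rq Zx; rewrite cycSr.
by apply: IH; [lia | lia | apply: (ker_far h) => //; lia].
Qed.

Lemma cyc_ker_up V n (s : nat -> V -> V) Z r q x : sym_kernels n s Z -> (r < n)%N ->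
  (q.+1 < r)%N -> Z q x -> Z q.+1 (cyc s r x).
Proof.
move=> h; elim: r x => // r IH x rn; rewrite ltnS leq_eqVlt => /predU1P [e|qr] Zx.
  rewrite -e !cycSr; apply: (cyc_ker h); [lia | lia | lia |].
  by apply: (ker_up h) => //; lia.
by rewrite cycSr; apply: IH => //; [lia | apply: (ker_far h) => //; lia].
Qed.

Lemma qbin_ker V n (s : nat -> V -> V) Z m k x : sym_kernels n s Z ->
  (m.+2 <= n)%N -> Z 0 x -> Z 0 (qbin (fun p => s p.+2) m k x).
Proof.
move=> h mn; set t := fun p => s p.+2.
have: (forall p y, (p.+1 < m)%N -> Z 0 y -> Z 0 (t p y)).
  by move=> p y pm; apply: (ker_far h); lia.
elim: m k (t) x {mn} => {t} //= m IH k t x ht Zx; case: ifP => // /negbT /norP [k0 _].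
have ht' p y : (p.+1 < m)%N -> Z 0 y -> Z 0 ((t \o S) p y).
  by move=> pm; apply: (ht p.+1); lia.
apply: (kerD h); apply: IH => //.
have: (m.+1 - k < m.+1)%N by lia.
elim: (m.+1 - k)%N x Zx => // r IHr y Zy rm; rewrite cycSr.
by apply: IHr; [apply: ht => //; lia | lia].
Qed.

(** The two strands in positions r, r+1 are carried to the front together; their
    wedge follows them step by step through ker_down. *)
Lemma cyc_cyc_ker V n (s : nat -> V -> V) Z r x : far_commute n s ->
  sym_kernels n s Z -> (r.+1 < n)%N -> Z r x -> Z 0 (cyc (s \o S) r (cyc s r x)).
Proof.
move=> sC h; elim: r x => // r IH x rn Zx; rewrite !cycSr /= -(cyc_far _ sC) //.
by apply: IH; [lia | apply: (ker_down h)].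
Qed.

(** For p > 0 the wedge avoids the first strand, and the induction hypothesis
    applies to both terms of the recursion. For p = 0, expand twice. If the first
    two strands come from the same block, the kernel condition there is
    transported to the front. The two remaining terms, one strand from each block
    in either order, add up to a shuffle of s_0 y + y, which ker_anti kills. *)
Lemma qbin_sym V n (s : nat -> V -> V) Z i j x : (i + j)%N = n ->
  (forall p, additive_op (s p)) -> far_commute n s -> sym_kernels n s Z ->
  (forall p, (p.+1 < n)%N -> p.+1 <> i -> Z p x) ->
  forall p, (p.+1 < n)%N -> Z p (qbin s n j x).
Proof.
elim: n i j s Z x => // n IH [|i] [|j] s Z x e sD sC h Zx p pn.
- by rewrite qbin0; apply: Zx.
- by move: e; rewrite add0n => ->; rewrite qbinn; apply: Zx.
- by rewrite qbin0; apply: Zx => //; lia.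
have sD' q : additive_op ((s \o S) q) by apply: sD.
have sC' := far_commute_shift sC; have h' := sym_kernels_shift h.
rewrite (@qbinS V s _ i j); last by lia.
case: p pn => [|p] pn; last first.
  apply: (kerD h).
    apply: (IH i.+1 j _ (Z \o S)) => // [|q qn qi]; first by lia.
    have [qi'|qi'] := ltnP q.+1 i.+1.
      by apply: (cyc_ker_up h); [lia | lia | apply: Zx; lia].
    by apply: (cyc_ker h); [lia | lia | lia | apply: Zx; lia].
  apply: (IH i j.+1 _ (Z \o S)) => // [|q qn qi]; first by lia.
  by apply: Zx; lia.
case: n IH e sC h Zx pn sC' h' => [|n] IH e sC h Zx pn sC' h'; first by lia.
(* y: the first strand of the right block carried to position 1; Q shuffles all but the first two strands. *)
rewrite cycS; set y := cyc _ _ x; pose Q := qbin (fun p => s p.+2) n.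
have QZ k z : Z 0%N z -> Z 0%N (Q k z) by apply: qbin_ker h _; lia.
have [t1 Zt1 ->] : exists2 t, Z 0%N t &
    qbin (s \o S) n.+1 j (s 0 y) = t + Q j (s 0 y).
  case: j e {QZ} => [|j] e.
    by exists 0; [apply: (ker0 h) | rewrite /Q !qbin0 add0r].
  exists (Q j (cyc (s \o S) i.+1 (cyc s i.+1 x))).
    apply: (qbin_ker _ h); first by lia.
    by apply: (cyc_cyc_ker sC h); [lia | apply: Zx; lia].
  by rewrite (@qbinS V _ _ i j) ?cycS; last by lia.
have [t2 Zt2 ->] : exists2 t, Z 0%N t &
    qbin (s \o S) n.+1 j.+1 x = Q j y + t.
  case: i e Zx @y {t1 Zt1} => [|i] e Zx y.
    have en : n = j by lia.
    exists 0; first exact: (ker0 h).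
    by rewrite /Q /y en !qbinn addr0.
  exists (Q j.+1 x); first by apply: QZ; apply: Zx; lia.
  by rewrite (@qbinS V _ _ i j); last by lia.
rewrite addrA -(addrA t1); apply: (kerD h) => //; apply: (kerD h) => //.
rewrite -qbin_additive; last by move=> q; apply: sD.
by apply: QZ; apply: (ker_anti h).
Qed.

End Shuffles.

(** * Additive and bimodule maps on tensor products *)

(** The degree is read off the map where possible: its source, such as
    Omega^1 ⊗ tower X n for tower X n.+1, does not determine it syntactically. *)
Create HintDb bmap discriminated.
#[export] Hint Resolve bimod_map_id : bmap.
#[export] Hint Extern 1 (bimod_map (idt _)) => apply: idt_map : bmap.
#[export] Hint Extern 1 (bimod_map (tmap _ _)) => apply: tmap_map : bmap.
#[export] Hint Extern 1 (bimod_map (braid12 _)) => apply: braid12_map : bmap.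
#[export] Hint Extern 1 (bimod_map tassoc) => exact: tassoc_map : bmap.
#[export] Hint Extern 1 (bimod_map (sigma _)) => exact: sigma_map : bmap.
#[export] Hint Extern 1 (bimod_map (wedge2 _)) => exact: wedge2_map : bmap.
#[export] Hint Extern 1 (bimod_map (@wedge12 _ _ ?O ?X)) => exact (wedge12_map O X) : bmap.
#[export] Hint Extern 1 (bimod_map (@sigma_at _ _ _ ?C ?X ?p ?n)) =>
  exact (sigma_at_map C X p n) : bmap.
#[export] Hint Extern 1 (bimod_map (@wedge_at _ _ ?O ?X ?p ?n)) =>
  exact (wedge_at_map O X p n) : bmap.
#[export] Hint Extern 2 (bimod_map _) => exact: sigma_at_map : bmap.
#[export] Hint Extern 2 (bimod_map _) => exact: wedge_at_map : bmap.
Ltac bmap := solve [auto 10 with bmap].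

Section TensorMaps.
Context {K : fieldType} {A : algType K}.
Implicit Types M N P V Y : bimod A.

Lemma comp_additive (U V W : zmodType) (g : V -> W) (f : U -> V) :
  additive_op g -> additive_op f -> additive_op (fun x => g (f x)).
Proof. by move=> gD fD x y; rewrite fD gD. Qed.

Lemma bmap_additive M N (f : M -> N) : bimod_map f -> additive_op f.
Proof. by move=> fM x y; apply: bmapD. Qed.

Lemma tensorl_additive M N (n : N) : additive_op (fun m : M => m ⊠ n).
Proof. by move=> x y; apply: tensorDl. Qed.

Lemma comp_tensorl_additive (U : zmodType) M N (f : U -> M) (n : N) :
  additive_op f -> additive_op (fun x => f x ⊠ n).
Proof. by move=> fD x y; rewrite fD tensorDl. Qed.

Lemma tensorr_additive M N (m : M) : additive_op (fun n : N => m ⊠ n).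
Proof. by move=> x y; apply: tensorDr. Qed.

Lemma tensor_ext M N (W : zmodType) (f g : (M ⊗ N)%B -> W) :
  additive_op f -> additive_op g ->
  (forall m n, f (m ⊠ n) = g (m ⊠ n)) -> f =1 g.
Proof.
move=> fD gD h t; elim/(@tensor_ind K A M N): t => [|//|s t hs ht].
  by rewrite !additive_op0.
by rewrite fD gD hs ht.
Qed.

Lemma tensor3_ext M N P (W : zmodType) (f g : (M ⊗ N ⊗ P)%B -> W) :
  additive_op f -> additive_op g ->
  (forall m n p, f (m ⊠ n ⊠ p) = g (m ⊠ n ⊠ p)) -> f =1 g.
Proof.
move=> fD gD h; apply: tensor_ext => // m n.
have mD := @tensorr_additive M (N ⊗ P) m.
by apply: (tensor_ext (comp_additive fD mD) (comp_additive gD mD)).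
Qed.

End TensorMaps.

(** Tensoring is tried before comp_additive, which cannot abstract over a variable
    in the left factor of a tensor. *)
Ltac addop := solve [repeat first
  [ exact: tensorl_additive | exact: tensorr_additive
  | apply: bmap_additive; bmap
  | apply: comp_tensorl_additive
  | apply: comp_additive ]].

Section TensorMaps2.
Context {K : fieldType} {A : algType K}.
Implicit Types M N P V Y : bimod A.

Lemma idt_comp M N N' N'' (g : N' -> N'') (f : N -> N') (t : (M ⊗ N)%B) :
  bimod_map g -> bimod_map f -> idt g (idt f t) = idt (fun x => g (f x)) t.
Proof.
move=> gM fM; have cM := bimod_map_comp gM fM; move: t.
apply: tensor_ext => [||m n]; [addop | addop |].
by rewrite !idtE.
Qed.

Lemma braid12E M V (s : (M ⊗ V)%B -> (V ⊗ M)%B) P m v (p : P) : bimod_map s ->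
  braid12 s (m ⊠ v ⊠ p) = tassoc (s (m ⊠ v) ⊠ p).
Proof. by move=> sM; rewrite /braid12 on12E. Qed.

Lemma idt_tassoc M N P P' (f : P -> P') (t : (M ⊗ N)%B) p : bimod_map f ->
  idt (idt f) (tassoc (t ⊠ p)) = tassoc (t ⊠ f p).
Proof.
move=> fM; move: t; apply: tensor_ext => [||m n]; [addop | addop |].
by rewrite !tassocE !idtE; try bmap.
Qed.

Lemma braid12_idt M V (s : (M ⊗ V)%B -> (V ⊗ M)%B) P P' (f : P -> P') t :
  bimod_map s -> bimod_map f ->
  braid12 s (idt (idt f) t) = idt (idt f) (braid12 s t).
Proof.
move=> sM fM; move: t; apply: tensor3_ext => [||m v p]; [addop | addop |].
by rewrite !idtE; try bmap; rewrite !braid12E // idt_tassoc.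
Qed.

End TensorMaps2.

Definition tassoc3 {K : fieldType} {A : algType K} {M N P Y : bimod A}
  (t : ((M ⊗ N ⊗ P) ⊗ Y)%B) : (M ⊗ N ⊗ P ⊗ Y)%B := idt tassoc (tassoc t).

Section Rebracket.
Context {K : fieldType} {A : algType K}.
Implicit Types M N P V Y : bimod A.

Lemma tassoc3_map M N P Y : bimod_map (@tassoc3 K A M N P Y).
Proof. by apply: bimod_map_comp; bmap. Qed.

Lemma tassoc3E M N P Y (m : M) (t : (N ⊗ P)%B) (y : Y) :
  tassoc3 ((m ⊠ t) ⊠ y) = m ⊠ tassoc (t ⊠ y).
Proof. by rewrite /tassoc3 tassocE idtE //; bmap. Qed.

Lemma tassoc3_tassoc M N P Y (t : (M ⊗ N)%B) (p : P) (y : Y) :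
  tassoc3 (tassoc (t ⊠ p) ⊠ y) = tassoc (t ⊠ p ⊠ y).
Proof.
have aM := tassoc3_map M N P Y; move: t.
apply: tensor_ext => [||m n]; [addop | addop |].
by rewrite tassocE tassoc3E !tassocE.
Qed.

Lemma braid12_tassoc3 M V (s : (M ⊗ V)%B -> (V ⊗ M)%B) P Y (t : (M ⊗ V ⊗ P)%B) (y : Y) :
  bimod_map s -> braid12 s (tassoc3 (t ⊠ y)) = tassoc3 (braid12 s t ⊠ y).
Proof.
move=> sM; have aM := tassoc3_map M V P Y; have aM' := tassoc3_map V M P Y.
move: t; apply: tensor3_ext => [||m v p]; [addop | addop |].
by rewrite tassoc3E tassocE !braid12E // tassoc3_tassoc.
Qed.

Lemma idt_braid12_tassoc3 M V (s : (M ⊗ V)%B -> (V ⊗ M)%B) N Y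
    (t : (N ⊗ M ⊗ V)%B) (y : Y) :
  bimod_map s -> idt (braid12 s) (tassoc3 (t ⊠ y)) = tassoc3 (idt s t ⊠ y).
Proof.
move=> sM; have aM := tassoc3_map N M V Y; have aM' := tassoc3_map N V M Y.
move: t; apply: tensor3_ext => [||n m v]; [addop | addop |].
rewrite tassoc3E tassocE !idtE; try bmap.
by rewrite tassoc3E braid12E.
Qed.

End Rebracket.
#[export] Hint Extern 1 (bimod_map tassoc3) => exact: tassoc3_map : bmap.

(** * One-forms *)

Section OneForms.
Context {K : fieldType} {A : algType K} {O : dga A}.
Local Notation Om := (Om O).
Local Notation Om1 := (Om 1).
Implicit Types (E F Y V : bimod A).

Lemma om1_ind (P : Om1 -> Prop) :
  (forall a, P (da O a)) -> (forall x y, P x -> P y -> P (x + y)) ->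
  (forall a x, P x -> P (a <* x)) -> (forall x a, P x -> P (x *> a)) ->
  forall x, P x.
Proof.
move=> Pd PD Pl Pr x.
apply: (@dga_generated K A O (fun n => match n return form_of A (dga_pos O) n -> Prop
  with 1 => P | _ => fun _ => True end) _ _ _ _ 1%N x) => //.
- by case=> [|[|n]] // y z; apply: PD.
- case=> [|[|i]] [|[|j]] //= y z; first by move=> _; apply: Pl.
  move=> Py _; have := Pr y z Py.
  by rewrite /ract /= (gcast_irr _ (erefl 1%N)).
Qed.

Lemma da_mul a b : da O (a * b) = da O a *> b + a <* da O b.
Proof.
rewrite /da -(wedge_deg0 O) (dga_leibniz (d := O) (i := 0) (j := 0)).
rewrite expr0 scale1r (gcast_irr _ (erefl 1%N)); congr (_ + _).
by rewrite /ract /= (gcast_irr _ (erefl 1%N)).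
Qed.

Lemma da1 : da O 1 = 0.
Proof.
apply: (@addrI _ (da O 1)).
by rewrite addr0; have := da_mul 1 1; rewrite mulr1 lact1 ract1 => {3}->.
Qed.

(** The relation a (db) = d(ab) - (da) b makes exact forms span Omega^1 as a right
    module, so right linear maps are determined by their values on them. *)
Lemma om1_ext V (f g : Om1 -> V) : additive_op f -> additive_op g ->
  (forall x a, f (x *> a) = f x *> a) -> (forall x a, g (x *> a) = g x *> a) ->
  (forall a, f (da O a) = g (da O a)) -> f =1 g.
Proof.
move=> fD gD fr gr fg x.
suff : forall a, f (a <* x) = g (a <* x) by move/(_ 1); rewrite lact1.
elim/om1_ind: x => [b a|x y hx hy a|b x hx a|x b hx a].
- apply: (@addrI _ (f (da O a *> b))).
  by rewrite -fD -da_mul [in RHS]fr !fg -gr -gD da_mul.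
- by rewrite lactDr fD gD hx hy.
- by rewrite -lactM.
- by rewrite -lractA fr gr hx.
Qed.

End OneForms.

(** * Tensor products of connections and the coloured braid relation *)

Section Relations.
Context {K : fieldType} {A : algType K} {O : dga A}.
Local Notation Om := (Om O).
Local Notation Om1 := (Om 1).
Implicit Types (E F Y V : bimod A).

Lemma tnabla_additive F (C : bimod_conn O F) E (g : E -> (Om1 ⊗ E)%B) :
  left_conn g -> additive_op (tnabla C g).
Proof. by move=> gL; apply: left_connD (tnabla_leftP C gL). Qed.

(** The right Leibniz rule of a tensor product of bimodule connections, whose
    braiding is the composite of the two braidings. *)
Lemma tnabla_ract F (CF : bimod_conn O F) E (CE : bimod_conn O E) t a :
  tnabla CF (nabla CE) (t *> a) = tnabla CF (nabla CE) t *> a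
    + braid12 (sigma CF) (idt (sigma CE) (tassoc (t ⊠ da O a))).
Proof.
have gL := nabla_left CE; have gD := tnabla_additive CF gL.
have aM := @tassoc_map K A; have bM := @braid12_map K A _ _ _ E (sigma_map CF).
have rD (M : bimod A) : additive_op (fun x : M => x *> a) by move=> x y; apply: ractDl.
move: t; apply: tensor_ext => [||w s].
- exact: (comp_additive gD (rD _)).
- move=> x y; rewrite gD ractDl tensorDl (bmapD (aM _ _ _)).
  rewrite (bmapD (idt_map _ (sigma_map CE))) (bmapD bM); exact: addrACA.
rewrite tensor_ract !tnablaE // tassocE idtE; last exact: sigma_map.
by rewrite nabla_ract tensorDr (bmapD bM) -!tensor_ract (bmapr bM) (bmapr (aM _ _ _)) ractDl addrA.
Qed.

(** Associativity of the tensor product of connections. *)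
Lemma tnabla_tassoc F (CF : bimod_conn O F) E (CE : bimod_conn O E) Y
    (g : Y -> (Om1 ⊗ Y)%B) u v : left_conn g ->
  tnabla CF (tnabla CE g) (tassoc (u ⊠ v)) =
    tassoc3 (tnabla CF (nabla CE) u ⊠ v)
    + braid12 (sigma CF) (idt (braid12 (sigma CE)) (tassoc (u ⊠ g v))).
Proof.
move=> gL; have hL := tnabla_leftP CE gL; have eL := nabla_left CE.
have hD := tnabla_additive CF hL; have eD := tnabla_additive CF eL.
move: u; apply: tensor_ext => [||w s].
- by apply: comp_additive hD _; addop.
- have bD : additive_op (fun t => braid12 (sigma CF) (idt (braid12 (sigma CE)) (tassoc (t ⊠ g v)))).
    by addop.
  move=> x y; rewrite eD tensorDl (bmapD (tassoc3_map _ _ _ _)) bD; exact: addrACA.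
rewrite !tassocE !tnablaE // !tensorDr (bmapD (braid12_map _ (sigma_map CF))).
rewrite tensorDl (bmapD (tassoc3_map _ _ _ _)) tassoc3_tassoc -braid12_tassoc3; last bmap.
by rewrite tassoc3E idtE ?addrA //; bmap.
Qed.

Lemma tnabla_idt F (CF : bimod_conn O F) Y Y' (f : Y -> Y')
    (g : Y -> (Om1 ⊗ Y)%B) (g' : Y' -> (Om1 ⊗ Y')%B) t :
  left_conn g -> left_conn g' -> bimod_map f -> (forall y, g' (f y) = idt f (g y)) ->
  tnabla CF g' (idt f t) = idt (idt f) (tnabla CF g t).
Proof.
move=> gL gL' fM h; move: t; apply: tensor_ext => [||w y].
- by apply: comp_additive; [apply: tnabla_additive | addop].
- by apply: comp_additive; [addop | apply: tnabla_additive].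
rewrite idtE // !tnablaE // h (bmapD (idt_map _ (idt_map _ fM))) idt_tassoc //.
rewrite -braid12_idt //; last bmap.
by rewrite idtE //; bmap.
Qed.

Section Coloured.
Variables (C : bimod_conn O Om1) (E : bimod A) (CE : bimod_conn O E).
Hypothesis CE_leibniz : leibniz_compatible C CE.

Let base (s : E) (x z : Om1) :
  braid12 (sigma C) (idt (sigma CE) (braid12 (sigma CE) (s ⊠ x ⊠ z))) =
  idt (sigma CE) (braid12 (sigma CE) (idt (sigma C) (s ⊠ x ⊠ z))).
Proof.
move: z; apply: om1_ext => [||z a|z a|a]; [addop | addop | | |].
- by rewrite -!tensor_ract !(bmapr (braid12_map _ (sigma_map _))) bmapr ?(bmapr (braid12_map _ (sigma_map _))) //; bmap.
- rewrite -!tensor_ract bmapr; last bmap.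
  by rewrite !(bmapr (braid12_map _ (sigma_map _))) bmapr //; bmap.
have := CE_leibniz ((s ⊠ x) *> a).
rewrite (bmapr (sigma_map CE)) !tnabla_ract CE_leibniz (bmapD (idt_map _ (sigma_map CE))).
rewrite (bmapr (idt_map _ (sigma_map CE))) => /addrI.
by rewrite tassocE braid12E //; apply: sigma_map.
Qed.

(** Replace t by t a in the Leibniz compatibility condition: the difference of
    the two Leibniz rules is the braid relation on s ⊗ x ⊗ da. *)
Lemma coloured_braid Y (t : (E ⊗ Om1 ⊗ Om1 ⊗ Y)%B) :
  braid12 (sigma C) (idt (braid12 (sigma CE)) (braid12 (sigma CE) t)) =
  idt (braid12 (sigma CE)) (braid12 (sigma CE) (idt (braid12 (sigma C)) t)).
Proof.
have sM := sigma_map C; have eM := sigma_map CE.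
move: t; apply: tensor3_ext => [||s x t]; [addop | addop |].
move: t; apply: tensor_ext => [||z y]; [addop | addop |].
have -> : s ⊠ x ⊠ z ⊠ y = tassoc3 ((s ⊠ x ⊠ z) ⊠ y) by rewrite tassoc3E tassocE.
rewrite braid12_tassoc3 // idt_braid12_tassoc3 // braid12_tassoc3 // base.
by rewrite idt_braid12_tassoc3 // braid12_tassoc3 // idt_braid12_tassoc3.
Qed.

(** Leibniz compatibility, with a further factor on the right; the terms in which
    that factor is differentiated are matched by the coloured braid relation. *)
Lemma tnabla_braid Y (g : Y -> (Om1 ⊗ Y)%B) t : left_conn g ->
  tnabla C (tnabla CE g) (braid12 (sigma CE) t) =
  idt (braid12 (sigma CE)) (tnabla CE (tnabla C g) t).
Proof.
move=> gL; have eM := sigma_map CE.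
have hD := tnabla_additive C (tnabla_leftP CE gL).
have kD := tnabla_additive CE (tnabla_leftP C gL).
move: t; apply: tensor3_ext => [||s x y].
- by apply: comp_additive => //; addop.
- by apply: comp_additive => //; addop.
rewrite braid12E // tnabla_tassoc // -tassocE tnabla_tassoc //.
rewrite CE_leibniz (bmapD (idt_map _ (braid12_map _ eM))) idt_braid12_tassoc3 //.
congr (_ + _); rewrite -braid12E // coloured_braid tassocE idtE //; bmap.
Qed.

End Coloured.
End Relations.

(** * The wedge product against braidings and derivatives *)

Section Wedge.
Context {K : fieldType} {A : algType K} {O : dga A}.
Local Notation Om := (Om O).
Local Notation Om1 := (Om 1).
Implicit Types (E F Y V : bimod A).

Lemma wedge12E Y (x z : Om1) (y : Y) :
  @wedge12 K A O Y (x ⊠ z ⊠ y) = wedge1 x z ⊠ y.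
Proof. by rewrite /wedge12 on12E ?wedge2E //; bmap. Qed.

Lemma wedge12_tassoc Y (t : (Om1 ⊗ Om1)%B) (y : Y) :
  @wedge12 K A O Y (tassoc (t ⊠ y)) = wedge2 O t ⊠ y.
Proof.
move: t; apply: tensor_ext => [||x z]; [addop | addop |].
by rewrite tassocE wedge12E wedge2E.
Qed.

Lemma wedge12_tassoc3 V Y (t : (Om1 ⊗ Om1 ⊗ V)%B) (y : Y) :
  wedge12 (tassoc3 (t ⊠ y)) = tassoc (wedge12 t ⊠ y).
Proof.
move: t; apply: tensor3_ext => [||x z v]; [addop | addop |].
by rewrite tassoc3E tassocE !wedge12E tassocE.
Qed.

Lemma idt_wedge12_tassoc3 Y (t : (Om1 ⊗ Om1 ⊗ Om1)%B) (y : Y) :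
  idt (@wedge12 K A O _) (tassoc3 (t ⊠ y)) = tassoc (idt (wedge2 O) t ⊠ y).
Proof.
move: t; apply: tensor3_ext => [||x z v]; [addop | addop |].
rewrite tassoc3E tassocE !idtE; try bmap.
by rewrite tassocE wedge12E wedge2E.
Qed.

Lemma wedge12_idt Y Y' (f : Y -> Y') t : bimod_map f ->
  @wedge12 K A O _ (idt (idt f) t) = idt f (wedge12 t).
Proof.
move=> fM; move: t; apply: tensor3_ext => [||x z y]; [addop | addop |].
by rewrite wedge12E !idtE ?wedge12E //; bmap.
Qed.

(** The induced map on a tensor product is a sum over a representative, so an
    additive map agrees with it without any balancing condition. *)
Lemma additive_tlift (M N : bimod A) (W : zmodType) (f : (M ⊗ N)%B -> W) t :
  additive_op f -> f t = tlift (fun m n => f (m ⊠ n)) t.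
Proof.
move=> fD; rewrite /tlift -(additive_op_sum _ _ _ fD); congr f.
by rewrite -[LHS](reprK (t : tensT M N)) tpiE.
Qed.

Lemma opp_additive (U V : zmodType) (f : U -> V) :
  additive_op f -> additive_op (fun x => - f x).
Proof. by move=> fD x y; rewrite fD opprD. Qed.

Section TorsionFree.
Variable C : bimod_conn O Om1.
Hypothesis C_torsion_free : torsion_free C.

(** Both d(w a) and wedge (nabla (w a)) are expanded by their Leibniz rules; what
    remains is wedge (sigma (w ⊗ da)) = - w wedge da. *)
Lemma wedge2_braid t : wedge2 O (sigma C t) = - wedge2 O t.
Proof.
have nr (M : bimod A) (x : M) a : - (x *> a) = (- x) *> a by rewrite -!scaleN1r ractZl.
have sM := sigma_map C; have wM := wedge2_map O.
move: t; apply: tensor_ext => [||w x]; [addop | apply: opp_additive; addop |].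
move: x; apply: om1_ext => [||x a|x a|a]; [addop | apply: opp_additive; addop | | |].
- by rewrite -tensor_ract !bmapr.
- by rewrite -tensor_ract bmapr // nr.
have := C_torsion_free (w *> a).
rewrite nabla_ract d1_ract bmapD // bmapr // C_torsion_free => /addrI ->.
by rewrite wedge2E.
Qed.

Lemma wedge12_braid Y (t : (Om1 ⊗ Om1 ⊗ Y)%B) :
  wedge12 (braid12 (sigma C) t) = - wedge12 t.
Proof.
move: t; apply: tensor3_ext => [||x z y]; [addop | apply: opp_additive; addop |].
rewrite braid12E; last bmap.
by rewrite wedge12_tassoc wedge2_braid wedge12E wedge2E tensorNl.
Qed.

Lemma wedge12_tnabla E (g : E -> (Om1 ⊗ E)%B) t : left_conn g ->
  wedge12 (tnabla C g t) = dnabla g t.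
Proof.
move=> gL.
have wD := comp_additive (bmap_additive (@wedge12_map K A O E)) (tnabla_additive C gL).
rewrite (additive_tlift t wD); apply: eq_tlift => w s.
rewrite tnablaE // (bmapD (@wedge12_map K A O E)) wedge12_tassoc wedge12_braid.
by rewrite C_torsion_free.
Qed.

Section Flat.
Hypotheses (C_leibniz : leibniz_compatible C C) (C_extendable : extendable C).

(** Extendability with a further factor on the right, in the form in which it
    carries kernels of wedges through the braiding of E. *)
Lemma extend_wedge12 E (CE : bimod_conn O E) : extendable CE ->
  exists2 T : (E ⊗ Om 2)%B -> (Om 2 ⊗ E)%B, bimod_map T &
    forall Y (t : (E ⊗ Om1 ⊗ Om1 ⊗ Y)%B),
      wedge12 (idt (braid12 (sigma CE)) (braid12 (sigma CE) t)) =
      braid12 T (idt (@wedge12 K A O Y) t).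
Proof.
case=> T TM TE; exists T => // Y t; have eM := sigma_map CE.
move: t; apply: tensor3_ext => [||s x t]; [addop | addop |].
move: t; apply: tensor_ext => [||z y]; [addop | addop |].
have -> : s ⊠ x ⊠ z ⊠ y = tassoc3 ((s ⊠ x ⊠ z) ⊠ y) by rewrite tassoc3E tassocE.
rewrite braid12_tassoc3 // idt_braid12_tassoc3 // wedge12_tassoc3 -TE.
by rewrite tassoc3E tassocE idtE ?wedge12E ?braid12E //; bmap.
Qed.

(** Flatness is inherited by tensor powers. In the second derivative of w ⊗ y the
    terms are nabla nabla w ⊗ y, killed by flatness of nabla; two mixed terms,
    which differ by a sigma_1 and hence cancel under the wedge; and
    sigma_2 sigma_1 (w ⊗ nabla nabla y), killed by extendability. *)
Lemma flat_tnabla Y (g : Y -> (Om1 ⊗ Y)%B) : flat_conn C -> left_conn g ->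
  (forall y, wedge12 (tnabla C g (g y)) = 0) ->
  forall t, wedge12 (tnabla C (tnabla C g) (tnabla C g t)) = 0.
Proof.
move=> C_flat gL g_flat t; have sM := sigma_map C; have cL := nabla_left C.
have hL := tnabla_leftP C gL; have hD := tnabla_additive C gL.
have kD := tnabla_additive C hL.
move: t; apply: (tensor_ext (g := fun=> 0)) => [||w y].
- by apply: comp_additive; [addop | apply: comp_additive].
- by move=> ? ?; rewrite addr0.
rewrite tnablaE // kD tnabla_tassoc // tnabla_braid // tnablaE //.
have wM Z := @wedge12_map K A O Z.
rewrite (bmapD (idt_map _ (braid12_map _ sM))) !(bmapD (wM _)).
rewrite wedge12_tassoc3 wedge12_tnabla // C_flat tensor0l (bmap0 (tassoc_map _ _ _)) add0r.
rewrite wedge12_braid addKr.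
have [T TM ->] := extend_wedge12 C_extendable.
rewrite idtE // g_flat tensor0r bmap0 //; exact: braid12_map.
Qed.

End Flat.
End TorsionFree.

Section WedgeCompatible.
Variables (C : bimod_conn O Om1) (C2 : bimod_conn O (Om 2)).
Hypothesis C2_wedge : forall x w : Om1, nabla C2 (wedge1 x w) =
  idt (wedge2 O) (tassoc (nabla C x ⊠ w))
  + idt (wedge2 O) (braid12 (sigma C) (x ⊠ nabla C w)).

Let base (x w z : Om1) :
  idt (wedge2 O) (braid12 (sigma C) (idt (sigma C) (x ⊠ w ⊠ z))) =
  sigma C2 (wedge1 x w ⊠ z).
Proof.
have sM := sigma_map C; have s2M := sigma_map C2; have wM := wedge2_map O.
have bM := @braid12_map K A _ _ _ Om1 sM.
have iM := idt_map Om1 wM.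
move: z; apply: om1_ext => [||z a|z a|a]; [addop | addop | | |].
- by rewrite -!tensor_ract (bmapr (idt_map _ sM)) (bmapr bM) (bmapr iM).
- by rewrite -!tensor_ract bmapr.
have := C2_wedge x (w *> a).
rewrite (bibr (wedge1_bib O)) nabla_ract C2_wedge nabla_ract tensorDr (bmapD bM) (bmapD iM).
rewrite -!tensor_ract (bmapr (tassoc_map _ _ _)) (bmapr bM) !(bmapr iM) ractDl.
by rewrite -!addrA => /addrI /addrI ->; rewrite idtE.
Qed.

(** Comparison of the Leibniz rule of the connection on Omega^2 with the formula
    for nabla (x wedge w a): its braiding is the double braiding of Omega^1. *)
Lemma wedge12_braid2 Y (t : (Om1 ⊗ Om1 ⊗ Om1 ⊗ Y)%B) :
  idt (@wedge12 K A O _) (braid12 (sigma C) (idt (braid12 (sigma C)) t)) =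
  braid12 (sigma C2) (wedge12 t).
Proof.
have sM := sigma_map C; have s2M := sigma_map C2.
move: t; apply: tensor3_ext => [||x w t]; [addop | addop |].
move: t; apply: tensor_ext => [||z y]; [addop | addop |].
have e : x ⊠ w ⊠ z ⊠ y = tassoc3 ((x ⊠ w ⊠ z) ⊠ y) by rewrite tassoc3E tassocE.
rewrite e idt_braid12_tassoc3 // braid12_tassoc3 // idt_wedge12_tassoc3 base.
by rewrite -e wedge12E braid12E.
Qed.

Lemma wedge12_tnabla2 Y (g : Y -> (Om1 ⊗ Y)%B) t : left_conn g ->
  idt (@wedge12 K A O _) (tnabla C (tnabla C g) t) = tnabla C2 g (wedge12 t).
Proof.
move=> gL; have iM := idt_map Om1 (@wedge12_map K A O Y).
have kD := tnabla_additive C (tnabla_leftP C gL); have lD := tnabla_additive C2 gL.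
move: t; apply: tensor3_ext => [||x w y].
- by apply: comp_additive => //; addop.
- by apply: comp_additive => //; addop.
rewrite wedge12E [in RHS]tnablaE // -[x ⊠ w ⊠ y]tassocE tnabla_tassoc // (bmapD iM).
rewrite wedge12_braid2 tassocE wedge12E idt_wedge12_tassoc3; congr (tassoc (_ ⊠ _) + _).
by rewrite C2_wedge tnablaE ?(bmapD (idt_map _ (wedge2_map O))) //; apply: nabla_left.
Qed.

End WedgeCompatible.
End Wedge.

(** * Braidings, wedges and derivatives on towers *)

Section Factors.
Context {K : fieldType} {A : algType K}.
Implicit Types M N P : bimod A.

(** Form in which statements that f x = 0 implies g x = 0 survive tensoring with
    Omega^1 on the left. *)
Definition factors M N P (f : M -> N) (g : M -> P) :=
  exists2 h : N -> P, bimod_map h & forall x, g x = h (f x).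

Lemma factors_idt M N P (f : M -> N) (g : M -> P) V :
  bimod_map f -> factors f g -> factors (@idt K A V _ _ f) (idt g).
Proof.
move=> fM [h hM gE]; exists (idt h); first bmap.
by move=> t; rewrite idt_comp //; congr (idt _ t); apply: funext.
Qed.

Lemma factors_ker M N P (f : M -> N) (g : M -> P) x :
  factors f g -> f x = 0 -> g x = 0.
Proof. by case=> h hM -> ->; apply: bmap0. Qed.

End Factors.

Section Towers.
Context {K : fieldType} {A : algType K} {O : dga A}.
Local Notation Om := (Om O).
Local Notation Om1 := (Om 1).
Local Notation tower := (tower O).
Implicit Types (E F X Y V : bimod A).

Lemma sigma_atS (C : bimod_conn O Om1) X n p t :
  @sigma_at K A O C X p.+1 n.+1 t = idt (@sigma_at K A O C X p n) t.
Proof. by []. Qed.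

Lemma sigma_at0 (C : bimod_conn O Om1) X n t :
  @sigma_at K A O C X 0 n.+2 t = braid12 (sigma C) t.
Proof. by []. Qed.

Lemma wedge_atS X n p t :
  @wedge_at K A O X p.+1 n.+1 t = idt (@wedge_at K A O X p n) t.
Proof. by []. Qed.

Section Sigma.
Variable C : bimod_conn O Om1.
Local Notation sg X n := (fun p => @sigma_at K A O C X p n).

Lemma bbinomE X n k x : @bbinom K A O C X n k x = qbin (sg X n) n k x.
Proof.
elim: n k x => //= n IH k x; case: ifP => // _.
have h k' t : idt (@bbinom K A O C X n k') t = qbin (sg X n.+1 \o S) n k' t.
  have bM := bbinom_map C X n k'; move: t.
  apply: tensor_ext => [||w y]; first by addop.
    apply: qbin_additive => p; apply: bmap_additive; exact: idt_map (sigma_at_map _ _ _ _).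
  rewrite idtE // IH; apply: (qbin_nat (f := fun y => w ⊠ y)); first by addop.
  by move=> p z _; rewrite /= idtE //; bmap.
by rewrite !h.
Qed.

Lemma sigma_at_additive X n p : additive_op (sg X n p).
Proof. by addop. Qed.

Lemma sigma_at_far X n : far_commute n (sg X n).
Proof.
elim: n => [|n IH] [|p] [|[|q]] x // pq qn.
  case: n {IH} x qn => [//|n] x qn.
  by rewrite /= braid12_idt //; bmap.
have h y := IH p q.+1 y pq qn.
change (idt (sg X n p) (idt (sg X n q.+1) x) = idt (sg X n q.+1) (idt (sg X n p) x)).
rewrite !idt_comp; try bmap.
by congr (idt _ x); apply/funext => y; apply: h.
Qed.

Lemma sigma_at_braided X n : leibniz_compatible C C -> braided n (sg X n).
Proof.
move=> CL; elim: n => [|n IH] [|p] x // pn.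
  by case: n {IH} x pn => [|[|n]] // x _; apply: coloured_braid.
have sM q : bimod_map (sg X n q) := sigma_at_map C X q n.
move: x; change (forall x : (Om1 ⊗ tower X n)%B, idt (sg X n p) (idt (sg X n p.+1) (idt (sg X n p) x)) =
  idt (sg X n p.+1) (idt (sg X n p) (idt (sg X n p.+1) x))).
apply: tensor_ext => [||w y].
- by apply: bmap_additive; do 2 apply: (bimod_map_comp (idt_map _ (sM _))); apply: idt_map.
- by apply: bmap_additive; do 2 apply: (bimod_map_comp (idt_map _ (sM _))); apply: idt_map.
by rewrite !(idtE _ _ (sM _)); congr (_ ⊠ _); apply: IH.
Qed.

End Sigma.

Section Wedges.
Variables (C : bimod_conn O Om1).
Local Notation sg X n := (fun p => @sigma_at K A O C X p n).
Hypotheses (C_torsion_free : torsion_free C) (C_wedge : wedge_compatible C)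
  (C_extendable : extendable C).

Lemma wedge_at_anti X n p x : (p.+1 < n)%N ->
  wedge_at p (sg X n p x) = - wedge_at p x.
Proof.
elim: p n x => [|p IH] [|n] x //.
  by case: n x => // n x _; apply: wedge12_braid.
have cM := bimod_map_comp (wedge_at_map O X p n) (sigma_at_map C X p n).
rewrite ltnS => pn; rewrite !wedge_atS sigma_atS idt_comp; try bmap.
move: x; apply: tensor_ext => [||w y].
- by apply: bmap_additive; apply: idt_map.
- by apply: opp_additive; addop.
by rewrite (idtE _ _ cM) idtE ?IH ?tensorNr //; bmap.
Qed.

Lemma wedge_at_up X n p : (p.+2 < n)%N ->
  factors (@wedge_at K A O X p n) (fun x => wedge_at p.+1 (sg X n p (sg X n p.+1 x))).
Proof.
have [C2 C2E] := C_wedge.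
elim: p n => [|p IH] [|n] //.
  case: n => [|[|n]] // _.
  exists (braid12 (sigma C2)); first bmap.
  by move=> x; apply: wedge12_braid2.
rewrite ltnS => pn; have [h hM hE] := factors_idt Om1 (wedge_at_map O X p n) (IH n pn).
exists h => // x; rewrite -hE wedge_atS !sigma_atS idt_comp; try bmap.
by rewrite idt_comp //; [apply: bimod_map_comp|]; bmap.
Qed.

Lemma wedge_at_down X n p : (p.+2 < n)%N ->
  factors (@wedge_at K A O X p.+1 n) (fun x => wedge_at p (sg X n p.+1 (sg X n p x))).
Proof.
elim: p n => [|p IH] [|n] //.
  case: n => [|[|n]] // _.
  have [T TM TE] := extend_wedge12 C_extendable.
  by exists (braid12 T); [bmap | move=> x; apply: TE].
rewrite ltnS => pn; have [h hM hE] := factors_idt Om1 (wedge_at_map O X p.+1 n) (IH n pn).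
exists h => // x; rewrite -hE wedge_atS !sigma_atS idt_comp; try bmap.
by rewrite idt_comp //; [apply: bimod_map_comp|]; bmap.
Qed.

Lemma wedge_at_far X n p q : (p.+1 < n)%N -> (q.+1 < n)%N ->
  (p.+1 < q)%N || (q.+1 < p)%N ->
  factors (@wedge_at K A O X q n) (fun x => wedge_at q (sg X n p x)).
Proof.
elim: n p q => // n IH [|p] [|q] //.
- case: n {IH} => [|n] // _; case: q => // q qn _.
  exists (braid12 (sigma C)); first bmap.
  by move=> x; rewrite /= braid12_idt //; bmap.
- case: n {IH} => [|n] //; case: p => // p pn _ _.
  exists (idt (sg X n p)); first bmap.
  by move=> x; rewrite /= wedge12_idt //; bmap.
rewrite !ltnS => pn qn pq.
have [h hM hE] := factors_idt Om1 (wedge_at_map O X q n) (IH p q pn qn pq).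
exists h => // x; rewrite -hE wedge_atS sigma_atS idt_comp //; bmap.
Qed.

(** The relations hold on the first factors by the assumptions on the connection,
    and propagate to the right by tensoring with Omega^1 on the left. *)
Lemma wedge_kernels X n :
  sym_kernels n (sg X n) (fun p x => @wedge_at K A O X p n x = 0).
Proof.
have wM p := wedge_at_map O X p n; split.
- by move=> p; apply: bmap0.
- by move=> p x y hx hy; rewrite (bmapD (wM p)) hx hy addr0.
- by move=> p x pn; rewrite (bmapD (wM p)) wedge_at_anti // addNr.
- by move=> p x pn; apply: factors_ker (wedge_at_up X pn).
- by move=> p x pn; apply: factors_ker (wedge_at_down X pn).
- by move=> p q x pn qn pq; apply: factors_ker (wedge_at_far X pn qn pq).
Qed.

End Wedges.

Section Derivatives.
Variables (C : bimod_conn O Om1) (E : bimod A) (CE : bimod_conn O E).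
Local Notation sg X n := (fun p => @sigma_at K A O C X p n).
Local Notation D n := (@nablaT K A O C E CE n).
Hypotheses (C_torsion_free : torsion_free C) (C_wedge : wedge_compatible C)
  (C_extendable : extendable C) (C_leibniz : leibniz_compatible C C).

Lemma nablaT_additive n : additive_op (D n).
Proof. exact: left_connD (nablaT_left C CE n). Qed.

Lemma nablaT_tensor n (w : Om1) (x : tower E n) :
  @nablaT K A O C E CE n.+1 (w ⊠ x) =
  tassoc (nabla C w ⊠ x) + braid12 (sigma C) (w ⊠ D n x).
Proof. exact: tnablaE (nablaT_left C CE n) w x. Qed.

Lemma nablaT_sigma n p x : (p.+1 < n)%N -> D n (sg E n p x) = sg E n.+1 p.+1 (D n x).
Proof.
elim: n p x => // n IH [|p] x pn.
  case: n {IH} x pn => // n x _.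
  by apply: tnabla_braid => //; apply: nablaT_left.
have gL := nablaT_left C CE n; apply: tnabla_idt => //; first bmap.
by move=> y; apply: IH.
Qed.

(** The map G is the connection induced on (Omega^1)^p ⊗ Omega^2 ⊗ ...; only that
    it vanishes on 0 is used afterwards. *)
Lemma nablaT_wedge n p : (p.+1 < n)%N -> exists2 G, left_conn G &
  forall x, idt (@wedge_at K A O E p n) (D n x) = G (wedge_at p x).
Proof.
have [C2 C2E] := C_wedge.
elim: n p => // n IH [|p] pn.
  case: n {IH} pn => // n _; have gL := nablaT_left C CE n.
  exists (tnabla C2 (D n)); first exact: tnabla_leftP.
  by move=> x; apply: wedge12_tnabla2.
have [G GL GE] := IH p pn; exists (tnabla C G); first exact: tnabla_leftP.
move=> x; symmetry; apply: tnabla_idt => //; [exact: nablaT_left | bmap].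
Qed.

Lemma nablaT_flat n x : flat_conn C -> flat_conn CE ->
  @wedge_at K A O E 0 n.+2 (D n.+1 (D n x)) = 0.
Proof.
move=> CF EF; elim: n x => [|n IH] x.
  by rewrite /= wedge12_tnabla //; apply: nabla_left.
by apply: flat_tnabla => //; apply: nablaT_left.
Qed.

(** Flatness handles the wedge of the two newest factors, and [nablaT_wedge] shows
    that the other wedges keep vanishing under differentiation. *)
Lemma nabla_iter_sym n p s : flat_conn C -> flat_conn CE -> (p.+1 < n)%N ->
  @wedge_at K A O E p n (nabla_iter C CE n s) = 0.
Proof.
move=> CF EF; elim: n p => // -[|n] IH [|p] pn //.
  exact: nablaT_flat.
have [G GL GE] := nablaT_wedge (n := n.+1) pn.
rewrite [LHS]GE IH //; exact: (additive_op0 (left_connD GL)).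
Qed.

End Derivatives.
End Towers.

(** * Graded actions and their products *)

Section Place.
Context {K : fieldType} {A : algType K} {O : dga A}.
Local Notation tower := (tower O).
Implicit Types (X : bimod A) (m n p : nat).

(** A total transport between degrees that are only propositionally equal; the
    value 0 elsewhere lets sums over i + j = n be written as sums over all i, j. *)
Definition place X m n (x : tower X m) : tower X n :=
  if m =P n is ReflectT e then ecast i (tower X i) e x else 0.

Lemma place_id X n (x : tower X n) : place n x = x.
Proof. by rewrite /place; case: eqP => // e; rewrite eq_axiomK. Qed.

Lemma place_neq X m n (x : tower X m) : m <> n -> place n x = 0.
Proof. by rewrite /place; case: eqP. Qed.

Lemma place_map X m n : bimod_map (@place X m n).
Proof.
have [<-|/eqP mn] := eqVneq m n.
  by apply: (bimod_map_ext (g := id)) => // x; apply: place_id.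
by apply: (bimod_map_ext (g := fun=> 0)) => [x|]; [apply: place_neq | apply: bimod_map0].
Qed.

Lemma place_place X m n p (x : tower X m) : m = n -> place p (place n x) = place p x.
Proof. by move=> <-; rewrite place_id. Qed.

Lemma placeS X m n (w : Om O 1) (x : tower X m) :
  @place X m.+1 n.+1 (w ⊠ x) = w ⊠ place n x.
Proof.
have [<-|/eqP mn] := eqVneq m n; first by rewrite !place_id.
by rewrite !place_neq ?tensor0r //; case.
Qed.

End Place.

Section GradedActions.
Context {K : fieldType} {A : algType K} {O : dga A} (C : bimod_conn O (Om O 1)).
Local Notation Om1 := (Om O 1).
Local Notation tower := (tower O).
Local Notation sg X n := (fun p => @sigma_at K A O C X p n).
Local Notation wd X n p := (@wedge_at K A O X p n).
Implicit Types X Y Z : bimod A.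

(** The part of a concatenation that has degree 0 on the left. It is the left action
    of A on tensors, or the passage of E to the right past forms; compatibility
    with braidings and wedges is what makes its products associative and
    symmetric. *)
Record gaction X Y Z := GAction {
  gact : forall j, (X ⊗ tower Y j)%B -> tower Z j;
  gact_map : forall j, bimod_map (@gact j);
  gact_sigma : forall j p t, (p.+1 < j)%N ->
    gact (idt (sg Y j p) t) = sg Z j p (gact t);
  gact_wedge : forall j p, (p.+1 < j)%N ->
    factors (idt (wd Y j p)) (fun t => wd Z j p (gact t)) }.

Section Join.
Context {X Y Z : bimod A} (mu : gaction X Y Z).

(** Concatenation of (Omega^1)^i ⊗ X with (Omega^1)^j ⊗ Y, where X is absorbed or
    carried to the right end by mu. *)
Fixpoint join i j : (tower X i ⊗ tower Y j)%B -> tower Z (i + j) :=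
  match i return (tower X i ⊗ tower Y j)%B -> tower Z (i + j) with
  | 0 => @gact _ _ _ mu j
  | i'.+1 => fun t => idt (@join i' j) (tassoc t)
  end.

Lemma join_map i j : bimod_map (@join i j).
Proof.
elim: i => [|i IH] /=; first exact: gact_map.
exact: (bimod_map_comp (idt_map _ IH) (tassoc_map _ _ _)).
Qed.

Lemma joinS i j w (u : tower X i) (v : tower Y j) :
  @join i.+1 j ((w ⊠ u) ⊠ v) = w ⊠ join (u ⊠ v).
Proof. by rewrite /= tassocE idtE //; apply: join_map. Qed.

Let jM := join_map.
#[local] Hint Extern 1 (bimod_map (@join ?i ?j)) => exact (jM i j) : bmap.

Lemma join_tassoc i j (q : (Om1 ⊗ Om1)%B) (u : tower X i) (v : tower Y j) :
  @join i.+2 j (tassoc (q ⊠ u) ⊠ v) = tassoc (q ⊠ join (u ⊠ v)).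
Proof.
move: q; apply: tensor_ext => [||x y]; [addop | addop |].
by rewrite !tassocE !joinS.
Qed.

Lemma join_sigma_l i j p u v : (p.+1 < i)%N ->
  @join i j (sg X i p u ⊠ v) = sg Z (i + j) p (join (u ⊠ v)).
Proof.
elim: i p u => // i IH [|p] u pi.
  case: i {IH} u pi => // i u _; move: u; apply: tensor3_ext => [||x y u].
  - by addop.
  - apply: (comp_additive (g := sg Z (i.+2 + j) 0)); addop.
  lazy beta; rewrite !sigma_at0 braid12E; last bmap.
  by rewrite join_tassoc !joinS braid12E //; bmap.
move: u; apply: tensor_ext => [||w u].
- by apply: (comp_additive (g := fun z => @join i.+1 j (z ⊠ v))); addop.
- by apply: (comp_additive (g := sg Z (i.+1 + j) p.+1)); addop.
rewrite sigma_atS idtE ?joinS; last bmap.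
by rewrite IH // -[LHS](idtE _ _ (sigma_at_map C Z p (i + j))).
Qed.

Lemma join_sigma_r i j p u v : (p.+1 < j)%N ->
  @join i j (u ⊠ sg Y j p v) = sg Z (i + j) (i + p) (join (u ⊠ v)).
Proof.
move=> pj; elim: i u => [|i IH] u.
  by rewrite /= -gact_sigma // idtE //; bmap.
move: u; apply: tensor_ext => [||w u].
- by addop.
- by apply: (comp_additive (g := sg Z (i.+1 + j) (i.+1 + p))); addop.
rewrite !joinS IH -[LHS](idtE _ _ (sigma_at_map C Z (i + p) (i + j))) //.
Qed.

Lemma join_wedge_l i j p : (p.+1 < i)%N ->
  exists2 h : (wedge_cod O X p i ⊗ tower Y j)%B -> wedge_cod O Z p (i + j), bimod_map h &
    forall u v, wd Z (i + j) p (join (u ⊠ v)) = h (wd X i p u ⊠ v).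
Proof.
elim: i p => // i IH [|p] pi.
  case: i {IH} pi => // i _; exists (fun t => idt (@join i j) (tassoc t)).
    by apply: bimod_map_comp; bmap.
  move=> u v; move: u; apply: tensor3_ext => [||x y u].
  - by apply: (comp_additive (g := wd Z (i.+2 + j) 0)); addop.
  - by addop.
  by rewrite !joinS /= !wedge12E tassocE idtE //; bmap.
have [h hM hE] := IH p pi; exists (fun t => idt h (tassoc t)).
  by apply: bimod_map_comp; bmap.
move=> u v; move: u; apply: tensor_ext => [||w u].
- by apply: (comp_additive (g := wd Z (i.+1 + j) p.+1)); addop.
- by addop.
rewrite joinS wedge_atS idtE ?tassocE; last bmap.
by rewrite idtE // -hE -[RHS](idtE _ _ (wedge_at_map O Z p (i + j))).
Qed.

Lemma join_wedge_r i j p u v : (p.+1 < j)%N -> wd Y j p v = 0 ->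
  wd Z (i + j) (i + p) (@join i j (u ⊠ v)) = 0.
Proof.
move=> pj vZ; have wM := wedge_at_map O Z; elim: i u => [|i IH] u.
  have [h hM ->] := gact_wedge mu pj.
  by rewrite idtE ?vZ ?tensor0r ?bmap0 //; bmap.
elim/(@tensor_ind K A Om1 (tower X i)): u => [|w u|s t hs ht].
- by rewrite tensor0l (bmap0 (jM _ _)) (bmap0 (wM _ _)).
- by rewrite joinS -[RHS](tensor0r _ w) -(IH u) -[RHS](idtE _ _ (wM (i + p)%N _)).
by rewrite tensorDl (bmapD (jM _ _)) (bmapD (wM _ _)) hs ht addr0.
Qed.

Definition gmul i j (u : tower X i) (v : tower Y j) : tower Z (i + j) :=
  qbin (sg Z (i + j)) (i + j) j (join (u ⊠ v)).

Lemma gmul_additivel i j (v : tower Y j) : additive_op (fun u : tower X i => gmul u v).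
Proof.
apply: (comp_additive (g := qbin (sg Z (i + j)) (i + j) j)); last by addop.
by apply: qbin_additive => p; addop.
Qed.

Lemma gmul_additiver i j (u : tower X i) : additive_op (fun v : tower Y j => gmul u v).
Proof.
apply: (comp_additive (g := qbin (sg Z (i + j)) (i + j) j)); last by addop.
by apply: qbin_additive => p; addop.
Qed.

Lemma gmul_sym i j (u : tower X i) (v : tower Y j) :
  torsion_free C -> wedge_compatible C -> extendable C ->
  (forall p, (p.+1 < i)%N -> wd X i p u = 0) ->
  (forall p, (p.+1 < j)%N -> wd Y j p v = 0) ->
  forall p, (p.+1 < i + j)%N -> wd Z (i + j) p (gmul u v) = 0.
Proof.
move=> CT CW CX uZ vZ; apply: (qbin_sym (Z := fun p x => wd Z (i + j) p x = 0) (i := i)) => //.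
- exact: sigma_at_additive.
- exact: sigma_at_far.
- exact: wedge_kernels.
move=> p pn pi; have [pi'|pi'] := ltnP p.+1 i.
  by have [h hM ->] := join_wedge_l j pi'; rewrite uZ // tensor0l bmap0.
have -> : p = (i + (p - i))%N by lia.
have pj : ((p - i).+1 < j)%N by lia.
by apply: join_wedge_r => //; apply: vZ.
Qed.

End Join.

Section Assoc.
Context {X Y Z U V W : bimod A}.
Variables (mu : gaction X Y Z) (mu' : gaction Z W V)
  (nu : gaction Y W U) (nu' : gaction X U V).
Hypothesis base : forall j k x (y : tower Y j) (w : tower W k),
  join mu' (gact mu (x ⊠ y) ⊠ w) = gact nu' (x ⊠ join nu (y ⊠ w)).

Lemma join_assoc i j k (u : tower X i) (v : tower Y j) (w : tower W k) :
  join mu' (join mu (u ⊠ v) ⊠ w) = place _ (join nu' (u ⊠ join nu (v ⊠ w))).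
Proof.
have jM X' Y' Z' (m : gaction X' Y' Z') := join_map m.
elim: i u => [|i IH] u; first by rewrite [place _ _]place_id; apply: base.
have pM m n := place_map (O := O) V m n.
move: u; apply: tensor_ext => [||x u].
- apply: comp_additive; first exact/bmap_additive/jM.
  apply: comp_tensorl_additive; apply: comp_additive; first exact/bmap_additive/jM.
  exact: tensorl_additive.
- apply: comp_additive; first exact/bmap_additive/pM.
  apply: comp_additive; first exact/bmap_additive/jM.
  exact: tensorl_additive.
by rewrite !joinS IH [RHS]placeS.
Qed.

Lemma place_qbin X' m n (f : nat -> nat) a k (x : tower X' m) :
  place n (qbin (sg X' m \o f) a k x) = qbin (sg X' n \o f) a k (place n x).
Proof.
have [<-|/eqP mn] := eqVneq m n; first by rewrite !place_id.
rewrite !place_neq // additive_op0 //; apply: qbin_additive => p; exact: sigma_at_additive.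
Qed.

(** Associativity in degree (0, j, k) is the only thing that depends on the
    actions; the rest is concatenation and [qbin_assoc]. *)
Lemma gmul_assoc i j k (u : tower X i) (v : tower Y j) (w : tower W k) :
  leibniz_compatible C C ->
  gmul mu' (gmul mu u v) w = place _ (gmul nu' u (gmul nu v w)).
Proof.
move=> CL; rewrite /gmul.
have -> : join mu' (qbin (sg Z (i + j)) (i + j) j (join mu (u ⊠ v)) ⊠ w) =
    qbin (sg V (i + j + k)) (i + j) j (join mu' (join mu (u ⊠ v) ⊠ w)).
  apply: (qbin_nat (f := fun z => join mu' (z ⊠ w))) => [|p y pij].
    apply: comp_additive; [exact/bmap_additive/join_map | exact: tensorl_additive].
  exact: join_sigma_l.
rewrite (qbin_assoc (i := i)).
- have -> : join nu' (u ⊠ qbin (sg U (j + k)) (j + k) k (join nu (v ⊠ w))) =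
      qbin (sg V (i + (j + k)) \o addn i) (j + k) k (join nu' (u ⊠ join nu (v ⊠ w))).
    apply: (qbin_nat (f := fun z => join nu' (u ⊠ z))) => [|p y pij].
      apply: comp_additive; [exact/bmap_additive/join_map | exact: tensorr_additive].
    exact: join_sigma_r.
  rewrite (place_qbin _ id) place_qbin join_assoc.
  by congr (qbin _ _ _ _); rewrite addnA.
- exact: sigma_at_additive.
- exact: sigma_at_far.
- exact: sigma_at_braided.
Qed.

End Assoc.
End GradedActions.

(** * Convolution of sequences of tensors *)

Section Sums.
Variable V : zmodType.

Lemma sum_widen (F : nat -> V) m n : (m <= n)%N ->
  (forall i, (m <= i)%N -> F i = 0) -> \sum_(i < n) F i = \sum_(i < m) F i.
Proof.
move=> mn F0; rewrite -!(big_mkord xpredT F) (big_cat_nat (n := m)) //=.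
rewrite [X in _ + X]big1_seq ?addr0 // => i.
by rewrite mem_index_iota => /and3P [_ mi _]; apply: F0.
Qed.

(** Reindexing for a Pascal recursion. *)
Lemma sum2_shift (f g1 g2 : nat -> nat -> V) n :
  (forall i j, f i j = (if i is i'.+1 then g1 i' j else 0)
                     + (if j is j'.+1 then g2 i j' else 0)) ->
  \sum_(i < n.+1) \sum_(j < n.+1) f i j =
  \sum_(i < n) \sum_(j < n.+1) g1 i j + \sum_(i < n.+1) \sum_(j < n) g2 i j.
Proof.
move=> fE; under eq_bigr => i _ do
  (under eq_bigr => j _ do rewrite fE; rewrite big_split /=).
rewrite big_split /=; congr (_ + _).
  by rewrite big_ord_recl /= big1 ?add0r.
by apply: eq_bigr => i _; rewrite big_ord_recl /= add0r.
Qed.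

End Sums.

Section Convolution.
Context {K : fieldType} {A : algType K} {O : dga A} {C : bimod_conn O (Om O 1)}.
Local Notation Om1 := (Om O 1).
Local Notation tower := (tower O).
Local Notation sg X n := (fun p => @sigma_at K A O C X p n).
Local Notation wd X n p := (@wedge_at K A O X p n).
Implicit Types X Y Z : bimod A.

Lemma place_additive X m n : additive_op (@place K A O X m n).
Proof. exact/bmap_additive/place_map. Qed.

Lemma place0 X m n : @place K A O X m n 0 = 0.
Proof. exact: bmap0 (place_map _ _ _). Qed.

Section Def.
Context {X Y Z : bimod A} (mu : gaction C X Y Z).

(** The summand is zero unless i + j = n, by the convention of [place]. *)
Definition conv (u : forall i, tower X i) (v : forall j, tower Y j) n : tower Z n :=
  \sum_(i < n.+1) \sum_(j < n.+1) place n (gmul mu (u i) (v j)).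

Lemma convE N u v n : (n < N)%N ->
  conv u v n = \sum_(i < N) \sum_(j < N) place n (gmul mu (u i) (v j)).
Proof.
move=> nN; have far i j : (n < i + j)%N -> place n (gmul mu (u i) (v j)) = 0.
  by move=> h; apply: place_neq; lia.
rewrite [RHS](sum_widen (m := n.+1) (F := fun i =>
    \sum_(j < N) place n (gmul mu (u i) (v j)))) => [|//|i ni]; last first.
  by apply: big1 => j _; apply: far; lia.
apply: eq_bigr => i _; symmetry.
apply: (sum_widen (F := fun j => place n (gmul mu (u i) (v j)))) => // j nj.
by apply: far; lia.
Qed.

Lemma gmul0l i j (v : tower Y j) : gmul mu (0 : tower X i) v = 0.
Proof. exact: additive_op0 (gmul_additivel mu _). Qed.

Lemma gmul0r i j (u : tower X i) : gmul mu u (0 : tower Y j) = 0.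
Proof. exact: additive_op0 (gmul_additiver mu _). Qed.

(** A sum over a degree in which a single term lives; this collapses the inner
    convolution in [conv_assoc]. *)
Lemma sum_gmull m n j (u : tower X m) (v : tower Y j) :
  \sum_(p < n.+1) place n (gmul mu (place p u) v) = place n (gmul mu u v).
Proof.
have [mn|mn] := ltnP m n.+1.
  rewrite (bigD1 (Ordinal mn)) //= place_id big1 ?addr0 // => p pm.
  rewrite [place p u]place_neq ?gmul0l ?place0 // => e.
  by case/eqP: pm; exact/val_inj/esym.
rewrite [RHS]place_neq; last by lia.
apply: big1 => p _; rewrite [place p u]place_neq ?gmul0l ?place0 //.
by have := ltn_ord p; lia.
Qed.

Lemma sum_gmulr m n i (u : tower X i) (v : tower Y m) :
  \sum_(p < n.+1) place n (gmul mu u (place p v)) = place n (gmul mu u v).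
Proof.
have [mn|mn] := ltnP m n.+1.
  rewrite (bigD1 (Ordinal mn)) //= place_id big1 ?addr0 // => p pm.
  rewrite [place p v]place_neq ?gmul0r ?place0 // => e.
  by case/eqP: pm; exact/val_inj/esym.
rewrite [RHS]place_neq; last by lia.
apply: big1 => p _; rewrite [place p v]place_neq ?gmul0r ?place0 //.
by have := ltn_ord p; lia.
Qed.

Lemma eq_conv u u' v v' n : (forall i, (i <= n)%N -> u i = u' i) ->
  (forall j, (j <= n)%N -> v j = v' j) -> conv u v n = conv u' v' n.
Proof.
move=> uu vv; apply: eq_bigr => i _; apply: eq_bigr => j _.
by rewrite uu ?vv // -ltnS.
Qed.

Lemma convDl u u' v n : conv (fun i => u i + u' i) v n = conv u v n + conv u' v n.
Proof.
rewrite /conv -big_split; apply: eq_bigr => i _ /=; rewrite -big_split.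
by apply: eq_bigr => j _ /=; rewrite gmul_additivel place_additive.
Qed.

Lemma convDr u v v' n : conv u (fun j => v j + v' j) n = conv u v n + conv u v' n.
Proof.
rewrite /conv -big_split; apply: eq_bigr => i _ /=; rewrite -big_split.
by apply: eq_bigr => j _ /=; rewrite gmul_additiver place_additive.
Qed.

Lemma gmulZl c i j (u : tower X i) (v : tower Y j) : gmul mu (c *: u) v = c *: gmul mu u v.
Proof.
rewrite /gmul tensorZl (bmapZ (join_map _ _ _)).
by rewrite -!(bbinomE C) (bmapZ (bbinom_map C Z _ _)).
Qed.

Lemma gmulZr c i j (u : tower X i) (v : tower Y j) : gmul mu u (c *: v) = c *: gmul mu u v.
Proof.
rewrite /gmul tensorZr (bmapZ (join_map _ _ _)).
by rewrite -!(bbinomE C) (bmapZ (bbinom_map C Z _ _)).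
Qed.

Lemma convZl c u v n : conv (fun i => c *: u i) v n = c *: conv u v n.
Proof.
rewrite /conv scaler_sumr; apply: eq_bigr => i _; rewrite scaler_sumr.
by apply: eq_bigr => j _; rewrite gmulZl (bmapZ (place_map _ _ _)).
Qed.

Lemma convZr c u v n : conv u (fun j => c *: v j) n = c *: conv u v n.
Proof.
rewrite /conv scaler_sumr; apply: eq_bigr => i _; rewrite scaler_sumr.
by apply: eq_bigr => j _; rewrite gmulZr (bmapZ (place_map _ _ _)).
Qed.

Lemma conv_homogl u v n i : (forall i', i' <> i -> u i' = 0) -> (i <= n)%N ->
  conv u v n = \sum_(j < n.+1) place n (gmul mu (u i) (v j)).
Proof.
move=> u0 iN; rewrite /conv (bigD1 (Ordinal (iN : (i < n.+1)%N))) //=.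
rewrite [X in _ + X]big1 ?addr0 // => i' ii'; apply: big1 => j _.
rewrite u0 ?gmul0l ?place0 // => e; by case/eqP: ii'; apply: val_inj.
Qed.

Lemma conv_homogr u v n j : (forall j', j' <> j -> v j' = 0) -> (j <= n)%N ->
  conv u v n = \sum_(i < n.+1) place n (gmul mu (u i) (v j)).
Proof.
move=> v0 jN; apply: eq_bigr => i _; rewrite (bigD1 (Ordinal (jN : (j < n.+1)%N))) //=.
rewrite big1 ?addr0 // => j' jj'.
rewrite v0 ?gmul0r ?place0 // => e; by case/eqP: jj'; apply: val_inj.
Qed.

Lemma sum_place_id m n (F : nat -> nat) (x : forall i, tower Z (F i)) :
  injective F -> F m = n -> (m < n.+1)%N ->
  \sum_(i < n.+1) place n (x i) = place n (x m).
Proof.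
move=> FI e mn; rewrite (bigD1 (Ordinal mn)) //= big1 ?addr0 // => i im.
apply: place_neq => e'; move/eqP: im; apply; apply: val_inj; apply: FI.
by rewrite e'.
Qed.

Lemma conv_sym u v n :
  torsion_free C -> wedge_compatible C -> extendable C ->
  (forall i p, (p.+1 < i)%N -> wd X i p (u i) = 0) ->
  (forall j p, (p.+1 < j)%N -> wd Y j p (v j) = 0) ->
  forall p, (p.+1 < n)%N -> wd Z n p (conv u v n) = 0.
Proof.
move=> CT CW CX u0 v0 p pn; have wD := bmap_additive (wedge_at_map O Z p n).
rewrite (additive_op_sum _ _ _ wD) big1 // => i _.
rewrite (additive_op_sum _ _ _ wD) big1 // => j _.
have := gmul_sym mu CT CW CX (u0 i) (v0 j); move: (gmul _ _ _); move: (i + j)%N => m y y0.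
have [e|/eqP e] := eqVneq m n; last by rewrite place_neq // (additive_op0 wD).
by move: y y0; rewrite e => y y0; rewrite place_id y0.
Qed.

End Def.

Section Assoc.
Context {X Y Z U V W : bimod A}.
Variables (mu : gaction C X Y Z) (mu' : gaction C Z W V)
  (nu : gaction C Y W U) (nu' : gaction C X U V).
Hypothesis base : forall j k x (y : tower Y j) (w : tower W k),
  join mu' (gact mu (x ⊠ y) ⊠ w) = gact nu' (x ⊠ join nu (y ⊠ w)).

(** Both sides are the sum of all triple products with i + j + k = n. *)
Lemma conv_assoc u v w n : leibniz_compatible C C ->
  conv mu' (conv mu u v) w n = conv nu' u (conv nu v w) n.
Proof.
move=> CL; pose T i j k := place n (gmul mu' (gmul mu (u i) (v j)) (w k)).
transitivity (\sum_(i < n.+1) \sum_(j < n.+1) \sum_(k < n.+1) T i j k).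
  rewrite /conv exchange_big /=.
  have e (k : 'I_n.+1) : \sum_(p < n.+1) place n (gmul mu' (conv mu u v p) (w k)) =
      \sum_(i < n.+1) \sum_(j < n.+1) T i j k.
    transitivity (\sum_(p < n.+1) \sum_(i < n.+1) \sum_(j < n.+1)
        place n (gmul mu' (place p (gmul mu (u i) (v j))) (w k))).
      apply: eq_bigr => p _; rewrite (convE mu (N := n.+1)) //.
      have fD := comp_additive (@place_additive V _ n) (@gmul_additivel _ _ _ C _ _ _ mu' p _ (w k)).
      rewrite (additive_op_sum _ _ _ fD); apply: eq_bigr => i _.
      by rewrite (additive_op_sum _ _ _ fD).
    rewrite exchange_big /=; apply: eq_bigr => i _.
    rewrite exchange_big /=; apply: eq_bigr => j _.
    exact: sum_gmull.
  under eq_bigr => k _ do rewrite e.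
  rewrite exchange_big /=; apply: eq_bigr => i _; exact: exchange_big.
apply: eq_bigr => i _.
transitivity (\sum_(q < n.+1) \sum_(j < n.+1) \sum_(k < n.+1)
    place n (gmul nu' (u i) (place q (gmul nu (v j) (w k))))).
  rewrite [RHS]exchange_big /=; apply: eq_bigr => j _.
  rewrite [RHS]exchange_big /=; apply: eq_bigr => k _.
  rewrite sum_gmulr /T (gmul_assoc base) // place_place //; exact: addnA.
apply: eq_bigr => q _; rewrite (convE nu (N := n.+1)) //.
have fD := comp_additive (@place_additive V _ n) (@gmul_additiver _ _ _ C _ _ _ nu' i q (u i)).
rewrite (additive_op_sum _ _ _ fD); apply: eq_bigr => j _.
by rewrite (additive_op_sum _ _ _ fD).
Qed.

End Assoc.

Section Leibniz.
Context {E : bimod A} (CE : bimod_conn O E).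
Local Notation D n := (@nablaT K A O C E CE n).
Hypothesis C_leibniz : leibniz_compatible C C.

Variable z : forall i j, tower E (i + j).
Hypothesis zP : forall i j, D (i + j) (z i j) =
  z i.+1 j + cyc (sg E (i + j).+1) i (place (i + j).+1 (z i j.+1)).

Let S n : tower E n :=
  \sum_(i < n.+1) \sum_(j < n.+1) place n (qbin (sg E (i + j)) (i + j) j (z i j)).

Lemma nablaT_place m n (x : tower E m) : D n (place n x) = place n.+1 (D m x).
Proof.
have [<-|/eqP mn] := eqVneq m n; first by rewrite !place_id.
rewrite [place n x]place_neq // [RHS]place_neq; last by case.
exact: additive_op0 (nablaT_additive C CE (n := n)).
Qed.

(** Here z i j stands for the concatenation of nabla^i a and nabla^j s, or of
    nabla^i s and nabla^j a, and zP is the Leibniz rule for concatenation. After commuting D past the shuffles, the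
    two groups of terms g1, g2 are the two halves of the recursion of the
    binomials in degree n + 1. *)
Lemma nablaT_shuffles n : D n (S n) = S n.+1.
Proof.
pose g1 i j := place n.+1 (qbin (sg E (i + j).+1 \o succn) (i + j) j (z i.+1 j)).
pose g2 i j := place n.+1
  (qbin (sg E (i + j.+1) \o succn) (i + j) j (cyc (sg E (i + j.+1)) i (z i j.+1))).
have cD X m r : additive_op (cyc (sg X m) r) by apply: cyc_additive => p; exact: sigma_at_additive.
have qD X m a b : additive_op (qbin (sg X m \o succn) a b).
  by apply: qbin_additive => p; exact: sigma_at_additive.
pose f i j := place n.+1 (qbin (sg E (i + j)) (i + j) j (z i j)).
have fE := @sum2_shift _ f g1 g2 n.+1.
rewrite [S n.+1]fE /f; last first.
  case=> [|i] [|j].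
  - by rewrite addr0 place_neq.
  - by rewrite add0r /g2 !qbinn.
  - by rewrite addr0 /g1 !qbin0.
  rewrite (@qbinS _ _ _ i j) // place_additive addrC; congr (_ + _).
  apply: (f_equal (fun a => place n.+1 (qbin (sg E (i.+1 + j.+1) \o succn) a j
    (cyc (sg E (i.+1 + j.+1)) i.+1 (z i.+1 j.+1))))); exact: esym (addSnnS i j).
transitivity (\sum_(i < n.+1) \sum_(j < n.+1) (g1 i j + g2 i j)).
  rewrite (additive_op_sum _ _ _ (nablaT_additive C CE (n := _))); apply: eq_bigr => i _.
  rewrite (additive_op_sum _ _ _ (nablaT_additive C CE (n := _))); apply: eq_bigr => j _.
  rewrite nablaT_place.
  have -> : D (i + j) (qbin (sg E (i + j)) (i + j) j (z i j)) =
      qbin (sg E (i + j).+1 \o succn) (i + j) j (D (i + j) (z i j)).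
    apply: (qbin_nat (f := D (i + j))); first exact: nablaT_additive.
    by move=> p y pn; apply: nablaT_sigma.
  rewrite zP qD place_additive; congr (_ + _).
  rewrite /g2.
  have -> m m' (x : tower E m) : cyc (sg E m') i (place m' x) = place m' (cyc (sg E m) i x).
    have [<-|/eqP mn] := eqVneq m m'; first by rewrite !place_id.
    by rewrite !place_neq ?(additive_op0 (cD _ _ _)).
  by rewrite -(place_qbin C _ succn) place_place // addnS.
under eq_bigr => i _ do rewrite big_split /=.
rewrite big_split /=; congr (_ + _).
  apply: eq_bigr => i _; rewrite [RHS]big_ord_recr /= [X in _ = _ + X]place_neq ?addr0 //; lia.
rewrite [RHS]big_ord_recr /= [X in _ = _ + X]big1 ?addr0 // => j _.
by rewrite /g2 place_neq //; lia.
Qed.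

Lemma nabla_iter_shuffles s n : S 0 = s -> nabla_iter C CE n s = S n.
Proof. by move=> <-; elim: n => //= n ->; apply: nablaT_shuffles. Qed.

End Leibniz.
End Convolution.

(** * The algebra as a module with connection *)

Section ScalarConnection.
Context {K : fieldType} {A : algType K} {O : dga A}.
Local Notation Om1 := (Om O 1).
Local Notation Om0 := (Om O 0).

Lemma om0_lact (a : A) (b : Om0) : a <* b = (a * (b : A)) :> A.
Proof. exact: (wedge_deg0 O). Qed.

Lemma om0_ract (b : Om0) (a : A) : b *> a = ((b : A) * a) :> A.
Proof. by rewrite -(wedge_deg0 O) [LHS]gcast_id. Qed.

Definition one0 : Om0 := (1 : A).

Lemma tensor_om0 (M : bimod A) (m : M) (a : Om0) : m ⊠ a = (m *> (a : A)) ⊠ one0.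
Proof. by rewrite tensorA; congr (_ ⊠ _); rewrite om0_lact mulr1. Qed.

Lemma sigma0_bib : bibalanced (fun (a : Om0) (w : Om1) => ((a : A) <* w) ⊠ one0).
Proof.
split=> [|a b w|a w b].
- split=> [a a' w|a w w'|a b w].
  + by rewrite -tensorDl -lactDl.
  + by rewrite lactDr tensorDl.
  + by rewrite om0_ract lactM.
- by rewrite om0_lact lactM tensor_lact.
- by rewrite tensor_ract -lractA tensorA; congr (_ ⊠ _); rewrite om0_lact om0_ract mulr1 mul1r.
Qed.

Definition nabla0 (a : Om0) : (Om1 ⊗ Om0)%B := da O (a : A) ⊠ one0.
Definition sigma0 : (Om0 ⊗ Om1)%B -> (Om1 ⊗ Om0)%B :=
  tlift (fun (a : Om0) (w : Om1) => ((a : A) <* w) ⊠ one0).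

Lemma sigma0E (a : Om0) (w : Om1) : sigma0 (a ⊠ w) = ((a : A) <* w) ⊠ one0.
Proof. by rewrite /sigma0 (tliftE (bib_bal sigma0_bib)). Qed.

Lemma da_lin : linear (da O).
Proof. by move=> c a b; apply: (@dga_d_lin K A O 0 c a b). Qed.

Lemma nabla0_lin : linear nabla0.
Proof. by move=> c a b; rewrite /nabla0 da_lin tensorDl tensorZl. Qed.

Lemma nabla0_lact a (s : Om0) : nabla0 (a <* s) = da O a ⊠ s + a <* nabla0 s.
Proof.
rewrite /nabla0 om0_lact da_mul tensorDl tensor_lact; congr (_ + _).
by rewrite [RHS]tensor_om0.
Qed.

Lemma nabla0_ract (s : Om0) a : nabla0 (s *> a) = nabla0 s *> a + sigma0 (s ⊠ da O a).
Proof.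
rewrite /nabla0 om0_ract da_mul tensorDl sigma0E tensor_ract; congr (_ + _).
by rewrite [RHS]tensor_om0 om0_ract mul1r.
Qed.

(** The exterior derivative a |-> da ⊗ 1 with the braiding a ⊗ w |-> a w ⊗ 1. *)
Definition conn0 : bimod_conn O Om0 :=
  BimodConn nabla0_lin (tlift_map sigma0_bib) nabla0_lact nabla0_ract.

Lemma nabla_conn0 (a : Om0) : nabla conn0 a = da O (a : A) ⊠ one0.
Proof. by []. Qed.

Lemma sigma_conn0 (a : Om0) w : sigma conn0 (a ⊠ w) = ((a : A) <* w) ⊠ one0.
Proof. exact: sigma0E. Qed.

Lemma nabla_conn0_one : nabla conn0 one0 = 0.
Proof. by rewrite nabla_conn0 da1 tensor0l. Qed.

Lemma flat_conn0 : flat_conn conn0.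
Proof.
move=> a; rewrite nabla_conn0 dnablaE; last exact: nabla_left.
rewrite nabla_conn0_one tensor0r (bmap0 (wedge12_map O _)) subr0.
by rewrite /d1 /da (dga_dd (d := O)) tensor0l.
Qed.

End ScalarConnection.

(** * The left and right actions *)

Section Instances.
Context {K : fieldType} {A : algType K} {O : dga A} (C : bimod_conn O (Om O 1)).
Local Notation Om1 := (Om O 1).
Local Notation Om0 := (Om O 0).
Local Notation tower := (tower O).
Local Notation sg X n := (fun p => @sigma_at K A O C X p n).
Local Notation wd X n p := (@wedge_at K A O X p n).

Section Left.
Variable E : bimod A.

Definition lgact j : (Om0 ⊗ tower E j)%B -> tower E j :=
  tlift (fun (a : Om0) x => (a : A) <* x).

Lemma lgact_map j : bimod_map (@lgact j).
Proof. exact/tlift_map/lact_bib. Qed.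

Lemma lgactE j (a : Om0) (x : tower E j) : lgact (a ⊠ x) = (a : A) <* x.
Proof. by rewrite /lgact (tliftE (bib_bal (lact_bib O _))). Qed.

(** Bimodule maps commute with the left action by scalars; the map g is the
    action on the target, left abstract so that it may be given in several forms. *)
Lemma lgact_bmap i (P : bimod A) (f : tower E i -> P) (g : (Om0 ⊗ P)%B -> P) t :
  bimod_map f -> bimod_map g -> (forall (a : Om0) y, g (a ⊠ y) = (a : A) <* y) ->
  f (@lgact i t) = g (idt f t).
Proof.
have lM := @lgact_map i.
move=> fM gM gE; move: t; apply: tensor_ext => [||a x]; [addop | addop |].
by rewrite lgactE (bmapl fM) idtE // gE.
Qed.

Lemma lgact_sigma j p t : (p.+1 < j)%N ->
  lgact (idt (sg E j p) t) = sg E j p (lgact t).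
Proof.
move=> _; symmetry; apply: lgact_bmap; [bmap | exact: lgact_map | exact: lgactE].
Qed.

Lemma lgact_wedge j p : (p.+1 < j)%N ->
  factors (idt (wd E j p)) (fun t : (Om0 ⊗ tower E j)%B => wd E j p (lgact t)).
Proof.
have lB := lact_bib O (wedge_cod O E p j).
move=> _; exists (tlift (fun (a : Om0) x => (a : A) <* x)); first exact: tlift_map.
move=> t; apply: lgact_bmap; [bmap | exact: tlift_map |].
by move=> a y; rewrite (tliftE (bib_bal lB)).
Qed.

Definition left_action : gaction C Om0 E E := GAction lgact_map lgact_sigma lgact_wedge.

End Left.

Section Right.
Variables (E : bimod A) (CE : bimod_conn O E).
Hypotheses (CE_leibniz : leibniz_compatible C CE) (CE_extendable : extendable CE).

(** The braiding sigma_E^j, with the trailing scalar multiplied into E. *)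
Fixpoint rgact j : (E ⊗ tower Om0 j)%B -> tower E j :=
  match j return (E ⊗ tower Om0 j)%B -> tower E j with
  | 0 => tlift (fun s (a : Om0) => s *> (a : A))
  | j'.+1 => fun t => idt (@rgact j') (braid12 (sigma CE) t)
  end.

Lemma rgact0E s (a : Om0) : @rgact 0 (s ⊠ a) = s *> (a : A).
Proof. by rewrite /= (tliftE (bib_bal (ract_bib O _))). Qed.

Lemma rgact_map j : bimod_map (@rgact j).
Proof.
elim: j => [|j IH] /=; first exact/tlift_map/ract_bib.
exact: (bimod_map_comp (idt_map _ IH) (braid12_map _ (sigma_map CE))).
Qed.

Lemma rgactS j t : @rgact j.+1 t = idt (@rgact j) (braid12 (sigma CE) t).
Proof. by []. Qed.

#[local] Hint Extern 1 (bimod_map (@rgact ?j)) => exact (rgact_map j) : bmap.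

Lemma rgact_sigma j p t : (p.+1 < j)%N ->
  rgact (idt (sg Om0 j p) t) = sg E j p (rgact t).
Proof.
elim: j p t => // j IH [|p] t pj.
  case: j {IH} t pj => // j t _.
  have h (x : (E ⊗ tower Om0 j.+2)%B) : rgact x =
      idt (idt (@rgact j)) (idt (braid12 (sigma CE)) (braid12 (sigma CE) x)).
    by rewrite rgactS idt_comp; bmap.
  rewrite !h [LHS](_ : _ = idt (idt (@rgact j)) (idt (braid12 (sigma CE))
    (braid12 (sigma CE) (idt (braid12 (sigma C)) t)))) //.
  by rewrite -coloured_braid // -braid12_idt //; bmap.
have h := rgact_map j; have h' := sigma_at_map C Om0 p j; have h'' := sigma_at_map C E p j.
rewrite rgactS [in LHS](_ : sg Om0 j.+1 p.+1 = idt (sg Om0 j p)) //.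
rewrite braid12_idt; [|bmap|done].
rewrite rgactS -[RHS]/(idt (sg E j p) (idt (@rgact j) (braid12 (sigma CE) t))).
rewrite !idt_comp; try bmap.
by congr (idt _ _); apply/funext => y; apply: IH.
Qed.

Lemma rgact_wedge j p : (p.+1 < j)%N ->
  factors (idt (wd Om0 j p)) (fun t : (E ⊗ tower Om0 j)%B => wd E j p (rgact t)).
Proof.
elim: j p => // j IH [|p] pj.
  case: j {IH} pj => // j _; have [T TM TE] := extend_wedge12 CE_extendable.
  exists (fun t => idt (@rgact j) (braid12 T t)).
    by apply: (bimod_map_comp (idt_map _ (rgact_map j))); bmap.
  move=> t; rewrite -TE -wedge12_idt; last bmap.
  by congr (wedge12 _); rewrite idt_comp; bmap.
have [h hM hE] := IH p pj; exists (fun t => idt h (braid12 (sigma CE) t)).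
  by apply: bimod_map_comp; bmap.
move=> t; rewrite rgactS wedge_atS idt_comp; try bmap.
rewrite [in RHS](_ : wd Om0 j.+1 p.+1 = idt (wd Om0 j p)) // braid12_idt; try bmap.
by rewrite idt_comp; try bmap; congr (idt _ _); apply/funext.
Qed.

Definition right_action : gaction C E Om0 E := GAction rgact_map rgact_sigma rgact_wedge.

Lemma join_right_assoc j k s (y : tower Om0 j) (w : tower Om0 k) :
  join right_action (gact right_action (s ⊠ y) ⊠ w) =
  gact right_action (s ⊠ join (left_action Om0) (y ⊠ w)).
Proof.
have jM i l := join_map right_action i l.
have lM i l := join_map (left_action Om0) i l.
elim: j s y => [|j IH] s y.
  transitivity (@rgact k (@rgact 0 (s ⊠ y) ⊠ w)) => //.
  transitivity (@rgact k (s ⊠ lgact (y ⊠ w))) => //.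
  by rewrite rgact0E lgactE tensorA.
move: y; apply: tensor_ext => [||x y].
- apply: comp_additive; first exact/bmap_additive/jM.
  apply: comp_tensorl_additive; apply: comp_additive; first exact/bmap_additive/rgact_map.
  exact: tensorr_additive.
- apply: comp_additive; first exact/bmap_additive/rgact_map.
  apply: comp_additive; first exact: tensorr_additive.
  apply: comp_additive; first exact/bmap_additive/lM.
  exact: tensorl_additive.
rewrite joinS.
transitivity (join right_action (@rgact j.+1 (s ⊠ x ⊠ y) ⊠ w)) => //.
transitivity (@rgact (j + k).+1 (s ⊠ x ⊠ join (left_action Om0) (y ⊠ w))) => //.
rewrite !rgactS !braid12E; try bmap.
move: (sigma CE (s ⊠ x)); apply: tensor_ext => [||z r].
- apply: comp_additive; first exact/bmap_additive/jM.
  by apply: comp_tensorl_additive; addop.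
- by addop.
by rewrite !tassocE !idtE ?joinS ?[join _ _]IH //; bmap.
Qed.

End Right.

Lemma join_left_assoc E F G (mu : gaction C E F G) j k (a : Om0) (y : tower E j) (w : tower F k) :
  join mu (gact (left_action E) (a ⊠ y) ⊠ w) = gact (left_action G) (a ⊠ join mu (y ⊠ w)).
Proof.
by rewrite [gact (left_action E) _]lgactE [RHS]lgactE -tensor_lact (bmapl (join_map _ _ _)).
Qed.

Section JoinLeibniz.
Variables (X Y Z : bimod A) (mu : gaction C X Y Z).
Variables (CX : bimod_conn O X) (CY : bimod_conn O Y) (CZ : bimod_conn O Z).
Hypothesis mu_leibniz : forall j x (y : tower Y j),
  nablaT C CZ (gact mu (x ⊠ y)) =
  @join _ _ _ _ _ _ _ mu 1 j (nabla CX x ⊠ y) + gact mu (x ⊠ nablaT C CY y).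

(** The derivative of a concatenation: when it falls on v, the new form appears at
    position i and the braid [cyc] carries it to the front. *)
Lemma join_leibniz i j (u : tower X i) (v : tower Y j) :
  nablaT C CZ (join mu (u ⊠ v)) = join mu (nablaT C CX u ⊠ v)
  + cyc (sg Z (i + j).+1) i (place (i + j).+1 (join mu (u ⊠ nablaT C CY v))).
Proof.
have jM i' j' := join_map mu i' j'.
have ZD := nablaT_additive C CZ; have XD := nablaT_additive C CX.
elim: i u => [|i IH] u; first by rewrite mu_leibniz [place _ _]place_id.
have cD m r : additive_op (cyc (sg Z m) r).
  by apply: cyc_additive => p; exact: sigma_at_additive.
move: u; apply: (@tensor_ext K A Om1 (tower X i)) => [||w u].
- apply: comp_additive; first exact: ZD.
  by apply: comp_additive; [exact/bmap_additive/jM | exact: tensorl_additive].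
- move=> u u'; rewrite XD !tensorDl !(bmapD (jM _ _)) place_additive cD; exact: addrACA.
rewrite !joinS [nablaT C CZ _](nablaT_tensor C CZ w (join mu (u ⊠ v))) IH.
rewrite (nablaT_tensor C CX w u).
rewrite tensorDl (bmapD (jM _ _)) join_tassoc -addrA; congr (_ + _).
rewrite tensorDr (bmapD (braid12_map _ (sigma_map _))); congr (_ + _).
  rewrite -[braid12 _ (w ⊠ nablaT C CX u)]sigma_at0.
  rewrite [RHS](@join_sigma_l _ _ _ _ _ _ _ mu i.+2 j 0) //.
  by rewrite [in RHS]joinS.
rewrite placeS cycS -[LHS]sigma_at0; congr (sigma_at _ _ _).
apply: (cyc_nat (f := fun y => w ⊠ y)) => p y _.
exact: esym (idtE _ _ (sigma_at_map C Z p (i + j).+1)).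
Qed.

End JoinLeibniz.

Lemma left_action_leibniz E (CE : bimod_conn O E) j (a : Om0) (y : tower E j) :
  nablaT C CE (gact (left_action E) (a ⊠ y)) =
  @join _ _ _ _ _ _ _ (left_action E) 1 j (nabla conn0 a ⊠ y)
  + gact (left_action E) (a ⊠ nablaT C CE y).
Proof.
rewrite [gact _ _]lgactE [X in _ = _ + X]lgactE (left_connl (nablaT_left C CE j)).
congr (_ + _); rewrite nabla_conn0 joinS; congr (_ ⊠ _).
by rewrite [RHS]lgactE lact1.
Qed.

(** By induction on j from Leibniz compatibility of E: differentiating after s has
    been moved to the right equals moving it after differentiating. *)
Lemma right_action_leibniz E (CE : bimod_conn O E) (CL : leibniz_compatible C CE)
    (CX : extendable CE) j s (y : tower Om0 j) :
  nablaT C CE (gact (right_action CL CX) (s ⊠ y)) =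
  @join _ _ _ _ _ _ _ (right_action CL CX) 1 j (nabla CE s ⊠ y)
  + gact (right_action CL CX) (s ⊠ nablaT C conn0 y).
Proof.
rewrite [gact _ _](_ : _ = @rgact E CE j (s ⊠ y)) //.
rewrite [X in _ = _ + X](_ : _ = @rgact E CE j.+1 (s ⊠ nablaT C conn0 y)) //.
rewrite [X in _ = X + _](_ : _ = idt (@rgact E CE j) (tassoc (nabla CE s ⊠ y))) //.
have rM i := rgact_map CE i; have aL i := nablaT_left C (@conn0 K A O) i.
have eL i := nablaT_left C CE i.
suff main (t : (E ⊗ tower Om0 j)%B) : nablaT C CE (rgact CE t) =
    idt (@rgact E CE j) (tnabla CE (nablaT C conn0 (n := j)) t).
  by rewrite main tnablaE // (bmapD (idt_map _ (rM j))).
elim: j t {y} => [|j IH] t.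
  move: t; apply: tensor_ext => [||x a].
  - apply: comp_additive; [exact: nablaT_additive | exact: bmap_additive (rM 0)].
  - apply: comp_additive; [exact: bmap_additive (idt_map _ (rM 0)) | exact: tnabla_additive].
  rewrite rgact0E [LHS]nabla_ract tnablaE // (bmapD (idt_map _ (rM 0))).
  rewrite [nablaT C conn0 a]nabla_conn0 braid12E; last bmap.
  have h (z : (Om1 ⊗ E)%B) (b : Om0) : idt (@rgact E CE 0) (tassoc (z ⊠ b)) = z *> (b : A).
    move: z; apply: tensor_ext => [||v r].
    - by apply: comp_additive; [exact: bmap_additive (idt_map _ (rM 0)) | addop].
    - by move=> ? ?; apply: ractDl.
    by rewrite tassocE idtE ?rgact0E ?tensor_ract.
  by rewrite !h ract1.
rewrite rgactS.
transitivity (tnabla C (@nablaT _ _ _ C E CE j) (idt (@rgact E CE j) (braid12 (sigma CE) t))) => //.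
rewrite (tnabla_idt _ _ (tnabla_leftP CE (aL j)) (eL j) (rM j) IH).
rewrite tnabla_braid // idt_comp; [|exact/idt_map/rM|bmap].
by congr (idt _ _).
Qed.

End Instances.

(** * Iterated derivatives *)

Section Jets.
Context {K : fieldType} {A : algType K} {O : dga A} (C : bimod_conn O (Om O 1)).
Local Notation Om1 := (Om O 1).
Local Notation Om0 := (Om O 0).
Local Notation tower := (tower O).
Local Notation tpow := (tpow O).

Section AppendOne.

Lemma tensor_one_map : bimod_map (fun w : Om1 => w ⊠ @one0 K A O).
Proof.
split=> [c x y|a x|x a].
- by rewrite tensorDl tensorZl.
- by rewrite tensor_lact.
- by rewrite tensor_ract [RHS]tensor_om0 om0_ract mul1r.
Qed.

(** The identification of (Omega^1)^(m+1) with (Omega^1)^(m+1) ⊗ A. *)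
Fixpoint append1 m : tower Om1 m -> tower Om0 m.+1 :=
  match m return tower Om1 m -> tower Om0 m.+1 with
  | 0 => fun w => w ⊠ @one0 K A O
  | m'.+1 => idt (@append1 m')
  end.

Lemma append1_map m : bimod_map (@append1 m).
Proof. by elim: m => [|m IH] /=; [apply: tensor_one_map | apply: idt_map]. Qed.

Lemma append1_nabla m (u : tower Om1 m) :
  nablaT C conn0 (append1 u) = append1 (nablaT C C u).
Proof.
elim: m u => [|m IH] u.
  rewrite [LHS](nablaT_tensor C conn0 (n := 0) u one0).
  rewrite [nablaT C conn0 (n := 0) _]nabla_conn0_one tensor0r.
  rewrite (bmap0 (braid12_map _ (sigma_map _))) addr0 -[nablaT C C u]/(nabla C u).
  move: (nabla C u); apply: tensor_ext => [||x y].
  - by addop.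
  - exact/bmap_additive/idt_map/tensor_one_map.
  by rewrite tassocE; apply: esym (idtE _ _ tensor_one_map).
transitivity (tnabla C (nablaT C conn0 (n := m.+1)) (idt (@append1 m) u)) => //.
rewrite (tnabla_idt _ _ (nablaT_left C C m) (nablaT_left C conn0 m.+1)) //.
exact: append1_map.
Qed.

Lemma nabla_iter_append1 m a :
  nabla_iter C conn0 m.+1 a = append1 (nabla_iter C C m (da O a)).
Proof.
elim: m => [|m IH]; first exact: nabla_conn0.
by rewrite -[RHS](append1_nabla (nabla_iter C C m (da O a))) -IH.
Qed.

Lemma tcatE E m j a (x : tower E j) :
  tcat (nabla_pow C m a ⊠ x) = join (left_action C E) (nabla_iter C conn0 m a ⊠ x).
Proof.
case: m => [//|m]; rewrite nabla_iter_append1 /nabla_pow.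
move: (nabla_iter C C m (da O a)); rewrite /tcat; elim: m => [|m IH] u.
  transitivity (u ⊠ lgact (one0 ⊠ x)); first by rewrite lgactE lact1.
  exact: esym (joinS (left_action C E) (i := 0) u one0 x).
have jM i l := join_map (left_action C E) i l; have aM := append1_map m.
have cM : bimod_map (@tcatT K A O E m j) := tcat_map O E m.+1 j.
move: u; apply: (@tensor_ext K A Om1 (tower Om1 m)) => [||w u].
- apply: comp_additive; first exact: bmap_additive (tcat_map O E m.+2 j).
  exact: tensorl_additive.
- apply: comp_additive; first exact/bmap_additive/jM.
  by apply: comp_tensorl_additive; exact: bmap_additive (append1_map m.+1).
rewrite [append1 _](idtE _ _ aM) joinS -IH.
rewrite -[LHS]/(idt (@tcatT K A O E m j) (tassoc ((w ⊠ u) ⊠ x))).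
by rewrite tassocE idtE.
Qed.

(** The product of the statement is the one attached to the left action of A. *)
Lemma odotlE E m j a (x : tower E j) :
  odotl C (nabla_pow C m a) x = gmul (left_action C E) (nabla_iter C conn0 m a) x.
Proof. by rewrite /odotl tcatE bbinomE. Qed.

Section RightOdot.
Variables (E : bimod A) (CE : bimod_conn O E).
Hypotheses (CE_leibniz : leibniz_compatible C CE) (CE_extendable : extendable CE).
Local Notation R := (right_action CE_leibniz CE_extendable).

Lemma sigmaT_rgact m t : @sigmaT K A O E CE m t = @rgact K A O E CE m.+1 (idt (@append1 m) t).
Proof.
have eM := sigma_map CE; have rM := rgact_map CE; have aM := append1_map.
elim: m t => [|m IH] t.
  move: t; apply: tensor_ext => [||s w].
  - by addop.
  - apply: comp_additive; first exact: bmap_additive (rM 1).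
    exact: bmap_additive (idt_map _ (aM 0)).
  rewrite (idtE _ _ (aM 0)) rgactS braid12E //=.
  move: (sigma CE (s ⊠ w)); apply: tensor_ext => [||v r] //.
    apply: comp_additive; first exact: bmap_additive (idt_map _ (rM 0)).
    by addop.
  by rewrite tassocE (idtE _ _ (rM 0)) rgact0E ract1.
rewrite rgactS [idt (append1 (m := m.+1)) t](_ : _ = idt (idt (@append1 m)) t) //.
rewrite (braid12_idt _ eM (aM m)) (idt_comp _ (rM m.+1) (idt_map E (aM m))).
by rewrite -[LHS]/(idt (@sigmaT K A O E CE m) (braid12 (sigma CE) t)); congr (idt _ _); apply/funext.
Qed.

Lemma sigma_catE j m a (x : tower E j) :
  sigma_cat CE (x ⊠ nabla_pow C m a) = join R (x ⊠ nabla_iter C conn0 m a).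
Proof.
have jM i l := join_map R i l; have cM i l := sigma_cat_map CE i l.
elim: j x => [|j IH] x.
  case: m => [//|m]; rewrite nabla_iter_append1.
  rewrite [LHS]sigmaT_rgact (idtE _ _ (append1_map m)) //.
move: x; apply: (@tensor_ext K A Om1 (tower E j)) => [||w x].
- apply: comp_additive; first exact/bmap_additive/cM.
  exact: tensorl_additive.
- apply: comp_additive; first exact/bmap_additive/jM.
  exact: tensorl_additive.
rewrite joinS -IH -[LHS]/(idt (@sigma_cat K A O E CE j m) (tassoc ((w ⊠ x) ⊠ nabla_pow C m a))).
by rewrite tassocE idtE.
Qed.

Lemma odotrE j m a (x : tower E j) :
  odotr C CE x (nabla_pow C m a) = gmul R x (nabla_iter C conn0 m a).
Proof. by rewrite /odotr sigma_catE bbinomE. Qed.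

End RightOdot.
End AppendOne.

Section Leibniz.
Hypotheses (C_leibniz : leibniz_compatible C C).
Variables (E : bimod A) (CE : bimod_conn O E).
Hypotheses (CE_leibniz : leibniz_compatible C CE) (CE_extendable : extendable CE).
Local Notation R := (right_action CE_leibniz CE_extendable).
Local Notation D0 a := (fun n => nabla_iter C (@conn0 K A O) n a).
Local Notation DE s := (fun n => nabla_iter C CE n s).

(** The Leibniz rule for iterated derivatives: it makes j^k left linear and, for
    E = A, the map a |-> (nabla^n a)_n multiplicative. *)
Lemma nabla_iter_lact a s n :
  nabla_iter C CE n (a <* s) = conv (left_action C E) (D0 a) (DE s) n.
Proof.
apply: (nabla_iter_shuffles C_leibniz
  (z := fun i j => join (left_action C E) (nabla_iter C conn0 i a ⊠ nabla_iter C CE j s))).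
  by move=> i j; rewrite (join_leibniz (CX := conn0) (CY := CE)) //; apply: left_action_leibniz.
by rewrite !big_ord1 place_id qbin0 [join _ _]lgactE.
Qed.

Lemma nabla_iter_ract s a n :
  nabla_iter C CE n (s *> a) = conv R (DE s) (D0 a) n.
Proof.
apply: (nabla_iter_shuffles C_leibniz
  (z := fun i j => join R (nabla_iter C CE i s ⊠ nabla_iter C conn0 j a))).
  by move=> i j; rewrite (join_leibniz (CX := CE) (CY := conn0)) //; apply: right_action_leibniz.
by rewrite !big_ord1 place_id qbin0 [join _ _]rgact0E.
Qed.

Lemma nabla_iter_lin n : linear (fun s => nabla_iter C CE n s).
Proof.
elim: n => // n IH c x y; rewrite /= IH (nablaT_additive C CE).
congr (_ + _); rewrite [in LHS]scale_lact (left_connl (nablaT_left C CE n)).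
have -> : da O (c *: 1) = 0.
  rewrite -[c *: 1]addr0 da_lin da1 scaler0 add0r.
  exact: (@additive_op0 A (Om O 1) (da O) (@daD K A O)).
by rewrite tensor0l add0r -scale_lact.
Qed.

Lemma nabla_iter_one i : i <> 0%N -> nabla_iter C (@conn0 K A O) i 1 = 0.
Proof.
case: i => // i _; elim: i => [|i IH]; first exact: nabla_conn0_one.
rewrite [LHS](congr1 (@nablaT _ _ _ C _ conn0 i.+1) IH).
exact: additive_op0 (nablaT_additive C conn0 (n := i.+1)).
Qed.

(** Since d1 = 0, the sequence of derivatives of 1 is concentrated in degree 0. *)
Lemma left_unit x n : conv (left_action C E) (D0 1) x n = x n.
Proof.
rewrite (conv_homogl _ _ (i := 0)) //; last exact: nabla_iter_one.
rewrite (sum_place_id (F := id) (m := n) (fun j => gmul (left_action C E) (nabla_iter C conn0 0 1) (x j))) //.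
by rewrite place_id /gmul qbinn [join _ _]lgactE lact1.
Qed.

Lemma right_unit x n : conv R x (D0 1) n = x n.
Proof.
rewrite (conv_homogr _ _ (j := 0)) //; last exact: nabla_iter_one.
rewrite (sum_place_id (F := addn^~ 0) (m := n) (fun i => gmul R (x i) (nabla_iter C conn0 0 1))) ?addn0 //; last first.
  by move=> i j; rewrite !addn0.
rewrite /gmul qbin0; elim: n (x n) => [|n IH] y.
  by rewrite place_id [join _ _]rgact0E ract1.
move: y; apply: (@tensor_ext K A Om1 (tower E n)) => [||w y] //.
  apply: comp_additive; first exact: place_additive.
  apply: comp_additive; first exact/bmap_additive/join_map.
  exact: tensorl_additive.
by rewrite joinS placeS IH.
Qed.

End Leibniz.
End Jets.

(** * Jet bimodules *)

Section JetBimodules.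
Context {K : fieldType} {A : algType K} {O : dga A} (C : bimod_conn O (Om O 1)).
Context {E : bimod A} (CE : bimod_conn O E).
Local Notation tower := (tower O).
Local Notation Om0 := (Om O 0).
Hypotheses (C_torsion_free : torsion_free C) (C_flat : flat_conn C)
    (C_wedge : wedge_compatible C) (C_extendable : extendable C)
    (C_leibniz : leibniz_compatible C C)
    (CE_flat : flat_conn CE) (CE_extendable : extendable CE)
    (CE_leibniz : leibniz_compatible C CE).
Variable X : sym_model O E.
Hypotheses (iota_lin : forall n, linear (@sym_iota _ _ _ _ X n)) (X_sym : sym_identified X).

Local Notation L := (left_action C E).
Local Notation R := (right_action CE_leibniz CE_extendable).
Local Notation D0 a := (fun n => nabla_iter C (@conn0 K A O) n a).
Local Notation DE s := (fun n => nabla_iter C CE n s).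
Local Notation iota := (@sym_iota _ _ _ _ X _).

Definition symmetric_seq (Y : bimod A) (v : forall n, tower Y n) :=
  forall n p, (p.+1 < n)%N -> wedge_at p (v n) = 0.

Lemma symEP n (y : tower E n) :
  y \in sub_pred (symE O E n) <-> forall p, (p.+1 < n)%N -> wedge_at p y = 0.
Proof. by split=> [/asboolP|h] //; apply/asboolP. Qed.

Lemma iotaI n : injective (@sym_iota _ _ _ _ X n).
Proof. by have [] := X_sym n. Qed.

Lemma iota_additive n : additive_op (@sym_iota _ _ _ _ X n).
Proof. by move=> x y; have := iota_lin 1 x y; rewrite !scale1r. Qed.

Lemma iotaZ n c (x : X n) : iota (c *: x) = c *: iota x.
Proof. by have := iota_lin c x 0; rewrite !addr0 (additive_op0 (@iota_additive n)) addr0. Qed.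

Lemma iota_sym n p (x : X n) : (p.+1 < n)%N -> wedge_at p (iota x) = 0.
Proof. by move: p; apply/symEP; have [_ h] := X_sym n; apply/h; exists x. Qed.

Definition iota_inv n (y : tower E n) : X n :=
  if pselect (exists x, @sym_iota _ _ _ _ X n x = y) is left e then projT1 (cid e) else 0.

Lemma iota_invK (v : forall n, tower E n) n : symmetric_seq v -> iota (iota_inv (v n)) = v n.
Proof.
move=> vS; rewrite /iota_inv; case: pselect => [e|[]]; first exact: projT2 (cid e).
by have [_ h] := X_sym n; apply/h/symEP => p; apply: vS.
Qed.

(** A jet as a sequence of tensors, zero above degree k. *)
Definition jet_seq k (x : jet X k) n : tower E n :=
  if @idP (n < k.+1)%N is ReflectT h then iota (x (Ordinal h)) else 0.

Lemma jet_seqE k (x : jet X k) (i : 'I_k.+1) : jet_seq x i = iota (x i).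
Proof.
case: i => i hi; rewrite /jet_seq /=; case: {-}_ / idP => // h.
by rewrite (bool_irrelevance h hi).
Qed.

Lemma jet_seq_sym k (x : jet X k) : symmetric_seq (jet_seq x).
Proof.
move=> n p pn; rewrite /jet_seq; case: {-}_ / idP => [h|_]; first exact: iota_sym.
exact: bmap0 (wedge_at_map _ _ _ _).
Qed.

Lemma jet_seqD k (x y : jet X k) n : jet_seq (x + y) n = jet_seq x n + jet_seq y n.
Proof.
rewrite /jet_seq; case: {-}_ / idP => [h|_]; first exact: iota_additive.
by rewrite addr0.
Qed.

Lemma jet_seqZ k c (x : jet X k) n : jet_seq (c *: x) n = c *: jet_seq x n.
Proof.
rewrite /jet_seq; case: {-}_ / idP => [h|_]; first exact: iotaZ.
by rewrite scaler0.
Qed.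

Definition jet_of k (v : forall n, tower E n) : jet X k := fun i => iota_inv (v i).

Lemma jet_ofE k v (i : 'I_k.+1) : symmetric_seq v -> iota (@jet_of k v i) = v i.
Proof. exact: iota_invK. Qed.

Lemma jet_of_seq k v n : symmetric_seq v -> (n <= k)%N -> jet_seq (@jet_of k v) n = v n.
Proof.
by move=> vS nk; rewrite (jet_seqE _ (Ordinal (nk : (n < k.+1)%N))) jet_ofE.
Qed.

Lemma jetP k (x y : jet X k) : (forall i : 'I_k.+1, iota (x i) = iota (y i)) -> x = y.
Proof. by move=> h; apply: functional_extensionality_dep => i; apply: iotaI. Qed.

Definition jet_l k (a : A) (x : jet X k) : jet X k := @jet_of k (conv L (D0 a) (jet_seq x)).
Definition jet_r k (x : jet X k) (a : A) : jet X k := @jet_of k (conv R (jet_seq x) (D0 a)).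
Definition jet_j k (s : E) : jet X k := @jet_of k (DE s).

Lemma D0_sym a : symmetric_seq (D0 a).
Proof. by move=> n p pn; apply: nabla_iter_sym => //; apply: flat_conn0. Qed.

Lemma DE_sym s : symmetric_seq (DE s).
Proof. by move=> n p pn; apply: nabla_iter_sym. Qed.

Lemma left_sym a v : symmetric_seq v -> symmetric_seq (conv L (D0 a) v).
Proof. by move=> vS n p pn; apply: conv_sym => // i q; apply: D0_sym. Qed.

Lemma right_sym v a : symmetric_seq v -> symmetric_seq (conv R v (D0 a)).
Proof. by move=> vS n p pn; apply: conv_sym => // i q; apply: D0_sym. Qed.

Lemma jet_lE k a x (i : 'I_k.+1) : iota (jet_l a x i) = conv L (D0 a) (jet_seq x) i.
Proof. exact/jet_ofE/left_sym/jet_seq_sym. Qed.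

Lemma jet_rE k x a (i : 'I_k.+1) : iota (jet_r x a i) = conv R (jet_seq x) (D0 a) i.
Proof. exact/jet_ofE/right_sym/jet_seq_sym. Qed.

Lemma jet_jE k s (i : 'I_k.+1) : iota (@jet_j k s i) = nabla_iter C CE i s.
Proof. exact/jet_ofE/DE_sym. Qed.

Lemma jet_seq_l k a (x : jet X k) n : (n <= k)%N ->
  jet_seq (jet_l a x) n = conv L (D0 a) (jet_seq x) n.
Proof. by apply: jet_of_seq; apply/left_sym/jet_seq_sym. Qed.

Lemma jet_seq_r k (x : jet X k) a n : (n <= k)%N ->
  jet_seq (jet_r x a) n = conv R (jet_seq x) (D0 a) n.
Proof. by apply: jet_of_seq; apply/right_sym/jet_seq_sym. Qed.

Lemma jet_seq_j k s n : (n <= k)%N -> jet_seq (@jet_j k s) n = nabla_iter C CE n s.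
Proof. by apply: jet_of_seq; apply/DE_sym. Qed.

Lemma D0D a b n : nabla_iter C (@conn0 K A O) n (a + b) = D0 a n + D0 b n.
Proof. by have := nabla_iter_lin C (@conn0 K A O) n 1 a b; rewrite !scale1r. Qed.

Lemma D0Z c a n : nabla_iter C (@conn0 K A O) n (c *: a) = c *: D0 a n.
Proof.
have n0 : nabla_iter C (@conn0 K A O) n 0 = 0.
  by apply: (@addrI _ (nabla_iter C (@conn0 K A O) n 0)); rewrite -D0D !addr0.
by have := nabla_iter_lin C (@conn0 K A O) n c a 0; rewrite !addr0 n0 addr0.
Qed.

Lemma D0M a b n : nabla_iter C (@conn0 K A O) n (a * b) = conv (left_action C Om0) (D0 a) (D0 b) n.
Proof. by rewrite -nabla_iter_lact // om0_lact. Qed.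

(** Both sides of each axiom are compared inside the tensors, where they are
    convolutions that depend only on components of degree at most that of i. *)
Lemma jet_axioms k : bimod_axioms (@jet_l k) (@jet_r k).
Proof.
have kP (i : 'I_k.+1) n : (n <= i)%N -> (n <= k)%N by have := ltn_ord i; lia.
split.
- move=> a b x; apply: jetP => i; rewrite (iota_additive (jet_l a x i)) !jet_lE -convDl.
  by apply: eq_conv => // n _; apply: D0D.
- move=> a x y; apply: jetP => i; rewrite (iota_additive (jet_l a x i)) !jet_lE -convDr.
  by apply: eq_conv => // n _; apply: jet_seqD.
- move=> c a x; apply: jetP => i; rewrite (iotaZ c (jet_l a x i)) !jet_lE -convZl.
  by apply: eq_conv => // n _; apply: D0Z.
- move=> c a x; apply: jetP => i; rewrite (iotaZ c (jet_l a x i)) !jet_lE -convZr.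
  by apply: eq_conv => // n _; apply: jet_seqZ.
- by move=> x; apply: jetP => i; rewrite jet_lE left_unit jet_seqE.
- move=> a b x; apply: jetP => i; rewrite !jet_lE.
  transitivity (conv L (conv (left_action C Om0) (D0 a) (D0 b)) (jet_seq x) i).
    by apply: eq_conv => // n _; apply: D0M.
  rewrite (conv_assoc (nu := L) (nu' := L)) //; last exact: join_left_assoc.
  by apply: eq_conv => // n ni; rewrite jet_seq_l ?(kP i).
- move=> x y a; apply: jetP => i; rewrite (iota_additive (jet_r x a i)) !jet_rE -convDl.
  by apply: eq_conv => // n _; apply: jet_seqD.
- move=> x a b; apply: jetP => i; rewrite (iota_additive (jet_r x a i)) !jet_rE -convDr.
  by apply: eq_conv => // n _; apply: D0D.
- move=> c x a; apply: jetP => i; rewrite (iotaZ c (jet_r x a i)) !jet_rE -convZl.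
  by apply: eq_conv => // n _; apply: jet_seqZ.
- move=> c x a; apply: jetP => i; rewrite (iotaZ c (jet_r x a i)) !jet_rE -convZr.
  by apply: eq_conv => // n _; apply: D0Z.
- by move=> x; apply: jetP => i; rewrite jet_rE right_unit jet_seqE.
- move=> x a b; apply: jetP => i; rewrite !jet_rE.
  transitivity (conv R (jet_seq x) (conv (left_action C Om0) (D0 a) (D0 b)) i).
    by apply: eq_conv => // n _; apply: D0M.
  rewrite -(conv_assoc (mu := R) (mu' := R)) //; last exact: join_right_assoc.
  by apply: eq_conv => // n ni; rewrite jet_seq_r ?(kP i).
move=> a x b; apply: jetP => i; rewrite jet_rE jet_lE.
transitivity (conv R (conv L (D0 a) (jet_seq x)) (D0 b) i).
  by apply: eq_conv => // n ni; rewrite jet_seq_l ?(kP i).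
rewrite (conv_assoc (nu := R) (nu' := L)) //; last exact: join_left_assoc.
by apply: eq_conv => // n ni; rewrite jet_seq_r ?(kP i).
Qed.

Lemma jet_j_map k : bimod_map_for (@lact K A E) (@ract K A E) (@jet_l k) (@jet_r k) (@jet_j k).
Proof.
have kP (i : 'I_k.+1) n : (n <= i)%N -> (n <= k)%N by have := ltn_ord i; lia.
split.
- move=> c s t; apply: jetP => i.
  rewrite (iota_additive ((c *: @jet_j k s) i)) (iotaZ c (@jet_j k s i)) !jet_jE.
  exact: nabla_iter_lin.
- move=> a s; apply: jetP => i; rewrite jet_jE jet_lE nabla_iter_lact //.
  by apply: eq_conv => // n ni; rewrite jet_seq_j ?(kP i).
- move=> s a; apply: jetP => i.
  rewrite jet_jE jet_rE (nabla_iter_ract C_leibniz CE_leibniz CE_extendable).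
  by apply: eq_conv => // n ni; rewrite jet_seq_j ?(kP i).
Qed.

Lemma jet_seq_homog k (j : 'I_k.+1) (x : jet X k) (n : nat) : homog j x -> n <> j -> jet_seq x n = 0.
Proof.
move=> xj nj; rewrite /jet_seq; case: {-}_ / idP => // h.
rewrite xj; first exact: additive_op0 (@iota_additive n).
by apply/eqP => e; apply: nj; apply: (congr1 (@nat_of_ord _) e).
Qed.

Lemma conv_low (Y Z W : bimod A) (mu : gaction C Y Z W) u v n :
  (forall i j, (i + j)%N = n -> gmul mu (u i) (v j) = 0) -> conv mu u v n = 0.
Proof.
move=> h; apply: big1 => i _; apply: big1 => j _.
have [e|/eqP e] := eqVneq (i + j)%N n; last exact: place_neq.
by rewrite h // place0.
Qed.

Lemma jet_l_action k : left_jet_action C (@jet_l k).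
Proof.
move=> a j x xj; split=> [i ij|m h].
  apply: iotaI; rewrite jet_lE (additive_op0 (@iota_additive _)).
  apply: conv_low => p q e; rewrite (jet_seq_homog xj) ?gmul0r //; lia.
rewrite jet_lE odotlE (conv_homogr L _ (j := j)) => [|q qj|]; first last.
- exact: leq_addl.
- exact: jet_seq_homog qj.
rewrite (sum_place_id (F := addn^~ (j : nat)) (m := m)
  (fun p => gmul L (nabla_iter C conn0 p a) (jet_seq x j))) //.
- by rewrite jet_seqE [LHS]place_id.
- by move=> p q /addIn.
- by rewrite /=; lia.
Qed.

Lemma jet_r_action k : right_jet_action C CE (@jet_r k).
Proof.
move=> a j x xj; split=> [i ij|m h].
  apply: iotaI; rewrite jet_rE (additive_op0 (@iota_additive _)).
  apply: conv_low => p q e; rewrite (jet_seq_homog xj) ?gmul0l //; lia.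
rewrite jet_rE (odotrE CE_leibniz CE_extendable) (conv_homogl R _ (i := j)) => [|q qj|]; first last.
- exact: leq_addr.
- exact: jet_seq_homog qj.
rewrite (sum_place_id (F := addn (j : nat)) (m := m)
  (fun p => gmul R (jet_seq x j) (nabla_iter C conn0 p a))) //.
- by rewrite jet_seqE [LHS]place_id.
- by move=> p q /addnI.
- by rewrite /=; lia.
Qed.

Lemma jet_seq_pi k (x : jet X k.+1) n : (n <= k)%N -> jet_seq (jet_pi x) n = jet_seq x n.
Proof.
move=> nk; rewrite (jet_seqE _ (Ordinal (nk : (n < k.+1)%N))).
by rewrite -(jet_seqE x (widen_ord (leqnSn k.+1) (Ordinal (nk : (n < k.+1)%N)))).
Qed.

Lemma jet_pi_map k :
  bimod_map_for (@jet_l k.+1) (@jet_r k.+1) (@jet_l k) (@jet_r k) (@jet_pi K X k).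
Proof.
have kP (i : 'I_k.+1) n : (n <= i)%N -> (n <= k)%N by have := ltn_ord i; lia.
split=> [c x y|a x|x a] //; apply: jetP => i.
  rewrite -[LHS]/(iota (jet_l a x (widen_ord (leqnSn k.+1) i))) !jet_lE.
  apply: eq_conv => // n ni.
  by rewrite jet_seq_pi ?(kP i).
rewrite -[LHS]/(iota (jet_r x a (widen_ord (leqnSn k.+1) i))) !jet_rE.
apply: eq_conv => // n ni.
by rewrite jet_seq_pi ?(kP i).
Qed.

Lemma jet_pi_surj k (y : jet X k) : exists x, jet_pi x = y.
Proof.
exists (@jet_of k.+1 (jet_seq y)); apply: jetP => i.
rewrite -[iota (y i)]jet_seqE; exact: (jet_ofE (widen_ord _ i) (jet_seq_sym y)).
Qed.

Lemma jet_pi_ker k (x : jet X k.+1) : jet_pi x = 0 <-> homog ord_max x.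
Proof.
split=> [x0 i im|xm].
  have ik : (i < k.+1)%N.
    by have := ltn_ord i; rewrite ltnS leq_eqVlt => /predU1P [e|//]; case/eqP: im; apply: val_inj.
  have -> : i = widen_ord (leqnSn k.+1) (Ordinal ik) by apply: val_inj.
  exact: (f_equal (fun z : jet X k => z (Ordinal ik)) x0).
apply: functional_extensionality_dep => i; apply: (xm (widen_ord (leqnSn k.+1) i)).
by apply/eqP => /(congr1 val) /=; have := ltn_ord i; lia.
Qed.

(** The argument uses only that X embeds linearly onto the symmetric tensors, so it
    covers both models of the symmetric forms with values in E. *)
Lemma jet_bimodulesP : jet_bimodules C CE X.
Proof.
exists jet_l, jet_r, jet_j; split=> k.
  split; [exact: jet_l_action | exact: jet_r_action | exact: jet_jE
    | exact: jet_axioms | exact: jet_j_map].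
split; [exact: jet_pi_map | exact: jet_pi_surj | exact: jet_pi_ker |].
by move=> s; apply: jetP => i; rewrite -[LHS]/(iota (@jet_j k.+1 s (widen_ord (leqnSn k.+1) i))) !jet_jE.
Qed.

End JetBimodules.

Theorem theorem5p9 (K : fieldType) (A : algType K) (O : dga A)
    (C : bimod_conn O (Om O 1)) (E : bimod A) (CE : bimod_conn O E)
    (C_torsion_free : torsion_free C) (C_flat : flat_conn C)
    (C_wedge : wedge_compatible C) (C_extendable : extendable C)
    (C_leibniz : leibniz_compatible C C)
    (CE_flat : flat_conn CE) (CE_extendable : extendable CE)
    (CE_leibniz : leibniz_compatible C CE) :
  jet_bimodules C CE (ker_model O E) /\
  (sym_identified (tens_model O E) -> jet_bimodules C CE (tens_model O E)).
Proof.
split=> [|XS]; apply: jet_bimodulesP => //.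
- move=> n; split=> [x y|y]; first exact: val_inj.
  split=> [yS|[x <-]]; last exact: subvalP.
  by exists (SubCar yS).
- by move=> n; have [h _ _] := tens_iota_map O E n => c x y; apply: h.
Qed.
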